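(* Let $k\in\mathbb Z_{>0}$ and $p=1+\frac{k+2}{(k+1)n}$. Let $u_0\in L^1_1(\mathbb R^n)\cap L^\infty(\mathbb R^n)$ and let $u$ be the global solution with initial datum $u_0$. Then for every $q\in[1,\infty]$ there exists $C>0$ such that $$t^{\frac n2(1-\frac1q)}\|u(t)-\widetilde{\mathcal A}_{0,k+1}(t)\|_q\le Ct^{-\frac12}\quad\text{for all }t>2^{k+1},$$ where $\widetilde{\mathcal A}_{0,k+1}(t)=\mathcal A_{0,k}(t)+\sum_{j=1}^na_j\int_1^t\Lambda_{e_j,0}\big(t;f(\mathcal A_{0,k}(s))-f(\mathcal A_{0,k-1}(s))\big)ds.$
   Context: Let $n\ge1$, $a=(a_1,\dots,a_n)\in\mathbb R^n\setminus\{0\}$, $p\in(1,\infty)$, and let $f\in C^1(\mathbb R)$, $f\not\equiv0$, $f(0)=0$, satisfy $|f(\xi)-f(\eta)|\le C(|\xi|^{p-1}+|\eta|^{p-1})|\xi-\eta|$ for all $\xi,\eta$. $\|\cdot\|_q$ is the $L^q(\mathbb R^n)$ norm; $L^1_1(\mathbb R^n)=\{\varphi\in L^1: x_j\varphi\in L^1,\ j=1,\dots,n\}$. $G_t(x)=(4\pi t)^{-n/2}e^{-|x|^2/(4t)}$, $e^{t\Delta}\varphi=G_t*\varphi$ ($t>0$). For $u_0\in L^1\cap L^\infty$, the global solution of $\partial_tu-\Delta u=a\cdot\nabla f(u)$, $u(0)=u_0$, is the unique $u\in (C\cap L^\infty)([0,\infty);L^1)\cap(C\cap L^\infty)((0,\infty);L^\infty)$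 with $u(t)=e^{t\Delta}u_0+\int_0^ta\cdot\nabla e^{(t-s)\Delta}f(u(s))ds$ for all $t>0$. Dilation $(\delta_t\varphi)(x)=t^{-n/2}\varphi(t^{-1/2}x)$; $\mathcal M_0(\varphi)=\int\varphi\,dx$; $\mathcal A_0(t)=\mathcal M_0(u_0)G_t$; $\sigma=\frac n2(p-1)-\frac12$. $\mathcal A_{0,0}=\mathcal A_0$, and for $k\ge1$, $\mathcal A_{0,k}(t)=\mathcal A_0(t)+\int_0^1a\cdot\nabla e^{(t-s)\Delta}f(\mathcal A_0(s))ds+\int_1^ta\cdot\nabla e^{(t-s)\Delta}f(\mathcal A_{0,k-1}(s))ds$. For $\varphi\in L^1$, $\Lambda_{e_j,0}(t;\varphi)=-\frac12t^{-1/2}\mathcal M_0(\varphi)\,\delta_t(x_jG_1)$, where $x_jG_1$ denotes $x\mapsto x_jG_1(x)$. *)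

(* Defs.v *)
From mathcomp Require Import all_boot all_order all_algebra.
From mathcomp Require Import all_classical all_reals all_analysis.
Import numFieldNormedType.Exports.
Import Order.TTheory GRing.Theory Num.Theory.

Set Implicit Arguments.
Unset Strict Implicit.
Unset Printing Implicit Defensive.

Local Open Scope classical_set_scope.
Local Open Scope ring_scope.

Section Defs.
Variable R : realType.

Definition tsub n (x y : n.-tuple R) : n.-tuple R :=
  [tuple tnth x i - tnth y i | i < n].
Definition tscale n (c : R) (x : n.-tuple R) : n.-tuple R :=
  [tuple c * tnth x i | i < n].
Definition tshift n (x : n.-tuple R) (j : 'I_n) (r : R) : n.-tuple R :=
  [tuple tnth x i + (if i == j then r else 0) | i < n].
Definition tnorm2 n (x : n.-tuple R) : R := \sum_(i < n) tnth x i ^+ 2.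

(* ---------- Lebesgue integral on R^n, defined as the iterated
   one-dimensional Lebesgue integral (Fubini/Tonelli) ---------- *)
Fixpoint intRn (n : nat) : (n.-tuple R -> \bar R) -> \bar R :=
  match n return (n.-tuple R -> \bar R) -> \bar R with
  | 0 => fun f => f [tuple]
  | m.+1 => fun f =>
      (\int[@lebesgue_measure R]_x intRn (fun t : m.-tuple R => f [tuple of x :: t]))%E
  end.

Definition lebRn n (A : set (n.-tuple R)) : \bar R :=
  intRn (fun x => (\1_A x)%:E).
Definition nullRn n (A : set (n.-tuple R)) : Prop := lebRn A = 0%E.

Definition esssupnorm n (g : n.-tuple R -> R) : \bar R :=
  ereal_inf [set M%:E | M in [set M : R | 0 <= M /\ nullRn [set x | M < `|g x|]]].

Definition Lqnorm n (q : \bar R) (g : n.-tuple R -> R) : \bar R :=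
  match q with
  | r%:E => ((intRn (fun x => (`|g x| `^ r)%:E)) `^ (r^-1))%E
  | +oo%E => esssupnorm g
  | -oo%E => 0%E
  end.

Definition gauss n (t : R) (x : n.-tuple R) : R :=
  (4 * pi * t) `^ (- (n%:R / 2)) * expR (- (tnorm2 x / (4 * t))).

Definition heat n (t : R) (phi : n.-tuple R -> R) (x : n.-tuple R) : R :=
  fine (intRn (fun y => (gauss t (tsub x y) * phi y)%:E)).

Definition pderiv n (j : 'I_n) (g : n.-tuple R -> R) (x : n.-tuple R) : R :=
  derive1 (fun r => g (tshift x j r)) 0.

Definition adv n (a : n.-tuple R) (t : R) (g : n.-tuple R -> R) (x : n.-tuple R) : R :=
  \sum_(j < n) tnth a j * pderiv j (heat t g) x.

Definition duhamel n (a : n.-tuple R) (f : R -> R) (v : R -> n.-tuple R -> R)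
    (lo hi t : R) (x : n.-tuple R) : R :=
  fine (\int[@lebesgue_measure R]_(s in `[lo%R, hi%R]) (adv a (t - s) (fun y => f (v s y)) x)%:E)%E.

Definition mass n (phi : n.-tuple R -> R) : R := fine (intRn (fun x => (phi x)%:E)).

Definition A0 n (u0 : n.-tuple R -> R) (t : R) (x : n.-tuple R) : R :=
  mass u0 * gauss t x.

Fixpoint A0k n (a : n.-tuple R) (f : R -> R) (u0 : n.-tuple R -> R) (k : nat)
    : R -> n.-tuple R -> R :=
  match k with
  | 0 => A0 u0
  | k'.+1 => fun t x => A0 u0 t x + duhamel a f (A0 u0) 0 1 t x
                       + duhamel a f (A0k a f u0 k') 1 t t x
  end.

Definition dil n (t : R) (psi : n.-tuple R -> R) (x : n.-tuple R) : R :=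
  t `^ (- (n%:R / 2)) * psi (tscale (t `^ (- (1/2))) x).

Definition xjG1 n (j : 'I_n) (x : n.-tuple R) : R := tnth x j * gauss 1 x.

Definition Lambda n (j : 'I_n) (t : R) (phi : n.-tuple R -> R) (x : n.-tuple R) : R :=
  - (1/2) * t `^ (- (1/2)) * mass phi * dil t (xjG1 j) x.

Definition tildeA n (a : n.-tuple R) (f : R -> R) (u0 : n.-tuple R -> R) (k : nat)
    (t : R) (x : n.-tuple R) : R :=
  A0k a f u0 k t x +
  \sum_(j < n) tnth a j *
    fine (\int[@lebesgue_measure R]_(s in `[1%R, t%R])
      (Lambda j t (fun y => f (A0k a f u0 k s y) - f (A0k a f u0 k.-1 s y)) x)%:E)%E.

Definition is_global_solution n (a : n.-tuple R) (f : R -> R)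
    (u0 : n.-tuple R -> R) (u : R -> n.-tuple R -> R) : Prop :=
  (forall t, 0 <= t -> measurable_fun setT (u t)) /\
  (exists B : R, forall t, 0 <= t -> (Lqnorm 1%:E (u t) <= B%:E)%E) /\
  (forall t0, 0 <= t0 -> forall e : R, 0 < e -> exists2 d : R, 0 < d &
     forall t, 0 <= t -> `|t - t0| < d ->
       (Lqnorm 1%:E (fun x => (u t x - u t0 x)%R) < e%:E)%E) /\
  (exists B : R, forall t, 0 < t -> (Lqnorm +oo%E (u t) <= B%:E)%E) /\
  (forall t0, 0 < t0 -> forall e : R, 0 < e -> exists2 d : R, 0 < d &
     forall t, 0 < t -> `|t - t0| < d ->
       (Lqnorm +oo%E (fun x => (u t x - u t0 x)%R) < e%:E)%E) /\
  Lqnorm 1%:E (fun x => (u 0 x - u0 x)%R) = 0%E /\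
  (* Duhamel formula, for every t > 0 (as an identity in L^1, i.e. a.e.) *)
  (forall t, 0 < t ->
     nullRn [set x | u t x <> heat t u0 x + duhamel a f u 0 t t x]).

End Defs.

(* Main.v *)
(* Put sigma = n(p-1)/2 - 1/2 = 1/(2(k+1)).  If ||v(t)||_1 is bounded and ||v(t)||_oo decays like
   t^(-n/2), then f(v(t)) decays in the same way with the extra factor t^(-1/2-sigma), so its
   Duhamel integral gains t^(-sigma).

   Decay of u.  Since a . grad f(W) is orthogonal to W, the energy
   E(r,t) = int (e^(r Delta) u(t))^2 satisfies E(r,t+h) <= E(r+h,t) + o(h) for r a suitable power
   of h, by Hoelder-3/8 bounds for u in space and time.  If E stayed bounded below, convexity of
   r |-> E(r,t) would force a definite drop over each time step, which is impossible.  Hence the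
   energy, and with it sup |u(T)|, is small at some T.  Then u(T) is as small as after a long time
   L of decay, and the factor L^(-sigma) closes a continuation argument for the rate t^(-n/2).

   Expansion.  u - A_{0,0} = O(t^(-sigma)), and each Duhamel iteration improves the rate by
   t^(-sigma), up to u - A_{0,k-1} = O(t^(-k sigma)).  The next step is borderline (a logarithm), but
   any rate slightly below 1/2 for u - A_{0,k} already gives u - A_{0,k+1} = O(t^(-1/2)).  Now
   A_{0,k+1} - A_{0,k} is the Duhamel integral of psi(s) = f(A_{0,k}(s)) - f(A_{0,k-1}(s)), and
   |psi(s)| <= C s^(-1) G_{2s}.  Replacing a . grad e^((t-s) Delta) psi(s) by the mass of psi(s)
   times a . grad G_t costs O(t^(-1/2)) by a first-moment estimate, and leaves exactly the
   Lambda_{e_j,0} terms. *)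
From HB Require Import structures.
Require Import Defs.
From mathcomp Require Import all_boot all_order all_algebra.
From mathcomp Require Import all_classical all_reals all_analysis.
From mathcomp Require Import measurable_realfun.
From mathcomp Require Import ring lra.
Import numFieldNormedType.Exports.
Import Order.TTheory GRing.Theory Num.Theory.

Set Implicit Arguments.
Unset Strict Implicit.
Unset Printing Implicit Defensive.

Local Open Scope classical_set_scope.
Local Open Scope ring_scope.

(** All estimates use one pair of norms, L^1 and the sup weighted by t^(n/2); interpolation turns it
    into every q only at the very end. The pair fits Duhamel integrals because a convolution can be
    bounded from L^1 to sup or from sup to sup, according to which time, that of the kernel or that
    of the source, is comparable with t. Nothing is then lost beyond the integrable (t-s)^(-1/2) of
    the gradient.

    The obstacle is the decay of u. The datum may be large, and a continuation argument needs a
    small factor. Such a factor, L^(-sigma), is available once u behaves like a flow of age L, and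
    at a time T with sup |u(T)| below a multiple of L^(-n/2) it does so. Hence smallness is needed
    at one time only, without a rate. An energy identity would give it, but u is only a mild
    solution and cannot be differentiated in time; so the energy is taken of a mollification and
    compared over discrete time steps, where the orthogonality error has to be small relative to the
    step. The regularity of the kernels used for this is derived from the semigroup law and first
    moments, without second derivatives. *)

Section parametric.
Context {R : realType} d1 d2 (T1 : measurableType d1) (T2 : measurableType d2)
  (m : {sigma_finite_measure set T2 -> \bar R}).

Lemma measurable_param_integral (g : T1 * T2 -> \bar R) : measurable_fun setT g ->
  measurable_fun setT (fun y => \int[m]_x g (y, x))%E.
Proof.
move=> mg; rewrite (_ : (fun _ => _) = (fun y => \int[m]_x funepos g (y, x)) \- (fun y => \int[m]_x funeneg g (y, x)))%E; last first.
  apply/funext => y; rewrite integralE.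
  by congr (_ - _)%E; apply: eq_integral => x _; rewrite ?funeposE ?funenegE.
apply: emeasurable_funB.
  apply: (@measurable_fun_fubini_tonelli_F _ _ _ _ _ m (funepos g)) => //.
  exact: measurable_funepos.
apply: (@measurable_fun_fubini_tonelli_F _ _ _ _ _ m (funeneg g)) => //.
exact: measurable_funeneg.
Qed.

Lemma measurable_param_Rintegral (g : T1 * T2 -> R) : measurable_fun setT g ->
  measurable_fun setT (fun y => \int[m]_x g (y, x)).
Proof.
move=> mg; apply: (measurableT_comp (fine_measurable measurableT)).
by apply: (measurable_param_integral (g := EFin \o g)); exact/measurable_EFinP.
Qed.

End parametric.

Section Rfubini.
Context {R : realType} d1 d2 (T1 : measurableType d1) (T2 : measurableType d2)
  (m1 : {sigma_finite_measure set T1 -> \bar R}) (m2 : {sigma_finite_measure set T2 -> \bar R}).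

(** The real-valued inner integral is the extended one only on integrable slices. Almost every slice
    is integrable, so the extended Fubini theorem carries over through almost-everywhere
    equality. *)
Lemma Rintegral_Fubini (f : T1 * T2 -> R) :
  (m1 \x m2)%E.-integrable setT (EFin \o f) ->
  \int[m1]_x \int[m2]_y f (x, y) = \int[m2]_y \int[m1]_x f (x, y).
Proof.
move=> intf; have mf := measurable_int _ intf.
rewrite /Rintegral; congr fine.
transitivity (\int[m1]_x \int[m2]_y (f (x, y))%:E)%E.
  apply: ae_eq_integral => //.
  - by apply/measurable_EFinP; apply: measurable_param_Rintegral; exact/measurable_EFinP.
  - exact: (measurable_param_integral m2 mf).
  have := ae_integrable1 intf; apply: filterS => x ix _.
  by rewrite fineK//; exact: integrable_fin_num.
rewrite (Fubini intf); apply: ae_eq_integral => //.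
- have msw : measurable_fun setT (EFin \o (fun z : T2 * T1 => f (z.2, z.1))).
    by apply: (measurableT_comp mf); exact: measurable_swap.
  exact: (measurable_param_integral m1 msw).
- apply/measurable_EFinP; apply: (measurable_param_Rintegral m1 (g := fun z : T2 * T1 => f (z.2, z.1))).
  by apply/measurable_EFinP; apply: (measurableT_comp mf); exact: measurable_swap.
have := ae_integrable2 intf; apply: filterS => x ix _.
by rewrite fineK//; exact: integrable_fin_num.
Qed.

End Rfubini.

(** * Lebesgue measure on R^n as an iterated product *)

Section measure_Rn.
Variable R : realType.
Local Notation leb := (@lebesgue_measure R).
Local Notation Rb := (measurableTypeR R).

Definition consf n (z : Rb * n.-tuple R) : n.+1.-tuple R := [tuple of z.1 :: z.2].

Lemma measurable_consf n : measurable_fun setT (@consf n).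
Proof. exact: (@measurable_cons _ _ _ _ fst n snd measurable_fst measurable_snd). Qed.

Definition unconsf n (z : n.+1.-tuple R) : Rb * n.-tuple R := (thead z, [tuple of behead z]).

Lemma measurable_unconsf n : measurable_fun setT (@unconsf n).
Proof.
apply: measurable_fun_pair; first exact: (@measurable_tnth _ _ n.+1 ord0).
exact: measurable_behead.
Qed.

Lemma consfK n : cancel (@consf n) (@unconsf n).
Proof. by case=> x t; congr pair; apply/val_inj. Qed.

Lemma unconsfK n : cancel (@unconsf n) (@consf n).
Proof. by move=> t; rewrite [RHS]tuple_eta. Qed.

Section succ.
Variables (n : nat) (m : {sigma_finite_measure set (n.-tuple R) -> \bar R}).

(** The product of the line with [m], carried to tuples by the cons map. The head coordinate is the
    outer one, as in the recursion of [intRn]. *)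
Definition consm : set (n.+1.-tuple R) -> \bar R :=
  pushforward (leb \x m)%E (@consf n).

Let consm0 : consm set0 = 0%E.
Proof. by rewrite /consm /pushforward preimage_set0 measure0. Qed.

Let consm_ge0 A : (0 <= consm A)%E.
Proof. exact: (@measure_ge0 _ _ _ (leb \x m)%E). Qed.

Let consm_sigma_additive : semi_sigma_additive consm.
Proof.
exact: (@measure_semi_sigma_additive _ _ _
  (measure_function_pushforward__canonical__measure_function_Measure
     (leb \x m)%E (@measurable_consf n))).
Qed.

HB.instance Definition _ := isMeasure.Build _ _ _ consm
  consm0 consm_ge0 consm_sigma_additive.

Let consm_sigma_finite : sigma_finite setT consm.
Proof.
have /sigma_finiteP[F [TF ndF Foo]] := @sigma_finiteT _ _ _ leb.
have /sigma_finiteP[G [TG ndG Goo]] := sigma_finiteT m.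
exists (fun i => @unconsf n @^-1` (F i `*` G i)).
  rewrite -preimage_bigcup (_ : \bigcup_i _ = setT) ?preimage_setT//.
  apply/seteqP; split => // -[x y] _.
  have [i _ Fix] : (\bigcup_i F i) x by rewrite -TF.
  have [j _ Gjy] : (\bigcup_i G i) y by rewrite -TG.
  exists (maxn i j) => //; split => /=.
    by move: x Fix; exact/subsetPset/ndF/leq_maxl.
  by move: y Gjy; exact/subsetPset/ndG/leq_maxr.
move=> k; have [mF Fk] := Foo k; have [mG Gk] := Goo k; split.
  by rewrite -[X in measurable X]setTI; apply: measurable_unconsf => //; exact: measurableX.
rewrite /consm /pushforward/= (_ : _ @^-1` _ = F k `*` G k); last first.
  by rewrite -comp_preimage (_ : _ \o _ = id)//; apply/funext => z; exact: consfK.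
by rewrite product_measure1E// lte_mul_pinfty// ge0_fin_numE.
Qed.

HB.instance Definition _ := Measure_isSigmaFinite.Build _ _ _ consm
  consm_sigma_finite.
End succ.

Fixpoint lebn (n : nat) : {sigma_finite_measure set (n.-tuple R) -> \bar R} :=
  match n return {sigma_finite_measure set (n.-tuple R) -> \bar R} with
  | 0 => [the {sigma_finite_measure set (0.-tuple R) -> \bar R} of dirac [tuple]]
  | m.+1 => [the {sigma_finite_measure set (m.+1.-tuple R) -> \bar R} of consm (lebn m)]
  end.


Lemma measurable_intRn d (T : measurableType d) n (F : T * n.-tuple R -> \bar R) :
  measurable_fun setT F -> measurable_fun setT (fun y => intRn (fun x => F (y, x))).
Proof.
elim: n d T F => [|n IH] d T F mF /=.
  by apply: (@measurableT_comp _ _ _ _ _ _ F).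
apply: (@measurable_param_integral _ _ _ T Rb leb (fun z => intRn (fun t => F (z.1, consf (z.2, t))))).
apply: (IH _ (T * Rb)%type (fun z => F (z.1.1, consf (z.1.2, z.2)))).
apply: measurableT_comp => //; apply: measurable_fun_pair.
  exact: measurableT_comp.
apply: (measurableT_comp (@measurable_consf n)).
by apply: measurable_fun_pair => //; exact: measurableT_comp.
Qed.

Lemma ge0_intRnE n (f : n.-tuple R -> \bar R) :
  measurable_fun setT f -> (forall x, 0 <= f x)%E -> intRn f = (\int[lebn n]_x f x)%E.
Proof.
elim: n f => [|n IH] f mf f0 /=.
  by rewrite integral_dirac// diracE mem_set// mul1e.
have mfc : measurable_fun setT (f \o @consf n).
  by apply: measurableT_comp => //; exact: measurable_consf.
transitivity (\int[leb]_x \int[lebn n]_t f (consf (x, t)))%E.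
  apply: eq_integral => x _; apply: IH => //.
  exact: (measurableT_comp mfc (@pair1_measurable _ _ _ _ x)).
rewrite ge0_integral_pushforward//=; last exact: measurable_consf.
by rewrite preimage_setT fubini_tonelli1//.
Qed.

(** The iterated integral is formed slice by slice, and only almost every slice of an integrable
    function is integrable. The induction hypothesis is therefore applied almost everywhere in the
    head variable. *)
Lemma intRnE n (f : n.-tuple R -> \bar R) :
  (lebn n).-integrable setT f -> intRn f = (\int[lebn n]_x f x)%E.
Proof.
elim: n f => [|n IH] f intf.
  have mf := measurable_int _ intf.
  by rewrite integral_dirac//= diracE mem_set// mul1e.
have mf := measurable_int _ intf.
have mc := @measurable_consf n.
have mfc : measurable_fun setT (f \o @consf n) by exact: measurableT_comp.
have intfc : (leb \x lebn n)%E.-integrable setT (f \o @consf n).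
  apply/integrableP; split => //.
  have /integrableP[_] := intf; rewrite ge0_integral_pushforward//=.
  exact: measurableT_comp.
rewrite /= (@integral_pushforward _ _ _ _ _ _ mc)//= preimage_setT.
rewrite -(integral12_prod_meas1 intfc) /fubini_F.
apply: ae_eq_integral => //.
- apply: (@measurable_intRn _ Rb n (fun z => f (consf (z.1, z.2)))).
  by rewrite (_ : (fun _ => _) = f \o @consf n)//; apply/funext; case.
- exact: measurable_int _ (integrable_fubini_F intfc).
have := ae_integrable1 intfc; apply: filterS => x /= ix _.
exact: IH.
Qed.

Lemma integral_lebn0 (f : 0.-tuple R -> \bar R) :
  measurable_fun setT f -> (\int[lebn 0]_z f z = f [tuple])%E.
Proof. by move=> mf; rewrite integral_dirac//= diracE mem_set// mul1e. Qed.

Lemma ge0_lebnS n (f : n.+1.-tuple R -> \bar R) :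
  measurable_fun setT f -> (forall x, 0 <= f x)%E ->
  (\int[lebn n.+1]_z f z = \int[leb]_x \int[lebn n]_t f (consf (x, t)))%E.
Proof.
move=> mf f0; rewrite -ge0_intRnE//=; apply: eq_integral => x _.
rewrite ge0_intRnE//.
exact: (measurableT_comp mf (measurableT_comp (@measurable_consf n) (@pair1_measurable _ _ _ _ x))).
Qed.

End measure_Rn.

(** * Measurability of elementary operations and of the heat kernel *)

Section measurability.
Context {R : realType} d (T : measurableType d).
Implicit Types f g : T -> R.

(** Inversion is discontinuous at 0, so it is expressed by the measurable power of exponent -1,
    separately on each sign. *)
Lemma measurable_invr f : measurable_fun setT f -> measurable_fun setT (fun x => (f x)^-1).
Proof.
move=> mf; rewrite (_ : (fun x => _) = (fun x => if 0 <= f x then f x `^ (-1) else - ((- f x) `^ (-1)))); last first.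
  apply/funext => x; case: ifPn => [f0|]; first by rewrite powR_inv1.
  by rewrite -ltNge => f0; rewrite powR_inv1 ?oppr_ge0 ?ltW// invrN opprK.
apply: measurable_fun_ifT.
- exact: measurable_fun_ler.
- exact: (measurableT_comp (measurable_powR (-1 : R)) mf).
- apply: measurable_funN; apply: (measurableT_comp (measurable_powR (-1 : R))).
  exact: measurable_funN.
Qed.

Lemma measurable_fun_bigsum (I : Type) (s : seq I) (F : I -> T -> R) :
  (forall i, measurable_fun setT (F i)) ->
  measurable_fun setT (fun x => \sum_(i <- s) F i x).
Proof.
move=> mF; elim: s => [|i s IH].
  by under eq_fun do rewrite big_nil; exact: measurable_cst.
by under eq_fun do rewrite big_cons; apply: measurable_funD.
Qed.

End measurability.

Section Rn_measurability.
Context {R : realType} d (T : measurableType d) (n : nat).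
Implicit Types f g : T -> n.-tuple R.

Lemma measurable_coord f i : measurable_fun setT f -> measurable_fun setT (fun x => tnth (f x) i).
Proof. by move=> mf; apply: (measurableT_comp (@measurable_tnth _ _ n i) mf). Qed.

Lemma measurable_tsub f g : measurable_fun setT f -> measurable_fun setT g ->
  measurable_fun setT (fun x => tsub (f x) (g x)).
Proof.
move=> mf mg; apply/measurable_fun_tnthP => i.
rewrite (_ : _ \o _ = fun x => tnth (f x) i - tnth (g x) i); last first.
  by apply/funext => x /=; rewrite tnth_mktuple.
by apply: measurable_funB; exact: measurable_coord.
Qed.

Lemma measurable_tnorm2 f : measurable_fun setT f -> measurable_fun setT (fun x => tnorm2 (f x)).
Proof.
move=> mf; apply: measurable_fun_bigsum => i; apply: measurable_funX.
exact: measurable_coord.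
Qed.

Lemma measurable_gauss (t : T -> R) f :
  measurable_fun setT t -> measurable_fun setT f ->
  measurable_fun setT (fun x => gauss (t x) (f x)).
Proof.
move=> mt mf; apply: measurable_funM.
  apply: (measurableT_comp (measurable_powR _)); exact: measurable_funM.
apply: measurableT_comp => //; apply: measurable_funN; apply: measurable_funM.
  exact: measurable_tnorm2.
by apply: measurable_invr; exact: measurable_funM.
Qed.

End Rn_measurability.

(** * The heat kernel: mass one and the semigroup law *)

Section gauss1.
Variable R : realType.
Implicit Types s t x y z : R.
Local Notation leb := (@lebesgue_measure R).

Definition gauss1 t x : R := (4 * pi * t) `^ (- (1 / 2)) * expR (- (x ^+ 2 / (4 * t))).

Lemma fourpi_gt0 : (0 : R) < 4 * pi.
Proof. by rewrite mulr_gt0// pi_gt0. Qed.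

Lemma gauss1_ge0 t x : 0 <= gauss1 t x.
Proof. by rewrite mulr_ge0 ?powR_ge0 ?expR_ge0. Qed.

Lemma measurable_gauss1 t (f : measurableTypeR R -> R) : measurable_fun setT f ->
  measurable_fun setT (fun x => gauss1 t (f x)).
Proof.
move=> mf; apply: measurable_funM => //; apply: measurableT_comp => //.
by apply: measurable_funN; apply: measurable_funM => //; exact: measurable_funX.
Qed.

Lemma gauss1C t x y : gauss1 t (x - y) = gauss1 t (y - x).
Proof. by rewrite /gauss1 -sqrrN opprB. Qed.

(** As a function of z this is the normal density of mean x and standard deviation sqrt (2 t). *)
Lemma integral_gauss1 t x : 0 < t -> (\int[leb]_z (gauss1 t (x - z))%:E = 1)%E.
Proof.
move=> t0; rewrite -(integral_normal_pdf x (Num.sqrt (2 * t))).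
apply: eq_integral => z _; congr EFin; rewrite gauss1C.
have s0 : 0 < Num.sqrt (2 * t) by rewrite sqrtr_gt0 mulr_gt0.
rewrite /normal_pdf gt_eqF// /gauss1 /normal_peak /normal_fun.
rewrite sqr_sqrtr ?mulr_ge0 ?ltW//; congr (_ * _).
  rewrite powRN; congr (_^-1); rewrite div1r powR12_sqrt.
    by congr (Num.sqrt _); ring.
  by rewrite ltW// mulr_gt0// fourpi_gt0.
congr expR; rewrite mulNr; congr (- (_ / _)); ring.
Qed.

(** Completing the square in z: the product is a Gaussian in z, centred at a weighted mean of x and
    y, times a factor free of z. The semigroup law follows by integrating in z. *)
Lemma gauss1_mul s t x y z : 0 < s -> 0 < t ->
  gauss1 s (x - z) * gauss1 t (z - y) =
  gauss1 (s + t) (x - y) * gauss1 (s * t / (s + t)) ((t * x + s * y) / (s + t) - z).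
Proof.
move=> s0 t0; have st0 : 0 < s + t by rewrite addr_gt0.
have pi4 := fourpi_gt0.
have pos4 (u : R) : 0 < u -> 0 <= 4 * pi * u by move=> u0; rewrite ltW// mulr_gt0.
have r0 : 0 < s * t / (s + t) by rewrite divr_gt0 ?mulr_gt0.
rewrite /gauss1 mulrACA [RHS]mulrACA -!expRD -!powRM ?pos4//; congr (_ `^ _ * expR _).
  by field; rewrite gt_eqF.
by field; rewrite !gt_eqF.
Qed.

Lemma gauss1_semigroup s t x y : 0 < s -> 0 < t ->
  (\int[leb]_z (gauss1 s (x - z) * gauss1 t (z - y))%:E = (gauss1 (s + t) (x - y))%:E)%E.
Proof.
move=> s0 t0; have st0 : 0 < s + t by rewrite addr_gt0.
under eq_integral => z _ do rewrite gauss1_mul// EFinM.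
rewrite ge0_integralZl//; first by rewrite integral_gauss1 ?mule1// divr_gt0 ?mulr_gt0.
- by apply/measurable_EFinP; apply: measurable_gauss1; exact: measurable_funB.
- by move=> z _; rewrite lee_fin gauss1_ge0.
- by rewrite lee_fin gauss1_ge0.
Qed.

End gauss1.

Section gaussn.
Variable R : realType.
Local Notation leb := (@lebesgue_measure R).

Lemma tnth_consfS n (z : measurableTypeR R * n.-tuple R) i : tnth (consf z) (lift ord0 i) = tnth z.2 i.
Proof. by rewrite /consf tnthS. Qed.

Lemma tsub_consf n x y (v w : n.-tuple R) :
  tsub (consf (x, v)) (consf (y, w)) = consf (x - y, tsub v w).
Proof.
apply: eq_from_tnth => i; rewrite tnth_mktuple.
have [j ->|->//] := unliftP ord0 i; by rewrite !tnth_consfS tnth_mktuple.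
Qed.

(** The factorisation over coordinates reduces mass one and the semigroup law to dimension one, by
    induction on n. *)
Lemma gauss_consf n t x (v : n.-tuple R) : 0 < t ->
  gauss t (consf (x, v)) = gauss1 t x * gauss t v.
Proof.
move=> t0; rewrite /gauss /gauss1 mulrACA -powRD -?expRD; last first.
  by rewrite (gt_eqF (mulr_gt0 (fourpi_gt0 R) t0)) implybT.
congr (_ `^ _ * expR _); first by rewrite -natr1; field.
rewrite -opprD -mulrDl /tnorm2 big_ord_recl; congr (- ((_ + _) / _)).
by apply: eq_bigr => i _; rewrite tnth_consfS.
Qed.

Lemma gauss_ge0 n t (x : n.-tuple R) : 0 <= gauss t x.
Proof. by rewrite mulr_ge0 ?powR_ge0 ?expR_ge0. Qed.

Lemma tnorm2C n (x y : n.-tuple R) : tnorm2 (tsub x y) = tnorm2 (tsub y x).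
Proof. by apply: eq_bigr => i _; rewrite !tnth_mktuple -sqrrN opprB. Qed.

Lemma gaussC n t (x y : n.-tuple R) : gauss t (tsub x y) = gauss t (tsub y x).
Proof. by rewrite /gauss tnorm2C. Qed.

Lemma measurable_gaussr d (T : measurableType d) n t (f : T -> n.-tuple R) :
  measurable_fun setT f -> measurable_fun setT (fun x => gauss t (f x)).
Proof. by move=> mf; exact: measurable_gauss. Qed.

Lemma integral_gauss n t (x : n.-tuple R) : 0 < t ->
  (\int[lebn R n]_y (gauss t (tsub x y))%:E = 1)%E.
Proof.
move=> t0; elim: n x => [|n IH] x.
  rewrite integral_lebn0; last first.
    by apply/measurable_EFinP; apply: measurable_gaussr; exact: measurable_tsub.
  congr EFin; rewrite /gauss /tnorm2 big_ord0 !mul0r oppr0 powRr0 expR0 mulr1//.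
rewrite ge0_lebnS; last by move=> y; rewrite lee_fin gauss_ge0.
  rewrite -(integral_gauss1 (thead x) t0); apply: eq_integral => z _.
  rewrite -[x in LHS](unconsfK x).
  under eq_integral => v _ do rewrite tsub_consf gauss_consf// EFinM.
  rewrite ge0_integralZl//; first by rewrite IH mule1.
  - by apply/measurable_EFinP; apply: measurable_gaussr; exact: measurable_tsub.
  - by move=> v _; rewrite lee_fin gauss_ge0.
  - by rewrite lee_fin gauss1_ge0.
by apply/measurable_EFinP; apply: measurable_gaussr; exact: measurable_tsub.
Qed.

Lemma gauss_semigroup n s t (x y : n.-tuple R) : 0 < s -> 0 < t ->
  (\int[lebn R n]_z (gauss s (tsub x z) * gauss t (tsub z y))%:E = (gauss (s + t) (tsub x y))%:E)%E.
Proof.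
move=> s0 t0; have st0 : 0 < s + t by rewrite addr_gt0.
have mg m (v w : m.-tuple R) : measurable_fun setT (fun z => gauss s (tsub v z) * gauss t (tsub z w)).
  by apply: measurable_funM; apply: measurable_gaussr; exact: measurable_tsub.
have g0 m (v w z : m.-tuple R) : 0 <= gauss s (tsub v z) * gauss t (tsub z w).
  by rewrite mulr_ge0 ?gauss_ge0.
elim: n x y => [|n IH] x y.
  rewrite integral_lebn0; last by apply/measurable_EFinP; exact: mg.
  congr EFin; rewrite /gauss /tnorm2 !big_ord0 !mul0r oppr0 !powRr0 expR0 !mulr1//.
rewrite ge0_lebnS; last by move=> z; rewrite lee_fin.
  rewrite -(unconsfK x) -(unconsfK y) tsub_consf gauss_consf// EFinM.
  rewrite -(gauss1_semigroup _ _ s0 t0) -ge0_integralZr//; last 3 first.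
  - apply/measurable_EFinP; apply: measurable_funM; apply: measurable_gauss1; exact: measurable_funB.
  - by move=> z _; rewrite lee_fin mulr_ge0 ?gauss1_ge0.
  - by rewrite lee_fin gauss_ge0.
  apply: eq_integral => z _.
  under eq_integral => v _ do rewrite !tsub_consf !gauss_consf// mulrACA EFinM.
  rewrite ge0_integralZl//; first by rewrite IH.
  - by apply/measurable_EFinP; exact: mg.
  - by move=> v _; rewrite lee_fin.
  - by rewrite lee_fin mulr_ge0 ?gauss1_ge0.
by apply/measurable_EFinP; exact: mg.
Qed.

End gaussn.

(** * Gaussian kernels *)

Section gauss_bounds.
Variables (R : realType) (n : nat).
Implicit Types (s t c : R) (x y z : n.-tuple R).

Definition norm1 x : R := \sum_(i < n) `|tnth x i|.

Lemma norm1_ge0 x : 0 <= norm1 x.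
Proof. by rewrite sumr_ge0. Qed.

Lemma le_norm1 x i : `|tnth x i| <= norm1 x.
Proof. by rewrite /norm1 (bigD1 i)//= lerDl sumr_ge0. Qed.

Lemma sqr_coord_le x i : tnth x i ^+ 2 <= tnorm2 x.
Proof. by rewrite /tnorm2 (bigD1 i)//= lerDl sumr_ge0// => j _; rewrite sqr_ge0. Qed.

Lemma tnorm2_ge0 x : 0 <= tnorm2 x.
Proof. by rewrite sumr_ge0// => j _; rewrite sqr_ge0. Qed.

Lemma ge1_powR c (r : R) : 1 <= c -> 0 <= r -> 1 <= c `^ r.
Proof. by move=> c1 r0; rewrite -(powRr0 c) ler_powR. Qed.

Lemma ge0_ler_powRN t s (r : R) : 0 < s -> s <= t -> 0 <= r -> t `^ (- r) <= s `^ (- r).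
Proof.
move=> s0 st r0; rewrite !powRN lef_pV2 ?posrE ?powR_gt0//; last exact: lt_le_trans st.
by rewrite ge0_ler_powR// nnegrE ltW//; exact: lt_le_trans st.
Qed.

Lemma n2_ge0 : 0 <= n%:R / 2 :> R.
Proof. by rewrite divr_ge0. Qed.

Lemma gauss_le t x : 0 < t -> gauss t x <= t `^ (- (n%:R / 2)).
Proof.
move=> t0; rewrite /gauss -[leRHS]mulr1 ler_pM ?powR_ge0 ?expR_ge0//.
  apply: ge0_ler_powRN => //.
  have := pi_ge2 R => pi2; nra.
by rewrite expR_le1 oppr_le0 divr_ge0 ?tnorm2_ge0// mulr_ge0 ?ltW.
Qed.

Lemma gauss_gt0 t x : 0 < t -> 0 < gauss t x.
Proof. by move=> t0; rewrite mulr_gt0 ?expR_gt0// powR_gt0// mulr_gt0// fourpi_gt0. Qed.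

(** Widening a Gaussian costs only the ratio of the normalising powers. Estimates at different
    widths can thus be brought to a common one; [G2] is the price of doubling the time. *)
Lemma gauss_mono c s t x : 0 < s -> s <= t -> t <= c * s ->
  gauss s x <= c `^ (n%:R / 2) * gauss t x.
Proof.
move=> s0 st tc; have t0 : 0 < t by exact: lt_le_trans st.
have c0 : 0 < c by rewrite -(pmulr_lgt0 _ s0); exact: lt_le_trans tc.
rewrite /gauss mulrA ler_pM ?powR_ge0 ?expR_ge0//; last first.
  by rewrite ler_expR lerN2 ler_wpM2l ?tnorm2_ge0// lef_pV2 ?posrE ?mulr_gt0// ler_pM2l.
have pi4 := fourpi_gt0 R.
rewrite -[c `^ _]invrK -powRN -ler_pdivrMl ?invr_gt0 ?powR_gt0// invrK.
rewrite -powRM; [|exact: ltW|by rewrite ltW// mulr_gt0].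
apply: ge0_ler_powRN => //; first by rewrite mulr_gt0.
by rewrite mulrCA ler_pM2l.
Qed.

Definition G2 : R := 2 `^ (n%:R / 2).

Lemma G2_ge1 : 1 <= G2.
Proof. by rewrite ge1_powR ?n2_ge0//; lra. Qed.

(** Half of the exponent, [q], absorbs the factor |x_i| through 1 + q <= exp q; the other half
    remains as the Gaussian of time 2t. *)
Lemma coord_gauss t x i : 0 < t ->
  `|tnth x i| * gauss t x <= 2 * G2 * Num.sqrt t * gauss (2 * t) x.
Proof.
move=> t0; have pi4 := fourpi_gt0 R.
have w0 : 0 < Num.sqrt t by rewrite sqrtr_gt0.
have tw : t = Num.sqrt t ^+ 2 by rewrite sqr_sqrtr// ltW.
pose q := tnorm2 x / (4 * (2 * t)).
have qE : tnorm2 x / (4 * t) = q + q by rewrite /q; field; rewrite gt_eqF.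
have xq : `|tnth x i| * expR (- q) <= 2 * Num.sqrt t.
  rewrite expRN ler_pdivrMr ?expR_gt0//.
  apply: (@le_trans _ _ (2 * Num.sqrt t * (1 + q))); last first.
    by rewrite ler_wpM2l ?mulr_ge0 ?sqrtr_ge0// expR_ge1Dx.
  apply: (@le_trans _ _ (2 * Num.sqrt t * (1 + `|tnth x i| ^+ 2 / (4 * (2 * t))))); last first.
    rewrite ler_wpM2l ?mulr_ge0 ?sqrtr_ge0// lerD2l ler_wpM2r ?invr_ge0 ?mulr_ge0 ?(ltW t0)//.
    by rewrite real_normK ?num_real// sqr_coord_le.
  have : 0 <= `|tnth x i| by []; move: `|_| => a a0.
  move: (Num.sqrt t) w0 tw => w w0 ->.
  rewrite (_ : _ * _ = 2 * w + a ^+ 2 / (4 * w)); last by field; rewrite gt_eqF.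
  rewrite -(ler_pM2r (_ : 0 < 4 * w)) ?mulr_gt0//.
  have -> : (2 * w + a ^+ 2 / (4 * w)) * (4 * w) = 8 * w ^+ 2 + a ^+ 2 by field; rewrite gt_eqF.
  by have := sqr_ge0 (a - 2 * w); have := sqr_ge0 w; nra.
rewrite /gauss qE opprD expRD.
rewrite (_ : _ `^ _ = G2 * (4 * pi * (2 * t)) `^ (- (n%:R / 2))); last first.
  rewrite (_ : 4 * pi * (2 * t) = 2 * (4 * pi * t)); last by ring.
  rewrite [in RHS]powRM ?mulr_ge0 ?ltW// ?pi_gt0// mulrA /G2 -powRD ?subrr ?powRr0 ?mul1r//.
  by apply/implyP.
have := ler_wpM2r (mulr_ge0 (mulr_ge0 (ltW (lt_le_trans ltr01 G2_ge1)) (powR_ge0 (4 * pi * (2 * t)) (- (n%:R / 2)))) (expR_ge0 (- q))) xq.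
by rewrite -/q; congr (_ <= _); ring.
Qed.

(** The partial derivative of G_t in direction i, in closed form. *)
Definition dgauss (i : 'I_n) t x : R := - (tnth x i / (2 * t)) * gauss t x.

Lemma dgauss_le i t x : 0 < t -> `|dgauss i t x| <= G2 / Num.sqrt t * gauss (2 * t) x.
Proof.
move=> t0; have w0 : 0 < Num.sqrt t by rewrite sqrtr_gt0.
rewrite /dgauss normrM normrN normrM (ger0_norm (gauss_ge0 _ _)) (gtr0_norm (_ : 0 < (2 * t)^-1)) ?invr_gt0 ?mulr_gt0//.
rewrite mulrAC ler_pdivrMr ?mulr_gt0//; apply: le_trans (coord_gauss x i t0) _.
have tw := sqr_sqrtr (ltW t0); move: (Num.sqrt t) w0 tw (gauss _ _) => w w0 <- g.
rewrite le_eqVlt; apply/orP; left; apply/eqP; field.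
by rewrite gt_eqF.
Qed.

(** Both exponentials appear on the right, so that it need not be known which exponent is
    smaller. *)
Lemma expRN_dist (p q : R) : `|expR (- p) - expR (- q)| <= `|p - q| * (expR (- p) + expR (- q)).
Proof.
wlog pq : p q / p <= q.
  move=> H; have [/H//|/ltW/H] := leP p q.
  by rewrite distrC [`|q - p|]distrC [expR (- q) + _]addrC.
rewrite ger0_norm ?subr_ge0 ?ler_expR ?lerN2// ler0_norm ?subr_le0//.
have E : expR (- p) * (1 - (q - p)) <= expR (- q).
  rewrite (_ : - q = - p + - (q - p)); last by ring.
  by rewrite expRD ler_wpM2l ?expR_ge0// (le_trans _ (expR_ge1Dx _)).
have := expR_ge0 (- q) => q0; have : 0 <= q - p by rewrite subr_ge0. nra.
Qed.

(** The weight sits at the two end points of the shift and not at an intermediate point as in the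
    mean value theorem. In this form it can be integrated against other Gaussians by the semigroup
    law. *)
Lemma gauss_translation t x y : 0 < t ->
  `|gauss t (tsub x y) - gauss t x| <=
  4 * G2 * (norm1 y / Num.sqrt t) * (gauss (2 * t) (tsub x y) + gauss (2 * t) x).
Proof.
move=> t0; have w0 : 0 < Num.sqrt t by rewrite sqrtr_gt0.
have tw : t = Num.sqrt t ^+ 2 by rewrite sqr_sqrtr// ltW.
have G1 := G2_ge1.
have gm z : gauss t z <= G2 * gauss (2 * t) z by apply: gauss_mono => //; lra.
have g0 s z : 0 <= gauss s z by exact: gauss_ge0.
have N0 := norm1_ge0 y.
(* A shift longer than sqrt t needs no cancellation, since the ratio of its length to sqrt t is then
   at least one. *)
have [wN|Nw] := leP (Num.sqrt t) (norm1 y).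
  rewrite (le_trans (ler_normB _ _))// !ger0_norm//.
  apply: (@le_trans _ _ (G2 * (gauss (2 * t) (tsub x y) + gauss (2 * t) x))).
    by rewrite mulrDr lerD.
  rewrite ler_wpM2r ?addr_ge0// -mulrA mulrCA ler_peMr ?(le_trans _ G1)//.
  have : 1 <= norm1 y / Num.sqrt t by rewrite ler_pdivlMr// mul1r.
  lra.
set X := tsub x y.
have XE i : tnth X i = tnth x i - tnth y i by rewrite tnth_mktuple.
rewrite {1 2}/gauss -mulrBr normrM ger0_norm ?powR_ge0//.
set pw := _ `^ _; have pw0 : 0 <= pw by exact: powR_ge0.
have D : `|tnorm2 X / (4 * t) - tnorm2 x / (4 * t)| <=
    \sum_(i < n) `|tnth y i| * (`|tnth X i| + `|tnth x i|) / (4 * t).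
  rewrite -mulrBl normrM (gtr0_norm (_ : 0 < (4 * t)^-1)) ?invr_gt0 ?mulr_gt0//.
  rewrite -mulr_suml ler_wpM2r ?invr_ge0 ?mulr_ge0 ?(ltW t0)//.
  rewrite /tnorm2 -sumrB (le_trans (ler_norm_sum _ _ _))// ler_sum// => i _.
  rewrite (_ : _ - _ = - tnth y i * (tnth X i + tnth x i)); last by rewrite XE; ring.
  by rewrite normrM normrN ler_wpM2l// ler_normD.
(* The shift is now shorter than sqrt t. So |x_i| and |X_i| can be exchanged at the cost of sqrt t,
   and each is absorbed by the Gaussian at its own point. *)
have E i : (`|tnth X i| + `|tnth x i|) * (gauss t X + gauss t x) <=
    (5 * 2 * G2 * Num.sqrt t) * (gauss (2 * t) X + gauss (2 * t) x).
  have xX : `|tnth x i| <= `|tnth X i| + Num.sqrt t.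
    rewrite (_ : tnth x i = tnth X i + tnth y i); last by rewrite XE subrK.
    by rewrite (le_trans (ler_normD _ _))// lerD2l (le_trans (le_norm1 _ _))// ltW.
  have Xx : `|tnth X i| <= `|tnth x i| + Num.sqrt t.
    by rewrite XE (le_trans (ler_normB _ _))// lerD2l (le_trans (le_norm1 _ _))// ltW.
  have c1 := coord_gauss X i t0; have c2 := coord_gauss x i t0.
  have p1 := gm X; have p2 := gm x.
  have h1 : (`|tnth X i| + `|tnth x i|) * gauss t X <= (2 * `|tnth X i| + Num.sqrt t) * gauss t X.
    by rewrite ler_wpM2r//; lra.
  have h2 : (`|tnth X i| + `|tnth x i|) * gauss t x <= (2 * `|tnth x i| + Num.sqrt t) * gauss t x.
    by rewrite ler_wpM2r//; lra.
  have k1 := ler_wpM2l (ltW w0) p1; have k2 := ler_wpM2l (ltW w0) p2.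
  have e1 : 0 <= G2 * Num.sqrt t * gauss (2 * t) X by rewrite mulr_ge0// mulr_ge0 ?(ltW w0)// (le_trans _ G1).
  have e2 : 0 <= G2 * Num.sqrt t * gauss (2 * t) x by rewrite mulr_ge0// mulr_ge0 ?(ltW w0)// (le_trans _ G1).
  lra.
apply: le_trans (ler_wpM2l pw0 (expRN_dist _ _)) _.
apply: le_trans (ler_wpM2l pw0 (ler_wpM2r _ D)) _; first by rewrite addr_ge0 ?expR_ge0.
rewrite (_ : pw * _ = \sum_(i < n) `|tnth y i| / (4 * t) * ((`|tnth X i| + `|tnth x i|) * (gauss t X + gauss t x))); last first.
  rewrite mulrCA -mulrDr -/(gauss t X) -/(gauss t x) mulr_suml; apply: eq_bigr => i _.
  by rewrite /gauss -/pw; ring.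
apply: (@le_trans _ _ (\sum_(i < n) `|tnth y i| / (4 * t) * ((5 * 2 * G2 * Num.sqrt t) * (gauss (2 * t) X + gauss (2 * t) x)))).
  by apply: ler_sum => i _; rewrite ler_wpM2l// divr_ge0// mulr_ge0// (ltW t0).
rewrite (_ : \sum_(i < n) _ = norm1 y / (4 * t) * (5 * 2 * G2 * Num.sqrt t) *
    (gauss (2 * t) X + gauss (2 * t) x)); last first.
  by rewrite /norm1 !mulr_suml; apply: eq_bigr => i _; ring.
rewrite ler_wpM2r ?addr_ge0//.
move: (Num.sqrt t) w0 tw (norm1 y) N0 {Nw D E} => w w0 -> N N0.
have -> : N / (4 * w ^+ 2) * (5 * 2 * G2 * w) = (5 / 2 * G2) * (N / w) by field; rewrite gt_eqF.
by rewrite ler_wpM2r ?divr_ge0 ?(ltW w0)//; lra.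
Qed.

End gauss_bounds.

(** * Bounds in L^1 *)

Section L1bounds.
Context {R : realType} d (T : measurableType d) (mu : {sigma_finite_measure set T -> \bar R}).
Implicit Types (h : T -> R) (M : R).

Definition L1 h := mu.-integrable setT (EFin \o h).
Definition L1le h M := measurable_fun setT h /\ (\int[mu]_x (`|h x|)%:E <= M%:E)%E.

Lemma L1le_L1 h M : L1le h M -> L1 h.
Proof.
move=> [mh hM]; apply/integrableP; split; first exact/measurable_EFinP.
by apply: le_lt_trans hM _; rewrite ltry.
Qed.

Lemma L1_L1le h : L1 h -> exists2 M, 0 <= M & L1le h M.
Proof.
move=> ih; have /integrableP[mh hoo] := ih; exists (fine (\int[mu]_x (`|h x|)%:E)%E).
  by rewrite fine_ge0// integral_ge0.
split; first exact/measurable_EFinP.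
rewrite fineK// ge0_fin_numE//; first exact: integral_ge0.
Qed.

Lemma L1_measurable h : L1 h -> measurable_fun setT h.
Proof. by move=> /integrableP[/measurable_EFinP]. Qed.

Lemma L1le_ge0 h M : L1le h M -> 0 <= M.
Proof. by move=> [_ hM]; rewrite -lee_fin; apply: le_trans hM; exact: integral_ge0. Qed.

Lemma L1le_weak h M M' : M <= M' -> L1le h M -> L1le h M'.
Proof. by move=> MM [mh hM]; split=> //; apply: le_trans hM _; rewrite lee_fin. Qed.

Lemma L1le_dom h g M : measurable_fun setT h -> (forall x, `|h x| <= g x) -> L1le g M -> L1le h M.
Proof.
move=> mh hg [mg gM]; split=> //; apply: le_trans gM; apply: ge0_le_integral => //.
- by apply/measurable_EFinP; exact: measurableT_comp.
- by apply/measurable_EFinP; exact: measurableT_comp.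
by move=> x _; rewrite lee_fin (le_trans (hg x))// ler_norm.
Qed.

Lemma L1leD h g M M' : L1le h M -> L1le g M' -> L1le (fun x => h x + g x) (M + M').
Proof.
move=> [mh hM] [mg gM]; split; first exact: measurable_funD.
apply: (@le_trans _ _ (\int[mu]_x ((`|h x|)%:E + (`|g x|)%:E))%E).
  apply: ge0_le_integral => //.
  - by apply/measurable_EFinP; apply: measurableT_comp => //; exact: measurable_funD.
  - by apply/measurable_EFinP; apply: measurable_funD; exact: measurableT_comp.
  - by move=> x _; rewrite -EFinD lee_fin ler_normD.
rewrite ge0_integralD//.
- by rewrite EFinD leeD.
- by apply/measurable_EFinP; exact: measurableT_comp.
- by apply/measurable_EFinP; exact: measurableT_comp.
Qed.

Lemma L1leZ c h M : L1le h M -> L1le (fun x => c * h x) (`|c| * M).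
Proof.
move=> [mh hM]; split; first exact: measurable_funM.
under eq_integral => x _ do rewrite normrM EFinM.
rewrite ge0_integralZl//; first by rewrite EFinM lee_wpmul2l.
by apply/measurable_EFinP; exact: measurableT_comp.
Qed.

Lemma L1leB h g M M' : L1le h M -> L1le g M' -> L1le (fun x => h x - g x) (M + M').
Proof.
move=> H /(L1leZ (-1)); rewrite normrN normr1 mul1r => /(L1leD H).
by under eq_fun do rewrite mulN1r.
Qed.

Lemma L1B h g : L1 h -> L1 g -> L1 (fun x => h x - g x).
Proof. by move=> /L1_L1le[M _ hM] /L1_L1le[N _ gN]; exact: (L1le_L1 (L1leB hM gN)). Qed.

Lemma L1D h g : L1 h -> L1 g -> L1 (fun x => h x + g x).
Proof. by move=> /L1_L1le[M _ hM] /L1_L1le[N _ gN]; exact: (L1le_L1 (L1leD hM gN)). Qed.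

Lemma L1Z c h : L1 h -> L1 (fun x => c * h x).
Proof. by move=> /L1_L1le[M _ hM]; exact: (L1le_L1 (L1leZ c hM)). Qed.

Lemma L1_dom h g : measurable_fun setT h -> (forall x, `|h x| <= g x) -> L1 g -> L1 h.
Proof. by move=> mh hg /L1_L1le[M _ gM]; exact: (L1le_L1 (L1le_dom mh hg gM)). Qed.

Lemma L1_mulbd h g M : measurable_fun setT h -> (forall x, `|h x| <= M) -> L1 g -> L1 (fun x => h x * g x).
Proof.
move=> mh hM gi; have /integrableP[/measurable_EFinP mg _] := gi.
apply: (@L1_dom _ (fun x => M * `|g x|)); first exact: measurable_funM.
  by move=> x; rewrite normrM ler_wpM2r.
have [N _ [_ gN]] := L1_L1le gi; apply: (@L1le_L1 _ (`|M| * N)); apply: L1leZ; split.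
  exact: measurableT_comp.
by under eq_integral do rewrite normr_id.
Qed.

Lemma L1le_ae h g M : measurable_fun setT g -> {ae mu, forall x, h x = g x} -> L1le h M -> L1le g M.
Proof.
move=> mg hg [mh hM]; split=> //; rewrite -(ge0_ae_eq_integral (f := fun x => (`|h x|)%:E))//.
- by apply/measurable_EFinP; exact: measurableT_comp.
- by apply/measurable_EFinP; exact: measurableT_comp.
by move: hg; apply: filterS => x /= -> _.
Qed.

Lemma Rintegral_L1le h M : L1le h M -> `|\int[mu]_x h x| <= M.
Proof.
move=> hM; have ih := L1le_L1 hM.
apply: le_trans (le_normr_Rintegral measurableT ih) _.
by case: hM => mh hM; rewrite -lee_fin /Rintegral fineK//; apply: integrable_fin_num => //; exact: integrable_norm.
Qed.

Lemma Rintegral_ae h g : measurable_fun setT h -> measurable_fun setT g ->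
  {ae mu, forall x, h x = g x} -> \int[mu]_x h x = \int[mu]_x g x.
Proof.
move=> mh mg hg; rewrite /Rintegral; congr fine; apply: ae_eq_integral => //; [exact/measurable_EFinP|exact/measurable_EFinP|].
by move: hg; apply: filterS => x /= -> _.
Qed.

Lemma L1_bigsum (I : Type) (s : seq I) (F : I -> T -> R) : (forall i, L1 (F i)) ->
  L1 (fun x => \sum_(i <- s) F i x).
Proof.
move=> FL; elim: s => [|i s IH].
  by under eq_fun do rewrite big_nil; exact: integrable0.
by under eq_fun do rewrite big_cons; exact: L1D.
Qed.

Lemma Rintegral_bigsum (I : Type) (s : seq I) (F : I -> T -> R) : (forall i, L1 (F i)) ->
  \int[mu]_x (\sum_(i <- s) F i x) = \sum_(i <- s) \int[mu]_x F i x.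
Proof.
move=> FL; elim: s => [|i s IH].
  by under eq_Rintegral do rewrite big_nil; rewrite big_nil Rintegral_cst// mul0r.
rewrite big_cons -IH -RintegralD//; [|exact: FL|exact: L1_bigsum].
by apply: eq_Rintegral => x _; rewrite big_cons.
Qed.

(** Domination by a product of integrable functions gives integrability on the product space. This
    justifies the exchange of integrals behind associativity and adjointness of convolutions. *)
Lemma L1_prod d' (T' : measurableType d') (mu' : {sigma_finite_measure set T' -> \bar R})
    (h : T -> R) (h' : T' -> R) (f : T * T' -> R) : L1 h -> mu'.-integrable setT (EFin \o h') ->
  measurable_fun setT f -> (forall x y, `|f (x, y)| <= `|h x| * `|h' y|) ->
  (mu \x mu')%E.-integrable setT (EFin \o f).
Proof.
move=> /L1_L1le[M M0 [mh hM]] ih' mf fh; apply/integrable12ltyP; first exact/measurable_EFinP.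
have mh' : measurable_fun setT h' by apply/measurable_EFinP; case/integrableP: ih'.
apply: (@le_lt_trans _ _ (\int[mu]_x ((`|h x|)%:E * \int[mu']_y (`|h' y|)%:E))%E).
  apply: ge0_le_integral => //.
  - by move=> x _; exact: integral_ge0.
  - apply: (measurable_param_integral mu' (g := fun z => `|(f z)%:E|%E)).
    by apply/measurable_EFinP; exact: measurableT_comp.
  - apply: emeasurable_funM => //.
    by apply/measurable_EFinP; exact: measurableT_comp.
  - move=> x _; rewrite -ge0_integralZl//; last by apply/measurable_EFinP; exact: measurableT_comp.
    apply: ge0_le_integral => //.
    + apply/measurable_EFinP; apply: measurableT_comp => //.
      by apply: measurableT_comp mf _; exact: pair1_measurable.
    + by apply/measurable_EFinP; apply: measurable_funM => //; exact: measurableT_comp.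
    + by move=> y _; rewrite lee_fin.
rewrite ge0_integralZr//; last 2 first.
- by apply/measurable_EFinP; exact: measurableT_comp.
- exact: integral_ge0.
case/integrableP: ih' => _ h'oo; apply: lte_mul_pinfty => //.
  exact: integral_ge0.
rewrite ge0_fin_numE ?integral_ge0//; apply: le_lt_trans hM _; exact: ltry.
Qed.

End L1bounds.

(** * Convolution with Gaussian-dominated kernels *)

Section convolution.
Variables (R : realType) (n : nat).
Local Notation V := (n.-tuple R).
Local Notation mu := (lebn R n).
Implicit Types (K h g : V -> R) (x y z : V).

Definition cv K h x : R := \int[mu]_y (K (tsub x y) * h y).

(** The calculus of convolutions rests on this domination alone. It covers G_t and also its
    gradient, whose Gaussian bound lives at the doubled time. *)
Definition gker t c K := measurable_fun setT K /\ forall z, `|K z| <= c * gauss t z.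

Lemma gauss_gker t : gker t 1 (gauss t).
Proof.
by split=> [|z]; [exact: measurable_gaussr|rewrite mul1r ger0_norm// gauss_ge0].
Qed.

Lemma gker_ge0 t c K : 0 < t -> gker t c K -> 0 <= c.
Proof.
move=> t0 [_ /(_ [tuple of nseq n 0])] /(le_trans (normr_ge0 _)).
by rewrite pmulr_lge0// gauss_gt0.
Qed.

Lemma gker_bd t c K z : 0 < t -> gker t c K -> `|K z| <= c * t `^ (- (n%:R / 2)).
Proof.
move=> t0 Kt; have c0 := gker_ge0 t0 Kt; case: Kt => _ Kt.
by rewrite (le_trans (Kt z))// ler_wpM2l// gauss_le.
Qed.

Lemma measurable_ker2 K d (T : measurableType d) (f f' : T -> V) : measurable_fun setT K ->
  measurable_fun setT f -> measurable_fun setT f' -> measurable_fun setT (fun w => K (tsub (f w) (f' w))).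
Proof. by move=> mK mf mf'; apply: (measurableT_comp mK); exact: measurable_tsub. Qed.

Lemma L1_cv_integrand t c K h x : 0 < t -> gker t c K -> L1 mu h ->
  L1 mu (fun y => K (tsub x y) * h y).
Proof.
move=> t0 Kt ih; apply: (@L1_mulbd _ _ _ _ _ _ (c * t `^ (- (n%:R / 2)))) => //.
  by apply: measurable_ker2 => //; case: Kt.
by move=> y; exact: gker_bd.
Qed.

Lemma measurable_cv K h : measurable_fun setT K -> measurable_fun setT h ->
  measurable_fun setT (cv K h).
Proof.
move=> mK mh; apply: (measurable_param_Rintegral mu (g := fun z : V * V => K (tsub z.1 z.2) * h z.2)).
by apply: measurable_funM; [exact: measurable_ker2|exact: measurableT_comp].
Qed.

(** From L^1 to sup, paying the height of the kernel. The alternative [cv_sup2] goes from sup to sup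
    and pays its mass. *)
Lemma cv_sup1 t c K h M x : 0 < t -> gker t c K -> L1le mu h M ->
  `|cv K h x| <= c * t `^ (- (n%:R / 2)) * M.
Proof.
move=> t0 Kt hM; have c0 := gker_ge0 t0 Kt; apply: (@Rintegral_L1le _ _ _ mu).
set B := c * _; have B0 : 0 <= B by rewrite mulr_ge0 ?powR_ge0.
have := L1leZ B hM; rewrite ger0_norm// => -[mBh Bh]; split.
  apply: measurable_funM; last by case: hM.
  by apply: measurable_ker2 => //; case: Kt.
apply: le_trans Bh; apply: ge0_le_integral => //.
- apply/measurable_EFinP; apply: measurableT_comp => //; apply: measurable_funM; last by case: hM.
  by apply: measurable_ker2 => //; case: Kt.
- by apply/measurable_EFinP; exact: measurableT_comp.
move=> y _; rewrite lee_fin normrM [`|B * _|]normrM (ger0_norm B0) ler_wpM2r//.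
exact: gker_bd.
Qed.

Lemma integral_gaussl t y : 0 < t -> (\int[mu]_x (gauss t (tsub x y))%:E = 1)%E.
Proof. by move=> t0; under eq_integral do rewrite gaussC; exact: integral_gauss. Qed.

Lemma gker_L1le t c K x : 0 < t -> gker t c K -> L1le mu (fun y => K (tsub x y)) c.
Proof.
move=> t0 Kt; have c0 := gker_ge0 t0 Kt; case: Kt => mK Kt; split; first exact: measurable_ker2.
apply: (@le_trans _ _ (\int[mu]_y (c%:E * (gauss t (tsub x y))%:E))%E).
  apply: ge0_le_integral => //.
  - by apply/measurable_EFinP; apply: measurableT_comp => //; exact: measurable_ker2.
  - apply/measurable_EFinP; apply: measurable_funM => //.
    by apply: measurable_gaussr; exact: measurable_tsub.
  - by move=> y _; rewrite lee_fin.
rewrite ge0_integralZl//; first by rewrite integral_gauss// mule1.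
- by apply/measurable_EFinP; apply: measurable_gaussr; exact: measurable_tsub.
- by move=> y _; rewrite lee_fin gauss_ge0.
Qed.

Lemma cv_sup2 t c K h M x : 0 < t -> gker t c K -> measurable_fun setT h ->
  {ae mu, forall y, `|h y| <= M} -> 0 <= M -> `|cv K h x| <= c * M.
Proof.
move=> t0 Kt mh hM M0; apply: (@Rintegral_L1le _ _ _ mu).
have mKh : measurable_fun setT (fun y => K (tsub x y) * h y).
  apply: measurable_funM => //; apply: measurable_ker2 => //; by case: Kt.
have := L1leZ M (gker_L1le x t0 Kt); rewrite ger0_norm// mulrC => -[mK KM]; split=> //.
apply: le_trans KM; apply: ae_ge0_le_integral => //.
- by apply/measurable_EFinP; exact: measurableT_comp.
- by apply/measurable_EFinP; exact: measurableT_comp.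
move: hM; apply: filterS => y hy _.
by rewrite lee_fin !normrM mulrC ler_wpM2r// (le_trans hy)// ler_norm.
Qed.

(** Young's inequality, by Tonelli: integrated in x first, the Gaussian majorant of the kernel has
    mass one. *)
Lemma cv_L1le t c K h M : 0 < t -> gker t c K -> L1le mu h M -> L1le mu (cv K h) (c * M).
Proof.
move=> t0 Kt hM; have c0 := gker_ge0 t0 Kt; have [mh hMi] := hM; have [mK Kg] := Kt.
have mc := measurable_cv mK mh; split => //.
apply: (@le_trans _ _ (\int[mu]_x \int[mu]_y (c%:E * ((gauss t (tsub x y))%:E * (`|h y|)%:E)))%E).
  apply: ge0_le_integral => //.
  - by apply/measurable_EFinP; exact: measurableT_comp.
  - apply: (measurable_param_integral mu (g := fun z : V * V => (c * (gauss t (tsub z.1 z.2) * `|h z.2|))%:E)).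
    apply/measurable_EFinP; apply: measurable_funM => //; apply: measurable_funM.
      by apply: measurable_gaussr; exact: measurable_tsub.
    by apply: measurableT_comp => //; exact: measurableT_comp.
  move=> x _.
  have ih := L1_cv_integrand x t0 Kt (L1le_L1 hM).
  apply: (@le_trans _ _ (\int[mu]_y (`|K (tsub x y) * h y|)%:E)%E).
    have := le_normr_Rintegral measurableT ih; rewrite -lee_fin => /le_trans; apply.
    rewrite /Rintegral fineK//; apply: integrable_fin_num => //; exact: integrable_norm.
  apply: ge0_le_integral => //.
  - apply/measurable_EFinP; apply: measurableT_comp => //; apply: measurable_funM => //.
    exact: measurable_ker2.
  - apply/measurable_EFinP; apply: measurable_funM => //; apply: measurable_funM.
      by apply: measurable_gaussr; exact: measurable_tsub.
    exact: measurableT_comp.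
  - by move=> y _; rewrite -!EFinM lee_fin normrM mulrA ler_wpM2r.
rewrite (@fubini_tonelli _ _ _ _ _ mu mu (fun z : V * V => (c * (gauss t (tsub z.1 z.2) * `|h z.2|))%:E))/=.
- apply: (@le_trans _ _ (\int[mu]_y (c%:E * (`|h y|)%:E))%E); last first.
    rewrite ge0_integralZl//; first by rewrite EFinM lee_wpmul2l.
    by apply/measurable_EFinP; exact: measurableT_comp.
  apply: ge0_le_integral => //.
  - by move=> x _; apply: integral_ge0 => y _; rewrite lee_fin mulr_ge0// mulr_ge0// gauss_ge0.
  - apply: (measurable_param_integral mu (g := fun z : V * V => (c * (gauss t (tsub z.2 z.1) * `|h z.1|))%:E)).
    apply/measurable_EFinP; apply: measurable_funM => //; apply: measurable_funM.
      by apply: measurable_gaussr; exact: measurable_tsub.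
    by apply: measurableT_comp => //; exact: measurableT_comp.
  - by apply/measurable_EFinP; apply: measurable_funM => //; exact: measurableT_comp.
  move=> y _; under eq_integral do rewrite mulrA mulrAC EFinM.
  rewrite ge0_integralZl//; first by rewrite integral_gaussl// mule1.
  - by apply/measurable_EFinP; apply: measurable_gaussr; exact: measurable_tsub.
  - by move=> x _; rewrite lee_fin gauss_ge0.
  - by rewrite lee_fin mulr_ge0.
- apply/measurable_EFinP; apply: measurable_funM => //; apply: measurable_funM.
    by apply: measurable_gaussr; exact: measurable_tsub.
  by apply: measurableT_comp => //; exact: measurableT_comp.
- by move=> z; rewrite lee_fin mulr_ge0// mulr_ge0// gauss_ge0.
Qed.

Lemma cvB t c K h g x : 0 < t -> gker t c K -> L1 mu h -> L1 mu g ->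
  cv K (fun y => h y - g y) x = cv K h x - cv K g x.
Proof.
move=> t0 Kt ih ig; rewrite /cv -RintegralB//; try exact: (L1_cv_integrand _ t0 Kt).
by apply: eq_Rintegral => y _; rewrite mulrBr.
Qed.

Lemma cvZ t c K h x k : 0 < t -> gker t c K -> L1 mu h ->
  cv K (fun y => k * h y) x = k * cv K h x.
Proof.
move=> t0 Kt ih; rewrite /cv -RintegralZl//; last exact: (L1_cv_integrand _ t0 Kt).
by apply: eq_Rintegral => y _; rewrite mulrCA.
Qed.

Lemma cv_ae K h g x : measurable_fun setT K -> measurable_fun setT h -> measurable_fun setT g ->
  {ae mu, forall y, h y = g y} -> cv K h x = cv K g x.
Proof.
move=> mK mh mg hg; apply: Rintegral_ae.
- by apply: measurable_funM => //; exact: measurable_ker2.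
- by apply: measurable_funM => //; exact: measurable_ker2.
by move: hg; apply: filterS => y /= ->.
Qed.

(** The composition law of the two kernels enters as a hypothesis, so that one lemma serves the heat
    semigroup and its products with the gradient kernel in either order. *)
Lemma cv_assoc s t c c' K1 K2 K3 h x : 0 < s -> 0 < t -> gker s c K1 -> gker t c' K2 ->
  (forall y, \int[mu]_z (K1 (tsub x z) * K2 (tsub z y)) = K3 (tsub x y)) -> L1 mu h ->
  cv K1 (cv K2 h) x = cv K3 h x.
Proof.
move=> s0 t0 K1s K2t K12 ih; rewrite /cv.
have mh := L1_measurable ih; have [mK1 _] := K1s; have [mK2 _] := K2t.
transitivity (\int[mu]_z \int[mu]_y (K1 (tsub x z) * (K2 (tsub z y) * h y))).
  apply: eq_Rintegral => z _; rewrite -RintegralZl//; exact: (L1_cv_integrand _ t0 K2t).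
rewrite (@Rintegral_Fubini _ _ _ _ _ mu mu (fun u : V * V => K1 (tsub x u.1) * (K2 (tsub u.1 u.2) * h u.2))).
  apply: eq_Rintegral => y _; rewrite -K12 /=.
  under eq_Rintegral do rewrite mulrA.
  rewrite RintegralZr//; apply: (@L1_mulbd _ _ _ _ _ _ (c * s `^ (- (n%:R / 2)))).
  - exact: measurable_ker2.
  - by move=> z; exact: gker_bd.
  apply: (@L1_dom _ _ _ _ _ (fun z => c' * gauss t (tsub y z))); first exact: measurable_ker2.
    by move=> z; rewrite gaussC; case: K2t.
  apply: L1Z; have gk := gauss_gker t; exact: (L1le_L1 (gker_L1le y t0 gk)).
apply: (@L1_prod _ _ _ _ _ _ _ (fun z => K1 (tsub x z)) (fun y => c' * t `^ (- (n%:R / 2)) * h y)).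
- exact: (L1le_L1 (gker_L1le x s0 K1s)).
- exact: L1Z.
- apply: measurable_funM; first exact: measurable_ker2.
  by apply: measurable_funM; [exact: measurable_ker2|exact: measurableT_comp].
- move=> z y; rewrite !normrM /= ler_wpM2l// ler_wpM2r// -normrM.
  by rewrite (le_trans (gker_bd _ t0 K2t))// ler_norm.
Qed.

(** The transposed kernel is the reflection of K: the heat kernel is its own transpose, and the
    gradient kernel changes sign. *)
Lemma cv_adjoint t c K K' h g : 0 < t -> gker t c K -> (forall x y, K (tsub x y) = K' (tsub y x)) ->
  L1 mu h -> L1 mu g -> \int[mu]_x (cv K h x * g x) = \int[mu]_x (h x * cv K' g x).
Proof.
move=> t0 Kt KK ih ig; have [mK _] := Kt.
transitivity (\int[mu]_x \int[mu]_y (K (tsub x y) * h y * g x)).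
  apply: eq_Rintegral => x _; rewrite -RintegralZr//; exact: (L1_cv_integrand _ t0 Kt).
rewrite (@Rintegral_Fubini _ _ _ _ _ mu mu (fun u : V * V => K (tsub u.1 u.2) * h u.2 * g u.1)).
  apply: eq_Rintegral => y _ /=; rewrite /cv -RintegralZl//.
    by apply: eq_Rintegral => x _; rewrite KK; ring.
  under eq_fun do rewrite -KK.
  apply: (@L1_mulbd _ _ _ _ _ _ (c * t `^ (- (n%:R / 2)))) => //; first exact: measurable_ker2.
  by move=> z; exact: gker_bd.
have mh := L1_measurable ih; have mg := L1_measurable ig.
apply: (@L1_prod _ _ _ _ _ _ _ g (fun y => c * t `^ (- (n%:R / 2)) * h y)) => //.
- exact: L1Z.
- apply: measurable_funM; last exact: measurableT_comp.
  by apply: measurable_funM; [exact: measurable_ker2|exact: measurableT_comp].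
- move=> x y; rewrite !normrM /= mulrC ler_wpM2l// ler_wpM2r// -normrM.
  by rewrite (le_trans (gker_bd _ t0 Kt))// ler_norm.
Qed.

End convolution.

(** * The gradient of the heat kernel *)

Section gradient_kernel.
Variables (R : realType) (n : nat).
Local Notation V := (n.-tuple R).
Local Notation mu := (lebn R n).
Implicit Types (h g : V -> R) (x y z : V) (j : 'I_n) (t s r : R).

Lemma heat_cv t h x : 0 < t -> L1 mu h -> heat t h x = cv (gauss t) h x.
Proof.
move=> t0 ih; rewrite /heat intRnE//.
exact: (L1_cv_integrand x t0 (gauss_gker n t) ih).
Qed.

Lemma tsub_tshift x y j r : tsub (tshift x j r) y = tshift (tsub x y) j r.
Proof. by apply: eq_from_tnth => i; rewrite !tnth_mktuple addrAC. Qed.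

Lemma tshift0 x j : tshift x j 0 = x.
Proof. by apply: eq_from_tnth => i; rewrite tnth_mktuple; case: ifP; rewrite addr0. Qed.

Lemma tshiftD x j r s : tshift (tshift x j r) j s = tshift x j (r + s).
Proof. by apply: eq_from_tnth => i; rewrite !tnth_mktuple; case: ifP; rewrite ?addr0// addrA. Qed.

Lemma tnth_tshift x j r : tnth (tshift x j r) j = tnth x j + r.
Proof. by rewrite tnth_mktuple eqxx. Qed.

Lemma is_derive_gauss t z j r : 0 < t ->
  is_derive r 1 (fun s => gauss t (tshift z j s)) (dgauss j t (tshift z j r)).
Proof.
move=> t0; pose S := \sum_(i < n | i != j) tnth z i ^+ 2.
have E s : gauss t (tshift z j s) =
    (4 * pi * t) `^ (- (n%:R / 2)) * expR (- ((S + (tnth z j + s) ^+ 2) / (4 * t))).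
  rewrite /gauss (_ : tnorm2 _ = S + (tnth z j + s) ^+ 2)//.
  rewrite /tnorm2 (bigD1 j)//= tnth_tshift [LHS]addrC; congr (_ + _).
  by apply: eq_bigr => i ij; rewrite tnth_mktuple (negbTE ij) addr0.
under eq_fun do rewrite E.
apply: is_derive_eq; rewrite /dgauss E tnth_tshift /GRing.scale/= !(mulr0, addr0, add0r, mulr1).
by field; rewrite gt_eqF.
Qed.

Lemma measurable_dgauss j t : measurable_fun setT (@dgauss R n j t).
Proof.
apply: measurable_funM; last exact: measurable_gaussr.
apply: measurable_funN; apply: measurable_funM => //.
exact: (measurable_coord j (@measurable_id _ _ setT)).
Qed.

Lemma dgauss_gker j t : 0 < t -> gker (2 * t) (G2 R n / Num.sqrt t) (@dgauss R n j t).
Proof. by move=> t0; split; [exact: measurable_dgauss|move=> z; exact: dgauss_le]. Qed.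

(** Differentiation under the integral. The majorant is |h| times a global bound for the derivative
    of G_t, so integrability of h suffices. *)
Lemma is_derive_cv_gauss t h x j : 0 < t -> L1 mu h ->
  is_derive (0 : R) 1 (fun r => cv (gauss t) h (tshift x j r)) (cv (dgauss j t) h x).
Proof.
move=> t0 ih; have t20 : 0 < 2 * t by rewrite mulr_gt0.
pose f r y := gauss t (tsub (tshift x j r) y) * h y.
have D r y : is_derive r 1 (f ^~ y) (dgauss j t (tsub (tshift x j r) y) * h y).
  rewrite /f; under eq_fun do rewrite tsub_tshift.
  have H := is_derive_gauss (tsub x y) j r t0.
  apply: is_derive_eq; rewrite /GRing.scale/= tsub_tshift; ring.
pose B := G2 R n / Num.sqrt t * (2 * t) `^ (- (n%:R / 2)).
have B0 : 0 <= B by have := gker_bd (tshift x j 0) t20 (dgauss_gker j t0); apply: le_trans.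
have I0 : `](-1), 1[%classic (0 : R) by rewrite /= in_itv/= ltrN10 ltr01.
have intf r : `](-1), 1[%classic r -> mu.-integrable setT (EFin \o f r).
  by move=> _; exact: (L1_cv_integrand _ t0 (gauss_gker n t) ih).
have der r y : `](-1), 1[%classic r -> [set: V] y -> derivable (f ^~ y) r 1.
  by move=> _ _; case: (D r y).
have B0h y : 0 <= B * `|h y| by rewrite mulr_ge0.
have iB : mu.-integrable setT (EFin \o (fun y => B * `|h y|)).
  exact: (L1Z B (integrable_norm ih)).
have ub r y : `](-1), 1[%classic r -> [set: V] y -> `|partial1of2 f r y| <= B * `|h y|.
  move=> _ _; rewrite partial1of2E (@derive_val _ _ _ _ _ _ _ (D r y)) normrM ler_wpM2r//.
  exact: (gker_bd _ t20 (dgauss_gker j t0)).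
have := @derivable_under_integral _ _ _ mu f setT measurableT 0 (-1) 1 I0 intf der _ B0h iB ub.
have := @differentiation_under_integral _ _ _ mu f setT measurableT 0 (-1) 1 I0 intf der _ B0h iB ub.
rewrite derive1E => E Dv; apply: DeriveDef => //.
rewrite -/(cv _ _) in E *; rewrite [LHS]E; apply: eq_Rintegral => y _.
by rewrite partial1of2E (@derive_val _ _ _ _ _ _ _ (D 0 y)) tshift0.
Qed.

Lemma pderiv_heat t h x j : 0 < t -> L1 mu h -> pderiv j (heat t h) x = cv (dgauss j t) h x.
Proof.
move=> t0 ih; rewrite /pderiv derive1E.
under eq_fun do rewrite heat_cv//.
exact: (@derive_val _ _ _ _ _ _ _ (is_derive_cv_gauss x j t0 ih)).
Qed.

Lemma cv_gauss_gauss s t x y : 0 < s -> 0 < t ->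
  \int[mu]_z (gauss s (tsub x z) * gauss t (tsub z y)) = gauss (s + t) (tsub x y).
Proof. by move=> s0 t0; rewrite /Rintegral gauss_semigroup. Qed.

Lemma L1_gauss t y : 0 < t -> L1 mu (fun z => gauss t (tsub z y)).
Proof.
move=> t0; under eq_fun do rewrite gaussC.
exact: (L1le_L1 (gker_L1le y t0 (gauss_gker n t))).
Qed.

(** The two sides are the derivatives at r = 0 of the two sides of the semigroup law, shifted by r
    in direction j. *)
Lemma cv_dgauss_gauss s t x y j : 0 < s -> 0 < t ->
  \int[mu]_z (dgauss j s (tsub x z) * gauss t (tsub z y)) = dgauss j (s + t) (tsub x y).
Proof.
move=> s0 t0; have st0 : 0 < s + t by rewrite addr_gt0.
have D := is_derive_cv_gauss x j s0 (L1_gauss y t0).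
have D' := is_derive_gauss (tsub x y) j 0 st0.
rewrite -[LHS](@derive_val _ _ _ _ _ _ _ D) -{1}(tshift0 (tsub x y) j) -(@derive_val _ _ _ _ _ _ _ D').
rewrite (_ : (fun r => cv (gauss s) (fun z => gauss t (tsub z y)) (tshift x j r)) =
  (fun r => gauss (s + t) (tshift (tsub x y) j r)))//.
by apply/funext => r; rewrite -tsub_tshift; exact: cv_gauss_gauss.
Qed.

Lemma tnth_tsubC x y j : tnth (tsub x y) j = - tnth (tsub y x) j.
Proof. by rewrite !tnth_mktuple opprB. Qed.

Lemma dgaussC j t x y : dgauss j t (tsub x y) = - dgauss j t (tsub y x).
Proof. by rewrite /dgauss gaussC tnth_tsubC !mulNr. Qed.

Section adv.
Variable a : V.

(** The convolution kernel of a . grad e^(t Delta). *)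
Definition pker t z := \sum_(j < n) tnth a j * dgauss j t z.

Lemma pker_gker t : 0 < t -> gker (2 * t) (norm1 a * G2 R n / Num.sqrt t) (pker t).
Proof.
move=> t0; split.
  by apply: measurable_fun_bigsum => j; apply: measurable_funM => //; exact: measurable_dgauss.
move=> z; rewrite (le_trans (ler_norm_sum _ _ _))// -!mulrA /norm1 mulr_suml ler_sum// => j _.
by rewrite normrM ler_wpM2l// mulrA dgauss_le.
Qed.

Lemma adv_cv t h x : 0 < t -> L1 mu h -> adv a t h x = cv (pker t) h x.
Proof.
move=> t0 ih; have t20 : 0 < 2 * t by rewrite mulr_gt0.
rewrite /adv /cv /pker.
transitivity (\sum_(j < n) \int[mu]_y (tnth a j * (dgauss j t (tsub x y) * h y))).
  apply: eq_bigr => j _; rewrite pderiv_heat// /cv RintegralZl//.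
  exact: (L1_cv_integrand _ t20 (dgauss_gker j t0)).
rewrite -Rintegral_bigsum; last first.
  by move=> j; apply: L1Z; exact: (L1_cv_integrand _ t20 (dgauss_gker j t0)).
by apply: eq_Rintegral => y _; rewrite mulr_suml; apply: eq_bigr => j _; rewrite mulrA.
Qed.

Lemma pkerC t x y : pker t (tsub x y) = - pker t (tsub y x).
Proof.
rewrite /pker -sumrN; apply: eq_bigr => j _; by rewrite dgaussC mulrN.
Qed.

Lemma pker_gauss s t x y : 0 < s -> 0 < t ->
  \int[mu]_z (pker s (tsub x z) * gauss t (tsub z y)) = pker (s + t) (tsub x y).
Proof.
move=> s0 t0; have s20 : 0 < 2 * s by rewrite mulr_gt0.
rewrite -[LHS]/(cv (pker s) (fun z => gauss t (tsub z y)) x) -adv_cv//; last exact: L1_gauss.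
apply: eq_bigr => j _; rewrite pderiv_heat//; last exact: L1_gauss.
by rewrite -cv_dgauss_gauss.
Qed.

(** Reflecting all arguments reduces this to [pker_gauss] with the roles of s and t exchanged; the
    two signs from oddness cancel. *)
Lemma gauss_pker s t x y : 0 < s -> 0 < t ->
  \int[mu]_z (gauss s (tsub x z) * pker t (tsub z y)) = pker (s + t) (tsub x y).
Proof.
move=> s0 t0; rewrite addrC pkerC -(pker_gauss y x t0 s0).
rewrite -mulN1r -RintegralZl//.
  by apply: eq_Rintegral => z _; rewrite pkerC gaussC mulrC mulN1r mulNr.
have t20 : 0 < 2 * t by rewrite mulr_gt0.
exact: (L1_cv_integrand _ t20 (pker_gker t0) (L1_gauss x s0)).
Qed.

End adv.
End gradient_kernel.

(** * Translation moduli of kernels and first moments *)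

Section lipschitz_kernels.
Variables (R : realType) (n : nat).
Local Notation V := (n.-tuple R).
Local Notation mu := (lebn R n).
Implicit Types (K h g phi : V -> R) (x y z : V) (j : 'I_n) (t s r A M : R).

Definition tzero : V := [tuple 0 | _ < n].

Lemma tsub0 x : tsub x tzero = x.
Proof. by apply: eq_from_tnth => i; rewrite !tnth_mktuple subr0. Qed.

(** Lipschitz dependence on translations with Gaussian weights at both ends: the form that,
    integrated against a function, produces its first moment. *)
Definition lipker t A K := measurable_fun setT K /\
  forall x y, `|K (tsub x y) - K x| <= A * norm1 y * (gauss t (tsub x y) + gauss t x).

Lemma G2_ge0 : 0 <= G2 R n.
Proof. exact: le_trans ler01 (G2_ge1 _ _). Qed.

Lemma gauss_lipker t : 0 < t -> lipker (2 * t) (4 * G2 R n / Num.sqrt t) (gauss t).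
Proof.
move=> t0; split; first exact: measurable_gaussr.
move=> x y; apply: le_trans (gauss_translation x y t0) _.
by rewrite (_ : 4 * G2 R n / Num.sqrt t * norm1 y = 4 * G2 R n * (norm1 y / Num.sqrt t))//; ring.
Qed.

Lemma measurable_norm1 d (T : measurableType d) (f : T -> V) : measurable_fun setT f ->
  measurable_fun setT (fun w => norm1 (f w)).
Proof.
move=> mf; apply: measurable_fun_bigsum => i.
by apply: measurableT_comp => //; exact: measurable_coord.
Qed.

Lemma L1_gaussx t : 0 < t -> L1 mu (gauss t).
Proof. by move=> t0; have := L1_gauss tzero t0; under eq_fun do rewrite tsub0. Qed.

Lemma L1le_gauss2 s t x w : 0 < s -> 0 < t ->
  L1le mu (fun z => gauss s (tsub x z) * gauss t (tsub z w)) (gauss (s + t) (tsub x w)).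
Proof.
move=> s0 t0; split.
  by apply: measurable_funM; apply: measurable_gaussr; exact: measurable_tsub.
rewrite -(gauss_semigroup x w s0 t0) le_eqVlt; apply/orP; left; apply/eqP.
apply: eq_integral => z _; congr EFin; rewrite ger0_norm//.
by rewrite mulr_ge0// gauss_ge0.
Qed.

Definition Cp (a : V) : R := norm1 a * G2 R n * (8 * G2 R n).

(** A second derivative is avoided by halving the time: the kernel at t is the kernel at t/2
    convolved with G_{t/2}, and the translation is put on the second factor, where
    [gauss_translation] applies. The two factors (t/2)^(-1/2) combine to 1/t. *)
Lemma pker_lipker a t : 0 < t -> lipker (2 * t) (Cp a / t) (pker a t).
Proof.
move=> t0; have t20 : 0 < t / 2 by rewrite divr_gt0.
have tE : t / 2 + t / 2 = t by field.
have t2E : 2 * (t / 2) = t by field.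
have Pg := pker_gker a t20; have [mP Pb] := Pg.
split; first by have [] := pker_gker a t0.
move=> x y; have -> : pker a t (tsub x y) = cv (pker a (t / 2)) (fun z => gauss (t / 2) (tsub z y)) x.
  by rewrite /cv pker_gauss// tE.
have -> : pker a t x = cv (pker a (t / 2)) (fun z => gauss (t / 2) (tsub z tzero)) x.
  by rewrite /cv pker_gauss// tE tsub0.
rewrite t2E in Pg Pb; rewrite -(cvB _ t0 Pg); [|exact: L1_gauss..].
set c := norm1 a * _ / _ in Pg Pb; set d := 4 * G2 R n / Num.sqrt (t / 2).
have N0 := norm1_ge0 y.
have cd : c * d = Cp a / t.
  rewrite /c /d /Cp; have : Num.sqrt (t / 2) != 0 by rewrite gt_eqF// sqrtr_gt0.
  have : t = 2 * Num.sqrt (t / 2) ^+ 2 by rewrite sqr_sqrtr ?t2E// ltW.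
  by move: (Num.sqrt _) => w -> w0; field.
have d0 : 0 <= d by rewrite divr_ge0 ?sqrtr_ge0// mulr_ge0// G2_ge0.
have c0 : 0 <= c by exact: gker_ge0 Pg.
apply: (@Rintegral_L1le _ _ _ mu).
apply: (@L1le_dom _ _ _ _ _ (fun z => c * d * norm1 y * (gauss t (tsub x z) * gauss t (tsub z y) +
    gauss t (tsub x z) * gauss t (tsub z tzero)))).
- apply: measurable_funM; first exact: measurable_ker2.
  by apply: measurable_funB; apply: measurable_gaussr; exact: measurable_tsub.
- move=> z; rewrite normrM tsub0.
  apply: le_trans (ler_pM _ _ (Pb _) (gauss_translation z y t20)) _ => //.
  by rewrite t2E le_eqVlt; apply/orP; left; apply/eqP; rewrite /d; ring.
rewrite -cd.
have iG w : L1le mu (fun z => gauss t (tsub x z) * gauss t (tsub z w)) (gauss (t + t) (tsub x w)).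
  exact: L1le_gauss2.
have := L1leZ (c * d * norm1 y) (L1leD (iG y) (iG tzero)).
rewrite tsub0 (ger0_norm (mulr_ge0 (mulr_ge0 c0 d0) N0)).
by suff -> : 2 * t = t + t by []; ring.
Qed.

(** The difference is the integral of (K(x-y) - K(x)) phi(y), so the translation modulus of K turns
    into a first moment of phi. *)
Lemma lipker_moment t A c K phi x : 0 < t -> 0 <= A -> lipker t A K -> gker t c K ->
  L1 mu phi -> L1 mu (fun y => norm1 y * `|phi y|) ->
  `|cv K phi x - (\int[mu]_y phi y) * K x| <=
  A * (cv (gauss t) (fun y => norm1 y * `|phi y|) x + gauss t x * \int[mu]_y (norm1 y * `|phi y|)).
Proof.
move=> t0 A0 [mK Kl] Kg ip im; have mp := L1_measurable ip.
have iKp := L1_cv_integrand x t0 Kg ip.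
have iKx : L1 mu (fun y => K x * phi y) by exact: L1Z.
have iD := L1B iKp iKx.
have iG := L1_cv_integrand x t0 (gauss_gker n t) im.
have iGx : L1 mu (fun y => gauss t x * (norm1 y * `|phi y|)) by exact: L1Z.
have -> : cv K phi x - (\int[mu]_y phi y) * K x = \int[mu]_y (K (tsub x y) * phi y - K x * phi y).
  by rewrite RintegralB// RintegralZl// mulrC.
rewrite /cv -RintegralZl// -RintegralD// -RintegralZl//; last exact: L1D.
apply: le_trans (le_normr_Rintegral measurableT iD) _.
apply: le_Rintegral => //.
- exact: integrable_norm.
- by apply: L1Z; exact: L1D.
move=> y _; rewrite -mulrBl normrM.
apply: le_trans (ler_wpM2r _ (Kl x y)) _ => //.
by rewrite le_eqVlt; apply/orP; left; apply/eqP; ring.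
Qed.

Lemma L1_moment_gauss t : 0 < t -> L1le mu (fun y => norm1 y * gauss t y) (n%:R * (2 * G2 R n) * Num.sqrt t).
Proof.
move=> t0; have t20 : 0 < 2 * t by rewrite mulr_gt0.
set B := _ * Num.sqrt t.
have B0 : 0 <= B by rewrite !mulr_ge0 ?sqrtr_ge0 ?G2_ge0.
apply: (@L1le_dom _ _ _ _ _ (fun y => B * gauss (2 * t) (tsub y tzero))).
- by apply: measurable_funM; [exact: measurable_norm1|exact: measurable_gaussr].
- move=> y; rewrite [tsub y _](tsub0 y) ger0_norm; last by rewrite mulr_ge0 ?norm1_ge0 ?gauss_ge0.
  rewrite /norm1 mulr_suml; apply: le_trans (ler_sum _ (fun i _ => coord_gauss y i t0)) _.
  rewrite sumr_const card_ord -mulr_natl le_eqVlt; apply/orP; left; apply/eqP; rewrite /B; ring.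
have gl : L1le mu (fun y => gauss (2 * t) (tsub y tzero)) 1.
  have := gker_L1le tzero t20 (gauss_gker n (2 * t)).
  by under eq_fun do rewrite gaussC.
by have := L1leZ B gl; rewrite ger0_norm// mulr1.
Qed.

Lemma moment_gauss_le t y : 0 < t -> norm1 y * gauss t y <= n%:R * (2 * G2 R n) * Num.sqrt t * gauss (2 * t) y.
Proof.
move=> t0; rewrite /norm1 mulr_suml; apply: le_trans (ler_sum _ (fun i _ => coord_gauss y i t0)) _.
by rewrite sumr_const card_ord -mulr_natl le_eqVlt; apply/orP; left; apply/eqP; ring.
Qed.

Lemma cv_gauss_bound s t c K h M x : 0 < s -> 0 < t -> gker s c K -> measurable_fun setT h ->
  (forall y, `|h y| <= M * gauss t y) -> 0 <= M -> `|cv K h x| <= c * M * gauss (s + t) x.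
Proof.
move=> s0 t0 Kg mh hM M0; have c0 := gker_ge0 s0 Kg; have [mK Kb] := Kg.
apply: (@Rintegral_L1le _ _ _ mu).
apply: (@L1le_dom _ _ _ _ _ (fun y => c * M * (gauss s (tsub x y) * gauss t (tsub y tzero)))).
- by apply: measurable_funM => //; exact: measurable_ker2.
- move=> y; rewrite normrM tsub0; apply: le_trans (ler_pM _ _ (Kb _) (hM y)) _ => //.
  by rewrite le_eqVlt; apply/orP; left; apply/eqP; ring.
rewrite -{2}(tsub0 x) -[X in L1le _ _ (X * _)]ger0_norm ?mulr_ge0//; apply: L1leZ.
exact: L1le_gauss2.
Qed.

Lemma Rintegral_gauss t : 0 < t -> \int[mu]_y gauss t y = 1.
Proof.
move=> t0; rewrite /Rintegral (_ : (\int[mu]_y (gauss t y)%:E = 1)%E)//.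
by rewrite -(integral_gaussl tzero t0); apply: eq_integral => y _; rewrite tsub0.
Qed.

Definition Cm : R := n%:R * (2 * G2 R n).

Lemma Cm_ge0 : 0 <= Cm.
Proof. by rewrite mulr_ge0// mulr_ge0// G2_ge0. Qed.

(** For phi below M G_s the first-moment density is of order M sqrt s and again below a Gaussian, of
    time 2s; hence the widths t + 2s and t. It serves for phi = G_e, to compare kernels at two
    times, and for phi of mass zero, where the subtracted term vanishes. *)
Lemma cv_zero_mass s t A c K phi M x : 0 < s -> 0 < t -> 0 <= A -> lipker t A K -> gker t c K ->
  measurable_fun setT phi -> (forall y, `|phi y| <= M * gauss s y) -> 0 <= M ->
  `|cv K phi x - (\int[mu]_y phi y) * K x| <=
  A * (Cm * Num.sqrt s * M) * (gauss (t + 2 * s) x + gauss t x).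
Proof.
move=> s0 t0 A0 Kl Kg mphi pM M0; have s20 : 0 < 2 * s by rewrite mulr_gt0.
have ip : L1 mu phi by apply: (L1_dom mphi pM); apply: L1Z; exact: L1_gaussx.
have mm : measurable_fun setT (fun y => norm1 y * `|phi y|).
  by apply: measurable_funM; [exact: measurable_norm1|exact: measurableT_comp].
have mle : L1le mu (fun y => norm1 y * `|phi y|) (Cm * Num.sqrt s * M).
  apply: (@L1le_dom _ _ _ _ _ (fun y => M * (norm1 y * gauss s y))) => //.
    by move=> y; rewrite ger0_norm ?mulr_ge0 ?norm1_ge0// mulrCA ler_wpM2l ?norm1_ge0.
  by have := L1leZ M (L1_moment_gauss s0); rewrite ger0_norm// mulrC.
apply: le_trans (lipker_moment x t0 A0 Kl Kg ip (L1le_L1 mle)) _.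
rewrite -mulrA ler_wpM2l// mulrDr lerD//; last first.
  rewrite mulrC ler_wpM2r ?gauss_ge0// (le_trans (ler_norm _))//.
  exact: (@Rintegral_L1le _ _ _ mu).
apply: le_trans (ler_norm _) _; rewrite -[leRHS]mul1r mulrA.
apply: (cv_gauss_bound x t0 s20 (gauss_gker n t) mm) => //; last first.
  by rewrite mulr_ge0// mulr_ge0 ?sqrtr_ge0// Cm_ge0.
move=> y; rewrite ger0_norm; last by rewrite mulr_ge0 ?norm1_ge0.
apply: le_trans (ler_wpM2l (norm1_ge0 y) (pM y)) _.
by have := ler_wpM2l M0 (moment_gauss_le y s0); rewrite -/Cm; lra.
Qed.

End lipschitz_kernels.

(** * Functions bounded in L^1 and, with weight t^(n/2), in L^oo *)

Section weighted_bounds.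
Variables (R : realType) (n : nat).
Local Notation V := (n.-tuple R).
Local Notation mu := (lebn R n).
Implicit Types (K h g : V -> R) (x y z : V) (t s r c M N : R).

Definition hw t : R := t `^ (- (n%:R / 2)).

Lemma hw_ge0 t : 0 <= hw t. Proof. exact: powR_ge0. Qed.

Lemma hw_gt0 t : 0 < t -> 0 < hw t. Proof. by move=> t0; exact: powR_gt0. Qed.

Lemma hw_mono s t : 0 < s -> s <= t -> hw t <= hw s.
Proof. by move=> s0 st; apply: ge0_ler_powRN => //; exact: n2_ge0. Qed.

Lemma hw_scale c t : 0 < c -> 0 < t -> hw t = c `^ (n%:R / 2) * hw (c * t).
Proof.
move=> c0 t0; rewrite /hw powRM ?(ltW c0) ?(ltW t0)// mulrA -powRD ?subrr ?powRr0 ?mul1r//.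
by rewrite (gt_eqF c0) implybT.
Qed.

(** The sup bound holds almost everywhere here because u is known only up to null sets. The
    pointwise version [bde] holds for what is produced by convolutions and time integrals. *)
Definition bd t M h := L1le mu h M /\ {ae mu, forall x, `|h x| <= M * hw t}.
Definition bde t M h := L1le mu h M /\ forall x, `|h x| <= M * hw t.

Lemma bde_bd t M h : bde t M h -> bd t M h.
Proof. by move=> [hM hb]; split => //; apply: aeW. Qed.

Lemma bd_L1 t M h : bd t M h -> L1 mu h.
Proof. by move=> [hM _]; exact: L1le_L1 hM. Qed.

Lemma bd_measurable t M h : bd t M h -> measurable_fun setT h.
Proof. by move=> [[]]. Qed.

Lemma bd_ge0 t M h : bd t M h -> 0 <= M.
Proof. by move=> [/L1le_ge0]. Qed.

Lemma bd_weak t M M' h : M <= M' -> bd t M h -> bd t M' h.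
Proof.
move=> MM [hM hb]; split; first exact: L1le_weak hM.
by move: hb; apply: filterS => x; move/le_trans; apply; rewrite ler_wpM2r// hw_ge0.
Qed.

Lemma bde_weak t M M' h : M <= M' -> bde t M h -> bde t M' h.
Proof.
move=> MM [hM hb]; split; first exact: L1le_weak hM.
by move=> x; rewrite (le_trans (hb x))// ler_wpM2r// hw_ge0.
Qed.

Lemma bd_time c s t M h : 0 < s -> 0 < t -> 1 <= c -> s <= c * t ->
  bd t M h -> bd s (c `^ (n%:R / 2) * M) h.
Proof.
move=> s0 t0 c1 sct hb; have M0 := bd_ge0 hb; case: hb => hM hb.
have c0 : 0 < c by exact: lt_le_trans c1.
have C1 : 1 <= c `^ (n%:R / 2) by rewrite ge1_powR// n2_ge0.
split; first by apply: L1le_weak hM; rewrite ler_peMl.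
move: hb; apply: filterS => x /le_trans; apply.
by rewrite (hw_scale c0 t0) mulrA [M * _]mulrC ler_wpM2l ?mulr_ge0 ?powR_ge0// hw_mono.
Qed.

Lemma bdD t M N h g : bd t M h -> bd t N g -> bd t (M + N) (fun x => h x + g x).
Proof.
move=> [hM hb] [gN gb]; split; first exact: L1leD.
move: hb gb; apply: filterS2 => x hx gx.
by rewrite mulrDl (le_trans (ler_normD _ _))// lerD.
Qed.

Lemma bdB t M N h g : bd t M h -> bd t N g -> bd t (M + N) (fun x => h x - g x).
Proof.
move=> [hM hb] [gN gb]; split; first exact: L1leB.
move: hb gb; apply: filterS2 => x hx gx.
by rewrite mulrDl (le_trans (ler_normB _ _))// lerD.
Qed.

Lemma bd_ae t M h g : measurable_fun setT g -> {ae mu, forall x, h x = g x} -> bd t M h -> bd t M g.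
Proof.
move=> mg hg [hM hb]; split; first exact: L1le_ae hM.
by move: hb hg; apply: filterS2 => x hx <-.
Qed.

Lemma bde_gauss c t M h : 0 < t -> 1 <= c -> 0 <= M -> measurable_fun setT h ->
  (forall x, `|h x| <= M * gauss (c * t) x) -> bde t M h.
Proof.
move=> t0 c1 M0 mh hM; have c0 : 0 < c by exact: lt_le_trans c1.
have ct0 : 0 < c * t by rewrite mulr_gt0.
split; last first.
  move=> x; rewrite (le_trans (hM x))// ler_wpM2l// (le_trans (gauss_le _ ct0))//.
  by apply: hw_mono => //; rewrite ler_peMl// ltW.
apply: (@L1le_dom _ _ _ _ _ (fun x => M * gauss (c * t) (tsub x (tzero R n)))) => //.
  by move=> x; rewrite [tsub x _](tsub0 x).
rewrite -[M in X in L1le _ _ X]mulr1 -[X in L1le _ _ (X * _)](ger0_norm M0); apply: L1leZ.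
have := gker_L1le (tzero R n) ct0 (gauss_gker n (c * t)).
by under eq_fun do rewrite gaussC.
Qed.

(** If the kernel time r is at least t/2, the height of the kernel yields the weight t^(-n/2) from
    the L^1 bound. If the source time s is, the source already has this weight and the mass of the
    kernel passes it on. *)
Lemma cv_bde c K r s t M h : 0 < r -> 0 < s -> 0 < t -> t <= 2 * r \/ t <= 2 * s ->
  gker r c K -> bd s M h -> bde t (G2 R n * c * M) (cv K h).
Proof.
move=> r0 s0 t0 trs Kg hb; have c0 := gker_ge0 r0 Kg; have M0 := bd_ge0 hb.
have [hM hsup] := hb; have mh := bd_measurable hb.
split.
  by apply: L1le_weak (cv_L1le r0 Kg hM); rewrite -mulrA ler_peMl ?mulr_ge0// G2_ge1.
move=> x; case: trs => ts.
  apply: le_trans (cv_sup1 x r0 Kg hM) _.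
  have -> : c * r `^ (- (n%:R / 2)) * M = c * M * hw r by rewrite /hw; ring.
  rewrite (hw_scale (ltr0Sn R 1) r0) -/(G2 R n).
  rewrite [leRHS](_ : _ = c * M * (G2 R n * hw t)); last by ring.
  by rewrite ler_wpM2l ?mulr_ge0// ler_wpM2l ?G2_ge0// hw_mono.
apply: le_trans (cv_sup2 x r0 Kg mh hsup _) _; first by rewrite mulr_ge0// hw_ge0.
rewrite (hw_scale (ltr0Sn R 1) s0) -/(G2 R n) mulrA.
rewrite [leRHS](_ : _ = c * M * (G2 R n * hw t)); last by ring.
by rewrite ler_wpM2l ?mulr_ge0// ler_wpM2l ?G2_ge0// hw_mono.
Qed.

End weighted_bounds.

(** * Integration over time of families of functions *)

Section time_integrals.
Variables (R : realType) (n : nat).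
Local Notation V := (n.-tuple R).
Local Notation mu := (lebn R n).
Local Notation leb := (@lebesgue_measure R).
Local Notation Rb := (measurableTypeR R).
Implicit Types (D : set Rb) (F G : R -> V -> R) (x y : V) (t s r c M N I B : R) (k : R -> R).

(** Extension by zero outside the time set, so that joint measurability and Fubini can be used on
    the full product space. *)
Definition ext D F (z : Rb * V) : R := if z.1 \in D then F z.1 z.2 else 0.
Definition jm D F := measurable_fun setT (ext D F).
Definition tint D F x : R := \int[leb]_(s in D) F s x.

Lemma tintE D F x : tint D F x = \int[leb]_s ext D F (s, x).
Proof. by rewrite /tint Rintegral_mkcond. Qed.

Lemma eq_jm D F G : (forall s x, D s -> F s x = G s x) -> jm D F -> jm D G.
Proof.
move=> FG; rewrite /jm (_ : ext D F = ext D G)//.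
by apply/funext => -[s x]; rewrite /ext /=; case: ifPn => //; rewrite inE => /FG.
Qed.

Lemma eq_tint D F G x : (forall s, D s -> F s x = G s x) -> tint D F x = tint D G x.
Proof. by move=> FG; apply: eq_Rintegral => s; rewrite inE => /FG. Qed.

Lemma measurable_mem D d (T : measurableType d) (f : T -> Rb) : measurable D -> measurable_fun setT f ->
  measurable_fun setT (fun w => f w \in D).
Proof.
move=> mD mf; apply: (@measurable_fun_bool _ _ _ _ true).
rewrite setTI (_ : _ @^-1` _ = f @^-1` D); first by rewrite -[X in measurable X]setTI; exact: mf.
by apply/seteqP; split => w /= Dw; [exact: set_mem|exact: mem_set].
Qed.

Lemma jm_sub D D' F : measurable D' -> D' `<=` D -> jm D F -> jm D' F.
Proof.
move=> mD' DD mF; rewrite /jm (_ : ext D' F = fun z => if z.1 \in D' then ext D F z else 0).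
  by apply: measurable_fun_ifT => //; exact: measurable_mem.
apply/funext => -[s x]; rewrite /ext/=; case: ifPn => //; rewrite inE => /DD Ds.
by rewrite mem_set.
Qed.

Lemma jmB D F G : jm D F -> jm D G -> jm D (fun s x => F s x - G s x).
Proof.
move=> mF mG; rewrite /jm (_ : ext D _ = ext D F \- ext D G); first exact: measurable_funB.
by apply/funext => z; rewrite /ext/=; case: ifPn; rewrite ?subrr.
Qed.

Lemma jm_measurable D F s : D s -> jm D F -> measurable_fun setT (F s).
Proof.
move=> Ds mF; have := measurableT_comp mF (@pair1_measurable _ _ _ _ s).
by rewrite (_ : _ \o _ = F s)//; apply/funext => x /=; rewrite /ext/= mem_set.
Qed.

Lemma ext_measurable1 D F x : jm D F -> measurable_fun setT (fun s => ext D F (s, x)).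
Proof. by move=> mF; exact: (measurableT_comp mF (@pair2_measurable _ _ _ _ x)). Qed.

Section bound.
Variables (D : set Rb) (k : R -> R) (I : R).
Hypotheses (mD : measurable D) (mk : measurable_fun D (k : Rb -> R))
  (kI : (\int[leb]_(s in D) (k s)%:E <= I%:E)%E) (k0 : forall s, D s -> 0 <= k s).

Let kz s : R := if s \in D then k s else 0.

Let mkz : measurable_fun setT (kz : Rb -> R).
Proof. exact: (measurable_restrictT _ _).1 mk. Qed.

Let kz0 s : 0 <= kz s.
Proof. by rewrite /kz; case: ifPn => //; rewrite inE => /k0. Qed.

Let kzI : (\int[leb]_s (kz s)%:E <= I%:E)%E.
Proof.
apply: le_trans kI; rewrite [leRHS]integral_mkcond le_eqVlt; apply/orP; left; apply/eqP.
by apply: eq_integral => s _; rewrite /kz /patch; case: ifP.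
Qed.

Lemma ext_L1le F x B : jm D F -> (forall s, D s -> `|F s x| <= k s * B) -> 0 <= B ->
  L1le leb (fun s => ext D F (s, x)) (I * B).
Proof.
move=> mF FB B0; apply: (@L1le_dom _ _ _ leb _ (fun s : Rb => B * kz s)).
- exact: ext_measurable1.
- move=> s; rewrite /ext/= /kz; case: ifPn; rewrite ?normr0 ?mulr0// inE => Ds.
  by rewrite mulrC FB.
rewrite mulrC -[X in L1le _ _ (X * _)](ger0_norm B0); apply: L1leZ; split => //.
by under eq_integral do rewrite ger0_norm//.
Qed.

Lemma tint_le F x B : jm D F -> (forall s, D s -> `|F s x| <= k s * B) -> 0 <= B ->
  `|tint D F x| <= I * B.
Proof. by move=> mF FB B0; rewrite tintE; apply: Rintegral_L1le; exact: ext_L1le. Qed.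

Lemma measurable_tint F : jm D F -> measurable_fun setT (tint D F).
Proof.
move=> mF; rewrite (_ : tint D F = fun x => \int[leb]_s ext D F (s, x)); last first.
  by apply/funext => x; exact: tintE.
apply: (measurable_param_Rintegral leb (g := fun z : V * Rb => ext D F (z.2, z.1))).
by apply: (measurableT_comp mF); exact: measurable_swap.
Qed.

(** Minkowski's inequality for the time integral: k bounds both norms of each slice, and the L^1
    half is Tonelli. *)
Lemma bde_tint F t : jm D F -> (forall s, D s -> bde t (k s) (F s)) -> bde t I (tint D F).
Proof.
move=> mF Fb; have mt := measurable_tint mF; have w0 := hw_ge0 n t.
have FB x s : D s -> `|F s x| <= k s * hw n t by move=> /Fb[].
split; last by move=> x; apply: tint_le => // s; exact: FB.
split=> //; apply: (@le_trans _ _ (\int[mu]_x \int[leb]_s (`|ext D F (s, x)|)%:E)%E).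
  apply: ge0_le_integral => //.
  - by apply/measurable_EFinP; exact: measurableT_comp.
  - apply: (measurable_param_integral leb (g := fun z : V * Rb => (`|ext D F (z.2, z.1)|)%:E)).
    apply/measurable_EFinP; apply: measurableT_comp => //.
    by apply: (measurableT_comp mF); exact: measurable_swap.
  move=> x _; rewrite tintE.
  have iF := L1le_L1 (ext_L1le mF (FB x) w0).
  have := le_normr_Rintegral measurableT iF; rewrite -lee_fin => /le_trans; apply.
  by rewrite /Rintegral fineK//; apply: integrable_fin_num => //; exact: integrable_norm.
rewrite (@fubini_tonelli _ _ _ _ _ mu leb (fun z : V * Rb => (`|ext D F (z.2, z.1)|)%:E))//=; last first.
  apply/measurable_EFinP; apply: measurableT_comp => //.
  by apply: (measurableT_comp mF); exact: measurable_swap.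
apply: le_trans kzI; apply: ge0_le_integral => //.
- by move=> s _; apply: integral_ge0.
- apply: (measurable_param_integral mu (g := fun z => (`|ext D F z|)%:E)).
  by apply/measurable_EFinP; exact: measurableT_comp.
- exact/measurable_EFinP.
move=> s _; rewrite /ext/= /kz; case: ifPn => [|_]; last first.
  by under eq_integral do rewrite normr0; rewrite integral0.
by rewrite inE => /Fb[[]].
Qed.

Lemma tintB F G x B : jm D F -> jm D G -> (forall s, D s -> `|F s x| <= k s * B) ->
  (forall s, D s -> `|G s x| <= k s * B) -> 0 <= B ->
  tint D (fun s x => F s x - G s x) x = tint D F x - tint D G x.
Proof.
move=> mF mG FB GB B0; rewrite !tintE -RintegralB//.
- by apply: eq_Rintegral => s _; rewrite /ext/=; case: ifP; rewrite ?subrr.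
- exact: (L1le_L1 (ext_L1le mF FB B0)).
- exact: (L1le_L1 (ext_L1le mG GB B0)).
Qed.

End bound.

Lemma measurable_pker (a : V) d (T : measurableType d) (t : T -> R) (f : T -> V) :
  measurable_fun setT t -> measurable_fun setT f -> measurable_fun setT (fun w => pker a (t w) (f w)).
Proof.
move=> mt mf; apply: measurable_fun_bigsum => j; apply: measurable_funM => //.
apply: measurable_funM; last exact: measurable_gauss.
apply: measurable_funN; apply: measurable_funM; first exact: measurable_coord.
by apply: measurable_invr; exact: measurable_funM.
Qed.

Lemma cv_ext D K F (s : Rb) x : \int[mu]_y (K (tsub x y) * ext D F (s, y)) =
  if s \in D then cv K (F s) x else 0.
Proof.
rewrite /cv /ext/=; case: ifP => // _.
by under eq_Rintegral do rewrite mulr0; rewrite Rintegral_cst// mul0r.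
Qed.

Lemma jm_cv (a : V) D t F : jm D F -> jm D (fun s => cv (pker a (t - s)) (F s)).
Proof.
move=> mF; rewrite /jm (_ : ext D _ =
    fun z : Rb * V => \int[mu]_y (pker a (t - z.1) (tsub z.2 y) * ext D F (z.1, y))).
  apply: (measurable_param_Rintegral mu (g := fun w : (Rb * V) * V =>
    pker a (t - w.1.1) (tsub w.1.2 w.2) * ext D F (w.1.1, w.2))).
  apply: measurable_funM.
    apply: measurable_pker.
      by apply: measurable_funB => //; exact: (measurableT_comp measurable_fst measurable_fst).
    by apply: measurable_tsub => //; exact: (measurableT_comp measurable_snd measurable_fst).
  apply: (measurableT_comp mF); apply: measurable_fun_pair => //.
  exact: (measurableT_comp measurable_fst measurable_fst).
by apply/funext => -[s x]; rewrite cv_ext.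
Qed.

(** The end point of the integral is the time variable itself. It is moved into the integrand as the
    condition r < s, which leaves an ordinary parametric integral over a fixed space. *)
Lemma jm_duhamel (a : V) D F : jm D F ->
  measurable_fun setT (fun w : Rb * V => tint (D `&` [set r | r < w.1]) (fun r => cv (pker a (w.1 - r)) (F r)) w.2).
Proof.
move=> mF; rewrite (_ : (fun _ => _) = fun w : Rb * V => \int[leb]_r (if r < w.1 then
    \int[mu]_y (pker a (w.1 - r) (tsub w.2 y) * ext D F (r, y)) else 0)).
  apply: (measurable_param_Rintegral leb (g := fun w : (Rb * V) * Rb => if w.2 < w.1.1 then
    \int[mu]_y (pker a (w.1.1 - w.2) (tsub w.1.2 y) * ext D F (w.2, y)) else 0)).
  have m11 : measurable_fun setT (fun w : (Rb * V) * Rb => w.1.1).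
    exact: (measurableT_comp measurable_fst measurable_fst).
  apply: measurable_fun_ifT => //; first by apply: measurable_fun_ltr => //; exact: measurable_snd.
  apply: (measurable_param_Rintegral mu (g := fun w : ((Rb * V) * Rb) * V =>
    pker a (w.1.1.1 - w.1.2) (tsub w.1.1.2 w.2) * ext D F (w.1.2, w.2))).
  have m12 : measurable_fun setT (fun w : (Rb * V * Rb) * V => w.1.2).
    exact: (measurableT_comp measurable_snd measurable_fst).
  apply: measurable_funM.
    apply: measurable_pker.
      by apply: measurable_funB => //; exact: (measurableT_comp m11 measurable_fst).
    apply: measurable_tsub => //.
    exact: (measurableT_comp (measurableT_comp measurable_snd measurable_fst) measurable_fst).
  by apply: (measurableT_comp mF); exact: measurable_fun_pair.
apply/funext => -[s x]; rewrite tintE /=; apply: eq_Rintegral => r _.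
rewrite cv_ext /ext/= in_setI; case: (ltP r s) => rs.
  by rewrite [X in _ && X]mem_set// andbT.
by rewrite [X in _ && X]memNset ?andbF// /= ltNge rs.
Qed.

(** A Caratheodory argument: a function measurable in space and continuous in time is a limit of
    functions that are piecewise constant in time. *)
Lemma jm_carath (lo hi : R) F : lo < hi -> (forall s, lo < s < hi -> measurable_fun setT (F s)) ->
  (forall x s, lo < s < hi -> {for s, continuous (F ^~ x)}) -> jm `]lo, hi[ F.
Proof.
move=> lohi mF cF; pose D : set Rb := `]lo, hi[%classic.
have hl0 : 0 < hi - lo by rewrite subr_gt0.
pose y (s : R) := (s - lo) / (hi - lo).
(* Midpoints of m + 1 equal cells. They stay strictly inside the interval, the only place where F is
   controlled. *)
pose pt (m j : nat) := lo + (hi - lo) * ((j%:R + 1 / 2) / m.+1%:R).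
pose inI (m j : nat) (s : R) := (j%:R <= y s * m.+1%:R) && (y s * m.+1%:R < j.+1%:R).
pose h (m : nat) (w : Rb * V) : R := if w.1 \in D then
  \sum_(j < m.+1) (if inI m j w.1 then F (pt m j) w.2 else 0) else 0.
have ptD m j : (j < m.+1)%N -> lo < pt m j < hi.
  move=> jm; have m0 : 0 < m.+1%:R :> R by rewrite ltr0n.
  have j1 : j%:R + 1 <= m.+1%:R :> R by rewrite natr1 ler_nat.
  have j0 : 0 <= j%:R :> R by [].
  apply/andP; split; first by rewrite ltrDl mulr_gt0// divr_gt0//; lra.
  rewrite -ltrBrDl -[ltRHS]mulr1 ltr_pM2l// ltr_pdivrMr// mul1r; lra.
apply: (@measurable_fun_cvg _ _ _ setT h) => //.
  move=> m; apply: measurable_fun_ifT => //.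
    exact: (@measurable_mem D _ _ _ (measurable_itv _) measurable_fst).
  apply: measurable_fun_bigsum => j.
  have my : measurable_fun setT (fun w : Rb * V => y w.1 * m.+1%:R).
    apply: measurable_funM => //; apply: measurable_funM => //.
    by apply: measurable_funB => //; exact: measurable_fst.
  apply: measurable_fun_ifT => //.
    apply: measurable_and; [exact: measurable_fun_ler|exact: measurable_fun_ltr].
  by apply: measurableT_comp => //; apply: mF; exact: ptD.
move=> [s x] _; rewrite /ext /h /=; case: ifPn => [|_]; last exact: cvg_cst.
rewrite inE/= in_itv/= => sD.
have ys : 0 < y s < 1.
  case/andP: sD => los shi; apply/andP; split; first by rewrite divr_gt0// subr_gt0.
  by rewrite ltr_pdivrMr// mul1r; lra.
pose q (m : nat) := Num.truncn (y s * m.+1%:R).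
have qP m : inI m (q m) s.
  rewrite /inI /q; apply: Num.Theory.truncn_itv.
  by rewrite mulr_ge0//; case/andP: ys => /ltW.
have qm m : (q m < m.+1)%N.
  have /andP[qy _] := qP m; rewrite -(ltr_nat R); apply: le_lt_trans qy _.
  by rewrite gtr_pMl ?ltr0n//; case/andP: ys.
have E m : \sum_(j < m.+1) (if inI m j s then F (pt m j) x else 0) = F (pt m (q m)) x.
  rewrite (bigD1 (Ordinal (qm m)))//= qP big1 ?addr0// => j jq.
  case: ifPn => // /andP[j1 j2]; have /andP[q1 q2] := qP m.
  have : (j < (q m).+1)%N by rewrite -(ltr_nat R); exact: le_lt_trans q2.
  have : (q m < j.+1)%N by rewrite -(ltr_nat R); exact: le_lt_trans j2.
  rewrite !ltnS => jq1 jq2; case/negP: jq; apply/eqP/val_inj => /=.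
  by apply/eqP; rewrite eqn_leq jq2.
under eq_fun do rewrite E.
have /= cs := cF x s sD.
apply: (@cvg_comp _ _ _ (fun m => pt m (q m)) (F ^~ x) _ (nbhs s)) => //.
apply/cvgrPdist_le => /= e e0; near=> m.
have m0 : 0 < m.+1%:R :> R by rewrite ltr0n.
have sE : s = lo + (hi - lo) * y s by rewrite /y; field; rewrite gt_eqF.
have -> : s - pt m (q m) = (hi - lo) * ((y s * m.+1%:R - (q m)%:R - 1 / 2) / m.+1%:R).
  by rewrite {1}sE /pt; field; rewrite gt_eqF.
rewrite normrM (gtr0_norm hl0) normrM (gtr0_norm (_ : 0 < m.+1%:R^-1)) ?invr_gt0//.
apply: (@le_trans _ _ ((hi - lo) * (1 / m.+1%:R))).
  rewrite ler_pM2l// ler_pM2r ?invr_gt0// ler_norml.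
  by have /andP[] := qP m; rewrite -natr1 => q1 q2; apply/andP; split; lra.
rewrite mulrCA mul1r ler_pdivrMr// mulrC -ler_pdivrMr//.
apply: (@le_trans _ _ m%:R); last by rewrite ler_nat.
by near: m; exact: nbhs_infty_ger.
Unshelve. all: by end_near. Qed.

End time_integrals.

(** * Beta-type integrals in time *)

Section scalar_integrals.
Variable R : realType.
Local Notation leb := (@lebesgue_measure R).
Local Notation Rb := (measurableTypeR R).
Implicit Types (lo hi s t I b d : R) (g G : R -> R).

(** The integrands may be singular at an end point. The fundamental theorem is applied on closed
    subintervals exhausting the open one, and the bound passes to the limit by monotone
    convergence. *)
Lemma integral_oo_le lo hi g G I : lo < hi ->
  (forall s, lo < s < hi -> is_derive s 1 G (g s)) ->
  (forall s, lo < s < hi -> {for s, continuous g}) ->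
  (forall s, lo < s < hi -> 0 <= g s) ->
  (forall x y, lo < x -> x < y -> y < hi -> G y - G x <= I) ->
  measurable_fun `]lo, hi[ (g : Rb -> R) /\ (\int[leb]_(s in `]lo, hi[) (g s)%:E <= I%:E)%E.
Proof.
move=> lohi dG cg g0 GI; have d0 : 0 < hi - lo by rewrite subr_gt0.
have mg : measurable_fun `]lo, hi[ (g : Rb -> R).
  apply: open_continuous_measurable_fun; first exact: interval_open.
  by move=> s; rewrite inE/= in_itv/= => /cg.
split=> //.
(* The denominator m + 3 keeps 2 e(m) below hi - lo, so that even the first subinterval is
   nondegenerate. *)
pose e (m : nat) := (hi - lo) / m.+3%:R.
have e0 m : 0 < e m by rewrite divr_gt0.
have e2 m : 2 * e m < hi - lo.
  rewrite /e mulrCA -[ltRHS]mulr1 ltr_pM2l// ltr_pdivrMr// mul1r ltr_nat//.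
pose F (m : nat) : set Rb := `[lo + e m, hi - e m]%classic.
have eS m m' : (m <= m')%N -> e m' <= e m.
  by move=> mm; rewrite /e ler_pM2l// lef_pV2 ?posrE// ler_nat !ltnS.
have nF : nondecreasing_seq F.
  move=> m m' mm; apply/subsetPset => s; rewrite /F/= !in_itv/= => /andP[s1 s2].
  by have := eS _ _ mm => ee; apply/andP; split; lra.
have FD m s : F m s -> lo < s < hi.
  by rewrite /F/= in_itv/= => /andP[s1 s2]; have := e0 m => em; apply/andP; split; lra.
have UF : \bigcup_m F m = `]lo, hi[%classic.
  apply/seteqP; split => [s [m _ /FD]|s]; first by rewrite /= in_itv.
  rewrite /= in_itv/= => /andP[s1 s2].
  pose mn := Num.min (s - lo) (hi - s).
  have mn0 : 0 < mn by rewrite lt_min !subr_gt0 s1.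
  have [m _ mm] : \forall m \near \oo, (hi - lo) / mn <= m%:R by exact: nbhs_infty_ger.
  exists m => //; rewrite /F/= in_itv/=.
  have em : e m <= mn.
    rewrite /e ler_pdivrMr// mulrC -ler_pdivrMr//.
    apply: (le_trans (mm m _)) => //=; rewrite ler_nat.
    by rewrite -addn3 leq_addr.
  have : mn <= s - lo by rewrite ge_min lexx.
  have : mn <= hi - s by rewrite ge_min lexx orbT.
  by move=> h1 h2; apply/andP; split; lra.
rewrite -UF.
have mgF m : measurable_fun (F m) (EFin \o (g : Rb -> R)).
  apply/measurable_EFinP; apply: measurable_funS mg => //.
  by rewrite -UF; exact: bigcup_sup.
have H := @ge0_nondecreasing_set_cvg_integral _ _ _ F (EFin \o (g : Rb -> R)) leb nF (fun m => measurable_itv _) mgF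
  (fun m s Fs => (g0 s (FD m s Fs))).
rewrite -(cvg_lim _ H)//; apply: lime_le; first by apply/cvg_ex; eexists; exact: H.
apply: nearW => m /=.
have ab : lo + e m < hi - e m by have := e2 m; lra.
have FDi s : lo + e m <= s <= hi - e m -> lo < s < hi by move=> ?; apply: (FD m); rewrite /F/= in_itv.
have cG s : lo < s < hi -> {for s, continuous G}.
  move=> /dG dGs; apply: differentiable_continuous; apply/derivable1_diffP.
  by case: dGs.
rewrite (@continuous_FTC2 _ g G)//.
- by rewrite -EFinB lee_fin; apply: GI => //; have := e0 m; have := e2 m; lra.
- by apply: continuous_in_subspaceT => s; rewrite inE/= in_itv/= => /FDi /cg.
- split.
  + by move=> s; rewrite in_itv/= => /andP[s1 s2]; have [] : is_derive s 1 G (g s) by apply: dG; apply: FDi; rewrite !ltW.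
  + by apply: cvg_at_right_filter; apply: cG; apply: FDi; rewrite lexx ltW.
  + by apply: cvg_at_left_filter; apply: cG; apply: FDi; rewrite lexx ltW.
- move=> s; rewrite in_itv/= => /andP[s1 s2].
  have dGs : is_derive s 1 G (g s) by apply: dG; apply: FDi; rewrite !ltW.
  by rewrite derive1E (@derive_val _ _ _ _ _ _ _ dGs).
Qed.

Lemma continuous_powRx b s : 0 < s -> {for s, continuous (fun u : R => u `^ b)}.
Proof.
move=> s0; apply: differentiable_continuous; apply/derivable1_diffP.
by apply: derivable_powR; rewrite in_itv/= s0.
Qed.

Lemma int_powR b lo hi : b < 1 -> 0 <= lo -> lo < hi ->
  measurable_fun `]lo, hi[ (fun s : Rb => s `^ (- b)) /\
  (\int[leb]_(s in `]lo, hi[) (s `^ (- b))%:E <= (hi `^ (1 - b) / (1 - b))%:E)%E.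
Proof.
move=> b1 lo0 lohi; have b10 : 0 < 1 - b by rewrite subr_gt0.
apply: (@integral_oo_le lo hi (fun s => s `^ (- b)) (fun s => s `^ (1 - b) / (1 - b))) => //.
- move=> s /andP[ls _]; have s0 : 0 < s by exact: le_lt_trans ls.
  have dp := is_derive1_powR (1 - b) s0.
  apply: is_derive_eq; rewrite /GRing.scale/= !(mulr0, addr0, add0r, mulr1).
  rewrite (_ : 1 - b - 1 = - b); last by ring.
  by field; rewrite gt_eqF.
- by move=> s /andP[ls _]; apply: continuous_powRx; exact: le_lt_trans ls.
- by move=> s _; exact: powR_ge0.
move=> x y lx xy yh; have x0 : 0 < x by exact: le_lt_trans lx.
rewrite -mulrBl ler_pM2r ?invr_gt0// lerBlDr (@le_trans _ _ (hi `^ (1 - b)))// ?lerDl ?powR_ge0//.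
by rewrite ge0_ler_powR ?nnegrE ?ltW//; [exact: lt_trans xy|exact: le_lt_trans lohi].
Qed.

Lemma int_powR_rev b lo hi : b < 1 -> lo < hi ->
  measurable_fun `]lo, hi[ (fun s : Rb => (hi - s) `^ (- b)) /\
  (\int[leb]_(s in `]lo, hi[) ((hi - s) `^ (- b))%:E <= ((hi - lo) `^ (1 - b) / (1 - b))%:E)%E.
Proof.
move=> b1 lohi; have b10 : 0 < 1 - b by rewrite subr_gt0.
apply: (@integral_oo_le lo hi (fun s => (hi - s) `^ (- b)) (fun s => - ((hi - s) `^ (1 - b) / (1 - b)))) => //.
- move=> s /andP[ls sh]; have s0 : 0 < hi - s by rewrite subr_gt0.
  have dp := is_derive1_powR (1 - b) s0.
  have dc : is_derive s (1 : R) (fun u : R => (hi - u) `^ (1 - b)) (- ((1 - b) * (hi - s) `^ (1 - b - 1))).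
    apply: is_derive_eq.
      apply: (@is_derive1_comp _ (fun u : R => u `^ (1 - b)) (fun u => hi - u)).
    by rewrite add0r mul1r mulrN mulr1.
  apply: is_derive_eq; rewrite /GRing.scale/= !(mulr0, addr0, add0r, mulr1).
  rewrite (_ : 1 - b - 1 = - b); last by ring.
  by field; rewrite gt_eqF.
- move=> s /andP[ls sh]; apply: (@continuous_comp _ _ _ (fun u : R => hi - u) (fun u => u `^ (- b))).
    by apply: cvgB; [exact: cvg_cst|exact: cvg_id].
  by apply: continuous_powRx; rewrite subr_gt0.
- by move=> s _; exact: powR_ge0.
move=> x y lx xy yh; rewrite opprK addrC -mulrBl ler_pM2r ?invr_gt0// lerBlDr.
rewrite (@le_trans _ _ ((hi - lo) `^ (1 - b)))// ?lerDl ?powR_ge0//.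
by rewrite ge0_ler_powR ?nnegrE ?(ltW b10)//; lra.
Qed.

Lemma int_powR_tail d lo hi : 0 < d -> 1 <= lo -> lo < hi ->
  measurable_fun `]lo, hi[ (fun s : Rb => s `^ (- (1 + d))) /\
  (\int[leb]_(s in `]lo, hi[) (s `^ (- (1 + d)))%:E <= (1 / d)%:E)%E.
Proof.
move=> d0 lo1 lohi.
apply: (@integral_oo_le lo hi (fun s => s `^ (- (1 + d))) (fun s => - (s `^ (- d) / d))) => //.
- move=> s /andP[ls sh]; have s0 : 0 < s by lra.
  have dp := is_derive1_powR (- d) s0.
  apply: is_derive_eq; rewrite /GRing.scale/= !(mulr0, addr0, add0r, mulr1).
  rewrite (_ : - d - 1 = - (1 + d)); last by ring.
  by field; rewrite gt_eqF.
- by move=> s /andP[ls _]; apply: continuous_powRx; lra.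
- by move=> s _; exact: powR_ge0.
move=> x y lx xy yh; rewrite opprK addrC -mulrBl ler_pM2r ?invr_gt0// lerBlDr.
apply: (@le_trans _ _ 1); last by rewrite lerDl powR_ge0.
rewrite powRN invf_le1 ?powR_gt0//; [apply: ge1_powR|]; lra.
Qed.

(** On each half of (0, t) one of the two factors is away from its singularity and bounded by its
    value at t/2. *)
Lemma beta_split b s t : 0 <= b -> 0 < s -> s < t ->
  (t - s) `^ (- (1 / 2)) * s `^ (- b) <=
  (t / 2) `^ (- (1 / 2)) * s `^ (- b) + (t / 2) `^ (- b) * (t - s) `^ (- (1 / 2)).
Proof.
move=> b0 s0 st; have := powR_ge0 (t - s) (- (1 / 2)); have := powR_ge0 s (- b).
have := powR_ge0 (t / 2) (- (1 / 2)); have := powR_ge0 (t / 2) (- b) => p1 p2 p3 p4.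
have t20 : 0 < t / 2 by lra.
have [st2|st2] := leP s (t / 2).
  rewrite (@le_trans _ _ ((t / 2) `^ (- (1 / 2)) * s `^ (- b)))// ?lerDl ?mulr_ge0//.
  by rewrite ler_wpM2r// ge0_ler_powRN//; lra.
rewrite (@le_trans _ _ ((t / 2) `^ (- b) * (t - s) `^ (- (1 / 2))))// ?lerDr ?mulr_ge0//.
by rewrite mulrC ler_wpM2r// ge0_ler_powRN// ltW.
Qed.

Lemma measurable_powR_subl (D : set Rb) t p : measurable_fun D (fun s : Rb => (t - s) `^ p).
Proof.
apply: (measurable_funS measurableT (@subsetT _ _)).
by apply: (measurableT_comp (measurable_powR p)); exact: measurable_funB.
Qed.

Lemma measurable_powR_subr (D : set Rb) t p : measurable_fun D (fun s : Rb => (s - t) `^ p).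
Proof.
apply: (measurable_funS measurableT (@subsetT _ _)).
by apply: (measurableT_comp (measurable_powR p)); exact: measurable_funB.
Qed.

Lemma measurable_powRN (D : set Rb) p : measurable_fun D (fun s : Rb => s `^ p).
Proof. exact: (measurable_funS measurableT (@subsetT _ _)). Qed.

Lemma measurable_beta b lo t :
  measurable_fun `]lo, t[ (fun s : Rb => (t - s) `^ (- (1 / 2)) * s `^ (- b)).
Proof.
apply: (measurable_funS measurableT (@subsetT _ _)); apply: measurable_funM => //.
by apply: (measurableT_comp (measurable_powR (- (1 / 2)))); exact: measurable_funB.
Qed.

Lemma int_beta_split b lo t A B : 0 <= b -> 0 <= lo -> lo < t ->
  measurable_fun `]lo, t[ (fun s : Rb => s `^ (- b)) ->
  (\int[leb]_(s in `]lo, t[) (s `^ (- b))%:E <= A%:E)%E ->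
  (t / 2) `^ (- (1 / 2)) * A + (t / 2) `^ (- b) * ((t - lo) `^ (1 / 2) * 2) <= B ->
  (\int[leb]_(s in `]lo, t[) ((t - s) `^ (- (1 / 2)) * s `^ (- b))%:E <= B%:E)%E.
Proof.
move=> b0 lo0 lot mA iA AB.
have [mr ir] := @int_powR_rev (1 / 2) lo t ltac:(lra) lot.
have p1 := powR_ge0 (t / 2) (- (1 / 2)); have p2 := powR_ge0 (t / 2) (- b).
apply: (@le_trans _ _ (\int[leb]_(s in `]lo, t[) (((t / 2) `^ (- (1 / 2)))%:E * (s `^ (- b))%:E +
   ((t / 2) `^ (- b))%:E * ((t - s) `^ (- (1 / 2)))%:E))%E).
  apply: ge0_le_integral => //.
  - by move=> s _; rewrite lee_fin mulr_ge0 ?powR_ge0.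
  - by apply/measurable_EFinP; exact: measurable_beta.
  - by apply/measurable_EFinP; apply: measurable_funD; exact: measurable_funM.
  - move=> s; rewrite /= in_itv/= => /andP[s1 s2]; rewrite -!EFinM -EFinD lee_fin.
    by apply: beta_split => //; lra.
rewrite ge0_integralD//.
- rewrite ge0_integralZl//; [|exact/measurable_EFinP|by move=> s _; rewrite lee_fin powR_ge0].
  rewrite ge0_integralZl//; [|exact/measurable_EFinP|by move=> s _; rewrite lee_fin powR_ge0].
  apply: le_trans (leeD (lee_wpmul2l _ iA) (lee_wpmul2l _ ir)) _; rewrite ?lee_fin//.
  have e12 : 1 - 1 / 2 = 1 / 2 :> R by field.
  have e2 : (1 / 2)^-1 = 2 :> R by field.
  by rewrite e12 e2.
- by move=> s _; rewrite -EFinM lee_fin mulr_ge0 ?powR_ge0.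
- by apply/measurable_EFinP; exact: measurable_funM.
- by move=> s _; rewrite -EFinM lee_fin mulr_ge0 ?powR_ge0.
- by apply/measurable_EFinP; exact: measurable_funM.
Qed.

Lemma int_beta b : 0 <= b -> b < 1 -> exists2 C : R, 0 <= C & forall t, 0 < t ->
  (\int[leb]_(s in `]0%R, t[) ((t - s) `^ (- (1 / 2)) * s `^ (- b))%:E <= (C * t `^ (1 / 2 - b))%:E)%E.
Proof.
move=> b0 b1; exists (2 `^ (1 / 2) * (1 - b)^-1 + 2 `^ b * 2).
  by rewrite addr_ge0// mulr_ge0 ?powR_ge0// invr_ge0 subr_ge0 ltW.
move=> t t0; have [mp ip] := int_powR b1 (lexx 0) t0.
have t1 : 0 <= t by exact: ltW.
have tD r q : t `^ (r + q) = t `^ r * t `^ q by rewrite powRD// (gt_eqF t0) implybT.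
have h0 : (0 : R) <= 2^-1 by [].
apply: (int_beta_split b0 (lexx 0) t0 mp ip); rewrite subr0.
have half r : (t / 2) `^ (- r) = 2 `^ r * t `^ (- r).
  by rewrite powRM// -(powR_inv1 (ler0n R 2)) -powRrM mulN1r opprK mulrC.
rewrite !half le_eqVlt; apply/orP; left; apply/eqP.
have e1 : t `^ (- (1 / 2)) * t `^ (1 - b) = t `^ (1 / 2 - b) by rewrite -tD; congr (_ `^ _); field.
have e2 : t `^ (- b) * t `^ (1 / 2) = t `^ (1 / 2 - b) by rewrite -tD addrC.
by rewrite mulrDl -e1 {2}e1 -e2; ring.
Qed.

(** Beyond the critical exponent 1 the weight has finite mass on (1, oo), concentrated near s = 1.
    The decay that remains is the t^(-1/2) of the kernel. *)
Lemma int_beta_tail d : 0 < d -> exists2 C : R, 0 <= C & forall t, 1 < t ->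
  (\int[leb]_(s in `]1%R, t[) ((t - s) `^ (- (1 / 2)) * s `^ (- (1 + d)))%:E <= (C * t `^ (- (1 / 2)))%:E)%E.
Proof.
move=> d0; exists (2 `^ (1 / 2) * (1 / d) + 2 `^ (1 + d) * 2).
  by rewrite addr_ge0// mulr_ge0 ?powR_ge0// divr_ge0// ltW.
move=> t t1; have t0 : 0 < t by lra.
have [mp ip] := int_powR_tail d0 (lexx 1) t1.
have tD r q : t `^ (r + q) = t `^ r * t `^ q by rewrite powRD// (gt_eqF t0) implybT.
have h0 : (0 : R) <= 2^-1 by [].
apply: (int_beta_split _ _ t1 mp ip) => //; first by lra.
have half r : (t / 2) `^ (- r) = 2 `^ r * t `^ (- r).
  by rewrite powRM ?(ltW t0)// -(powR_inv1 (ler0n R 2)) -powRrM mulN1r opprK mulrC.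
rewrite !half mulrDl lerD//.
  by rewrite le_eqVlt; apply/orP; left; apply/eqP; ring.
have -> : 2 `^ (1 + d) * t `^ (- (1 + d)) * ((t - 1) `^ (1 / 2) * 2) = 2 `^ (1 + d) * 2 * (t `^ (- (1 + d)) * (t - 1) `^ (1 / 2)) by ring.
rewrite ler_wpM2l ?mulr_ge0 ?powR_ge0//.
apply: (@le_trans _ _ (t `^ (- (1 + d)) * t `^ (1 / 2))).
  by rewrite ler_wpM2l ?powR_ge0// ge0_ler_powR ?nnegrE//; lra.
rewrite -tD ler_powR ?(ltW t1)//; lra.
Qed.

End scalar_integrals.

(** * Duhamel integrals *)

Section Duhamel_integral.
Variables (R : realType) (n : nat) (a : n.-tuple R).
Local Notation V := (n.-tuple R).
Local Notation mu := (lebn R n).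
Local Notation leb := (@lebesgue_measure R).
Local Notation Rb := (measurableTypeR R).
Implicit Types (D : set Rb) (h g : R -> V -> R) (v w : V -> R) (x y : V) (t s r c M N I B : R) (k : R -> R).

Lemma invsqrtE t : 0 < t -> (Num.sqrt t)^-1 = t `^ (- (1 / 2)).
Proof. by move=> t0; rewrite powRN div1r powR12_sqrt// ltW. Qed.

Definition cP : R := norm1 a * G2 R n.

Lemma cP_ge0 : 0 <= cP.
Proof. by rewrite mulr_ge0 ?norm1_ge0 ?G2_ge0. Qed.

Lemma pker_gkerE t : 0 < t -> gker (2 * t) (cP * t `^ (- (1 / 2))) (pker a t).
Proof. by move=> t0; rewrite -invsqrtE//; exact: pker_gker. Qed.

Definition Duh D t h := tint D (fun s => cv (pker a (t - s)) (h s)).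
Definition jmD D t h := jm D (fun s => cv (pker a (t - s)) (h s)).

(** What a Duhamel estimate needs of a time weight: the source at time s will be bounded by k s, and
    I bounds the integral of k against the singularity of the gradient kernel. *)
Definition tbd D t k I := [/\ measurable D, forall s, D s -> s < t, measurable_fun D (k : Rb -> R),
  forall s, D s -> 0 <= k s & (\int[leb]_(s in D) ((t - s) `^ (- (1 / 2)) * k s)%:E <= I%:E)%E].

Lemma tbd_scale D t k I C : 0 <= C -> tbd D t k I ->
  [/\ measurable_fun D ((fun s => C * ((t - s) `^ (- (1 / 2)) * k s)) : Rb -> R),
   forall s, D s -> 0 <= C * ((t - s) `^ (- (1 / 2)) * k s) &
   (\int[leb]_(s in D) (C * ((t - s) `^ (- (1 / 2)) * k s))%:E <= (C * I)%:E)%E].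
Proof.
move=> C0 [mD Dt mk k0 kI].
have mp : measurable_fun D (fun s : Rb => (t - s) `^ (- (1 / 2))).
  exact: measurable_powR_subl.
have mm := measurable_funM mp mk.
split.
- exact: measurable_funM.
- by move=> s Ds; rewrite mulr_ge0// mulr_ge0 ?powR_ge0// k0.
under eq_integral do rewrite EFinM.
rewrite ge0_integralZl//; first by rewrite EFinM lee_wpmul2l.
- exact/measurable_EFinP.
- by move=> s Ds; rewrite lee_fin mulr_ge0 ?powR_ge0// k0.
Qed.

Lemma Duh_slice_bde D t h k I c s : tbd D t k I -> D s -> 0 < s + c -> bd (s + c) (k s) (h s) ->
  bde (t + c) (G2 R n * cP * ((t - s) `^ (- (1 / 2)) * k s)) (cv (pker a (t - s)) (h s)).
Proof.
move=> [mD Dt mk k0 kI] Ds sc hb; have ts : 0 < t - s by rewrite subr_gt0 Dt.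
have ts2 : 0 < 2 * (t - s) by rewrite mulr_gt0.
have tc0 : 0 < t + c by lra.
(* t + c is the sum of t - s and s + c, so the larger of these is at least half of it, and [cv_bde]
   applies. *)
have tc : t + c <= 2 * (2 * (t - s)) \/ t + c <= 2 * (s + c).
  by have [h1|h1] := leP (s + c) (t - s); [left|right]; lra.
have := cv_bde ts2 sc tc0 tc (pker_gkerE ts) hb.
by rewrite (_ : G2 R n * (cP * _) * _ = G2 R n * cP * ((t - s) `^ (- (1 / 2)) * k s))//; ring.
Qed.

(** The shift c measures ages from a virtual origin: c = 0 in the expansion, c = 1 where only
    bounded times matter, c = L - T in the continuation argument. *)
Lemma Duh_bde D t h k I c : tbd D t k I -> jmD D t h -> (forall s, D s -> 0 < s + c) ->
  (forall s, D s -> bd (s + c) (k s) (h s)) -> bde (t + c) (G2 R n * cP * I) (Duh D t h).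
Proof.
move=> T mj sc hb; have C0 : 0 <= G2 R n * cP by rewrite mulr_ge0 ?G2_ge0 ?cP_ge0.
have [mk k0 kI] := tbd_scale C0 T; have [mD _ _ _ _] := T.
apply: (@bde_tint _ _ D (fun s => G2 R n * cP * ((t - s) `^ (- (1 / 2)) * k s))) => // s Ds.
by apply: (Duh_slice_bde T) => //; [exact: sc|exact: hb].
Qed.

Lemma DuhB D t h g k I c x : tbd D t k I -> 0 < t + c -> jmD D t h -> jmD D t g ->
  (forall s, D s -> 0 < s + c) ->
  (forall s, D s -> bd (s + c) (k s) (h s)) -> (forall s, D s -> bd (s + c) (k s) (g s)) ->
  Duh D t (fun s y => h s y - g s y) x = Duh D t h x - Duh D t g x.
Proof.
move=> T tc0 mh mg sc hb gb; have C0 : 0 <= G2 R n * cP by rewrite mulr_ge0 ?G2_ge0 ?cP_ge0.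
have [mk k0 kI] := tbd_scale C0 T; have [mD Dt _ _ _] := T.
rewrite /Duh -(@tintB _ _ D (fun s => G2 R n * cP * ((t - s) `^ (- (1 / 2)) * k s)) (G2 R n * cP * I) mD mk kI k0 _ _ x (hw n (t + c)))//.
- apply: eq_tint => s Ds; have ts : 0 < 2 * (t - s) by rewrite mulr_gt0// subr_gt0 Dt.
  apply: (cvB _ ts); [by apply: pker_gkerE; rewrite subr_gt0 Dt|exact: bd_L1 (hb s Ds)|exact: bd_L1 (gb s Ds)].
- by move=> s Ds; have [_] := Duh_slice_bde T Ds (sc s Ds) (hb s Ds); exact.
- by move=> s Ds; have [_] := Duh_slice_bde T Ds (sc s Ds) (gb s Ds); exact.
- exact: hw_ge0.
Qed.

Lemma jmDB D t h g : (forall s, D s -> s < t) -> (forall s, D s -> L1 mu (h s)) -> (forall s, D s -> L1 mu (g s)) ->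
  jmD D t h -> jmD D t g -> jmD D t (fun s y => h s y - g s y).
Proof.
move=> Dt ih ig mh mg; apply: eq_jm (jmB mh mg) => s x Ds.
have ts : 0 < 2 * (t - s) by rewrite mulr_gt0// subr_gt0 Dt.
by rewrite (cvB _ ts (pker_gkerE _)) ?subr_gt0 ?Dt//; [exact: ih|exact: ig].
Qed.

(** The width 2 (t - s) of the kernel and the width 2 s of the source add up to 2 t. This makes
    domination by G_{2t} stable under Duhamel integrals. *)
Lemma pker_gauss_le t s M v x : 0 < s -> s < t -> measurable_fun setT v ->
  (forall y, `|v y| <= M * gauss (2 * s) y) -> 0 <= M ->
  `|cv (pker a (t - s)) v x| <= cP * ((t - s) `^ (- (1 / 2)) * M) * gauss (2 * t) x.
Proof.
move=> s0 st mv vM M0; have ts : 0 < t - s by rewrite subr_gt0.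
have ts2 : 0 < 2 * (t - s) by rewrite mulr_gt0.
have s20 : 0 < 2 * s by rewrite mulr_gt0.
have := cv_gauss_bound x ts2 s20 (pker_gkerE ts) mv vM M0.
have -> : 2 * (t - s) + 2 * s = 2 * t by ring.
by rewrite mulrA.
Qed.

Lemma Duh_gauss D t h k I x : tbd D t k I -> jmD D t h -> (forall s, D s -> 0 < s) ->
  (forall s, D s -> measurable_fun setT (h s)) ->
  (forall s y, D s -> `|h s y| <= k s * gauss (2 * s) y) -> `|Duh D t h x| <= cP * I * gauss (2 * t) x.
Proof.
move=> T mj s0 mh hb; have C0 := cP_ge0.
have [mk k0 kI] := tbd_scale C0 T; have [mD Dt _ kk _] := T.
apply: (@tint_le _ _ D (fun s => cP * ((t - s) `^ (- (1 / 2)) * k s))) => //; last exact: gauss_ge0.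
move=> s Ds; apply: pker_gauss_le; [exact: s0|exact: Dt|exact: mh|by move=> y; exact: hb|exact: kk].
Qed.

Lemma DuhB_gauss D t h g k I x : tbd D t k I -> jmD D t h -> jmD D t g -> (forall s, D s -> 0 < s) ->
  (forall s, D s -> measurable_fun setT (h s)) -> (forall s, D s -> measurable_fun setT (g s)) ->
  (forall s y, D s -> `|h s y| <= k s * gauss (2 * s) y) ->
  (forall s y, D s -> `|g s y| <= k s * gauss (2 * s) y) ->
  Duh D t (fun s y => h s y - g s y) x = Duh D t h x - Duh D t g x.
Proof.
move=> T mjh mjg s0 mh mg hb gb; have C0 := cP_ge0.
have [mk k0 kI] := tbd_scale C0 T; have [mD Dt _ kk _] := T.
have hi s : D s -> L1 mu (h s).
  move=> Ds; apply: (L1_dom (mh s Ds) (fun y => hb s y Ds)); apply: L1Z; apply: L1_gaussx.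
  by rewrite mulr_gt0// s0.
have gi s : D s -> L1 mu (g s).
  move=> Ds; apply: (L1_dom (mg s Ds) (fun y => gb s y Ds)); apply: L1Z; apply: L1_gaussx.
  by rewrite mulr_gt0// s0.
rewrite /Duh -(@tintB _ _ D (fun s => cP * ((t - s) `^ (- (1 / 2)) * k s)) (cP * I) mD mk kI k0 _ _ x (gauss (2 * t) x))//.
- apply: eq_tint => s Ds; have ts : 0 < 2 * (t - s) by rewrite mulr_gt0// subr_gt0 Dt.
  by apply: (cvB _ ts); [by apply: pker_gkerE; rewrite subr_gt0 Dt|exact: hi|exact: gi].
- by move=> s Ds; apply: pker_gauss_le; [exact: s0|exact: Dt|exact: mh|by move=> y; exact: hb|exact: kk].
- by move=> s Ds; apply: pker_gauss_le; [exact: s0|exact: Dt|exact: mg|by move=> y; exact: gb|exact: kk].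
- exact: gauss_ge0.
Qed.

Lemma tint_split lo mid hi F x : lo < mid -> mid < hi ->
  leb.-integrable `]lo, hi[ (fun s => (F s x)%:E) ->
  tint `]lo, hi[ F x = tint `]lo, mid[ F x + tint `]mid, hi[ F x.
Proof.
move=> lm mh iF; rewrite /tint.
have := @Rintegral_itvB _ (fun s => F s x) (BRight lo) (BLeft hi) mid iF.
rewrite !bnd_simp => /(_ (ltW lm) mh) => E.
have il : leb.-integrable `]lo, mid[ (EFin \o (fun s => F s x)).
  by apply: (integrableS _ _ _ iF) => //; apply: subset_itvl; rewrite bnd_simp ltW.
by rewrite -E (Rintegral_itv_bndo_bndc il) addrC subrK.
Qed.

Lemma Duh_integrable D t h k I c x : tbd D t k I -> 0 < t + c -> jmD D t h ->
  (forall s, D s -> 0 < s + c) -> (forall s, D s -> bd (s + c) (k s) (h s)) ->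
  leb.-integrable D (fun s => (cv (pker a (t - s)) (h s) x)%:E).
Proof.
move=> T tc0 mj sc hb; have C0 : 0 <= G2 R n * cP by rewrite mulr_ge0 ?G2_ge0 ?cP_ge0.
have [mk k0 kI] := tbd_scale C0 T; have [mD Dt _ _ _] := T.
apply/(integrable_mkcond _ mD).
have := L1le_L1 (@ext_L1le _ _ D _ _ mD mk kI k0 (fun s => cv (pker a (t - s)) (h s)) x _ mj _ (hw_ge0 n (t + c))).
have e : EFin \o (fun s : Rb => ext D (fun s => cv (pker a (t - s)) (h s)) (s, x)) =
   (fun s => (cv (pker a (t - s)) (h s) x)%:E) \_ D.
  by apply/funext => s /=; rewrite /ext/= patchE; case: ifP.
rewrite /L1 e; apply => s Ds.
by have [_] := Duh_slice_bde T Ds (sc s Ds) (hb s Ds); exact.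
Qed.

Section pairing.
Variables (D : set Rb) (F : R -> V -> R) (k : R -> R) (I : R) (g : V -> R) (B : R).
Hypotheses (mD : measurable D) (mj : jm D F) (mk : measurable_fun D (k : Rb -> R))
  (k0 : forall s, D s -> 0 <= k s) (kI : (\int[leb]_(s in D) (k s)%:E <= I%:E)%E)
  (Fk : forall s, D s -> L1le mu (F s) (k s)) (mg : measurable_fun setT g) (gB : forall y, `|g y| <= B).

Let B0 : 0 <= B. Proof. exact: le_trans (gB (tzero R n)). Qed.

Let f (w : V * Rb) := g w.1 * ext D F (w.2, w.1).

Let mf : measurable_fun setT f.
Proof.
apply: measurable_funM; first exact: (measurableT_comp mg measurable_fst).
by apply: (measurableT_comp mj); exact: measurable_swap.
Qed.

Let Bk s : D s -> (\int[mu]_y (`|f (y, s)|)%:E <= (B * k s)%:E)%E.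
Proof.
move=> Ds; have [mFs Fs] := Fk Ds.
apply: (@le_trans _ _ (\int[mu]_y (B%:E * (`|F s y|)%:E))%E).
  apply: ge0_le_integral => //.
  - apply/measurable_EFinP; apply: measurableT_comp => //.
    exact: (measurableT_comp mf (@pair2_measurable _ _ _ _ s)).
  - by apply/measurable_EFinP; apply: measurable_funM => //; exact: measurableT_comp.
  - by move=> y _; rewrite lee_fin /f /ext/= mem_set// normrM ler_wpM2r.
rewrite ge0_integralZl//; first by rewrite (EFinM B) lee_wpmul2l.
by apply/measurable_EFinP; exact: measurableT_comp.
Qed.

Let if_ : (mu \x leb)%E.-integrable setT (EFin \o f).
Proof.
apply/integrable21ltyP; first exact/measurable_EFinP.
apply: (@le_lt_trans _ _ (\int[leb]_(s in D) (B%:E * (k s)%:E))%E); last first.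
  rewrite ge0_integralZl//; [|exact/measurable_EFinP].
  by apply: le_lt_trans (lee_wpmul2l _ kI) _; rewrite ?lee_fin// -EFinM ltry.
rewrite [leRHS]integral_mkcond; apply: ge0_le_integral => //.
- by move=> s _; exact: integral_ge0.
- apply: (measurable_param_integral mu (g := fun w : Rb * V => (`|f (w.2, w.1)|)%:E)).
  apply/measurable_EFinP; apply: measurableT_comp => //.
  by apply: (measurableT_comp mf); exact: measurable_swap.
- apply/(measurable_restrictT _ mD); apply/measurable_EFinP; exact: measurable_funM.
move=> s _; rewrite patchE; case: ifPn => [|sD]; first by rewrite inE => /Bk.
under eq_integral do rewrite /f /ext/= (negbTE sD) mulr0 normr0.
by rewrite integral0.
Qed.

Lemma Rintegral_ext s : \int[mu]_y (g y * ext D F (s, y)) =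
  if s \in D then \int[mu]_y (g y * F s y) else 0.
Proof.
rewrite /ext/=; case: ifP => // _.
by under eq_Rintegral do rewrite mulr0; rewrite Rintegral_cst// mul0r.
Qed.

(** With g a translate of a kernel this moves convolutions under the time integral, as in [cv_tint];
    with g a mollified solution it treats the cross term of the energy. *)
Lemma Rintegral_tint :
  \int[mu]_y (g y * tint D F y) = \int[leb]_(s in D) \int[mu]_y (g y * F s y).
Proof.
transitivity (\int[mu]_y \int[leb]_s f (y, s)); last first.
  rewrite (Rintegral_Fubini if_) [RHS]Rintegral_mkcond; apply: eq_Rintegral => s _.
  by rewrite /f /= Rintegral_ext patchE.
have mf1 : measurable_fun setT (fun y => \int[leb]_s f (y, s)) by exact: measurable_param_Rintegral.
have mf2 : measurable_fun setT (fun y => g y * tint D F y).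
  by apply: measurable_funM => //; exact: measurable_tint.
have iext : (mu \x leb)%E.-integrable setT (EFin \o (fun w : V * Rb => ext D F (w.2, w.1))).
  apply/integrable21ltyP; first by apply/measurable_EFinP; apply: (measurableT_comp mj); exact: measurable_swap.
  apply: (@le_lt_trans _ _ (\int[leb]_(s in D) (k s)%:E)%E); last by apply: le_lt_trans kI _; rewrite ltry.
  rewrite [leRHS]integral_mkcond; apply: ge0_le_integral => //.
  - by move=> s _; exact: integral_ge0.
  - apply: (measurable_param_integral mu (g := fun w : Rb * V => (`|ext D F w|)%:E)).
    by apply/measurable_EFinP; exact: measurableT_comp.
  - by apply/(measurable_restrictT _ mD); exact/measurable_EFinP.
  move=> s _; rewrite patchE /ext/=; case: ifPn => [|sD]; first by rewrite inE => /Fk[].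
  by under eq_integral do rewrite normr0; rewrite integral0.
apply: Rintegral_ae => //; have := ae_integrable1 iext; apply: filterS => y /= iy.
by rewrite tintE -RintegralZl.
Qed.

Lemma Rintegral_tint_le c l : (forall s, D s -> `|\int[mu]_y (g y * F s y)| <= c) -> 0 <= c ->
  (leb D <= l%:E)%E -> `|\int[mu]_y (g y * tint D F y)| <= c * l.
Proof.
move=> Fc c0 Dl; rewrite Rintegral_tint Rintegral_mkcond; apply: Rintegral_L1le; split.
  rewrite (_ : _ \_ D = fun s => \int[mu]_y (g y * ext D F (s, y))); last first.
    by apply/funext => s; rewrite Rintegral_ext patchE.
  apply: (measurable_param_Rintegral mu (g := fun w : Rb * V => g w.2 * ext D F w)).
  by apply: measurable_funM => //; exact: (measurableT_comp mg measurable_snd).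
apply: (@le_trans _ _ (\int[leb]_(s in D) c%:E)%E); last first.
  by rewrite integral_cst// EFinM lee_wpmul2l.
rewrite [leRHS]integral_mkcond; apply: ge0_le_integral => //.
- apply/measurable_EFinP; apply: measurableT_comp => //.
  rewrite (_ : _ \_ D = fun s => \int[mu]_y (g y * ext D F (s, y))); last first.
    by apply/funext => s; rewrite Rintegral_ext patchE.
  apply: (measurable_param_Rintegral mu (g := fun w : Rb * V => g w.2 * ext D F w)).
  by apply: measurable_funM => //; exact: (measurableT_comp mg measurable_snd).
- by apply/(measurable_restrictT _ mD).
- by move=> s _; rewrite !patchE; case: ifPn => [|_]; rewrite ?normr0// inE => /Fc.
Qed.

End pairing.

Lemma cv_tint D K r c F k I x : 0 < r -> gker r c K -> measurable D -> jm D F ->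
  measurable_fun D (k : Rb -> R) -> (forall s, D s -> 0 <= k s) ->
  (\int[leb]_(s in D) (k s)%:E <= I%:E)%E -> (forall s, D s -> L1le mu (F s) (k s)) ->
  cv K (tint D F) x = tint D (fun s => cv K (F s)) x.
Proof.
move=> r0 Kg mD mj mk k0 kI Fk; have [mK _] := Kg.
rewrite /cv; apply: (Rintegral_tint mD mj mk k0 kI Fk); first exact: measurable_ker2.
by move=> y; exact: (gker_bd _ r0 Kg).
Qed.

End Duhamel_integral.

(** * Regularity of the kernels in time *)

Section kernel_time_regularity.
Variables (R : realType) (n : nat) (a : n.-tuple R).
Local Notation V := (n.-tuple R).
Local Notation mu := (lebn R n).
Local Notation leb := (@lebesgue_measure R).
Local Notation Rb := (measurableTypeR R).
Implicit Types (D : set Rb) (h g : R -> V -> R) (v w : V -> R) (x y : V) (t s r c e M N I B A : R) (k : R -> R).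

Lemma duhamelE (f : R -> R) (v : R -> V -> R) lo hi t x : lo < hi -> hi <= t ->
  (forall s, lo < s < hi -> L1 mu (fun y => f (v s y))) ->
  jmD a `]lo, hi[%classic t (fun s y => f (v s y)) ->
  duhamel a f v lo hi t x = Duh a `]lo, hi[%classic t (fun s y => f (v s y)) x.
Proof.
move=> lohi hit iv mj.
have E s : `]lo, hi[%classic s -> adv a (t - s) (fun y => f (v s y)) x = cv (pker a (t - s)) (fun y => f (v s y)) x.
  rewrite /= in_itv/= => sD; apply: adv_cv; last exact: iv.
  by case/andP: sD => _ sh; rewrite subr_gt0 (lt_le_trans sh).
have mi : measurable_fun `]lo, hi[ (fun s : Rb => (adv a (t - s) (fun y => f (v s y)) x)%:E).
  apply/measurable_EFinP; apply/(measurable_restrictT _ (measurable_itv _)).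
  rewrite (_ : _ \_ _ = fun s : Rb => ext `]lo, hi[%classic (fun s => cv (pker a (t - s)) (fun y => f (v s y))) (s, x)).
    exact: ext_measurable1.
  by apply/funext => s; rewrite patchE /ext/=; case: ifPn => //; rewrite inE => /E ->.
(* The definition integrates over a closed interval. The end points, where the kernel time may
   vanish, carry no mass. *)
rewrite /duhamel (integral_itv_bndoo _ _ mi) /Duh /tint /Rintegral; congr fine.
by apply: eq_integral => s; rewrite inE => /E ->.
Qed.

Definition Ct : R := Cm R n * (1 + G2 R n).

Lemma Ct_ge0 : 0 <= Ct.
Proof. by rewrite mulr_ge0 ?Cm_ge0// addr_ge0// G2_ge0. Qed.

(** Since G_e has mass one, the convolution of K1 with G_e minus K1 is a first-moment error. A time
    difference is thus controlled by the translation modulus, and the moment of G_e supplies sqrt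
    e. *)
Lemma ker_time_diff (K1 K2 : V -> R) t e A c : 0 < e -> e <= t -> 0 <= A ->
  lipker (2 * t) A K1 -> gker (2 * t) c K1 -> measurable_fun setT K2 ->
  (forall x, K2 x = cv K1 (gauss e) x) ->
  gker (2 * (t + e)) (A * Num.sqrt e * Ct) (fun x => K2 x - K1 x).
Proof.
move=> e0 et A0 Kl Kg mK2 K2E; have t0 : 0 < t by exact: lt_le_trans et.
have t20 : 0 < 2 * t by rewrite mulr_gt0.
split; first by apply: measurable_funB => //; case: Kl.
move=> x; have := cv_zero_mass x e0 t20 A0 Kl Kg (measurable_gaussr e (@measurable_id _ _ setT)) (M := 1).
rewrite Rintegral_gauss// mul1r -K2E => H.
apply: le_trans (H _ ler01) _; first by move=> y; rewrite mul1r ger0_norm// gauss_ge0.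
have -> : 2 * t + 2 * e = 2 * (t + e) by ring.
have gm : gauss (2 * t) x <= G2 R n * gauss (2 * (t + e)) x by apply: gauss_mono => //; lra.
have C0 : 0 <= A * (Cm R n * Num.sqrt e * 1) by rewrite mulr_ge0// mulr_ge0// mulr_ge0 ?Cm_ge0 ?sqrtr_ge0.
apply: (@le_trans _ _ (A * (Cm R n * Num.sqrt e * 1) * (gauss (2 * (t + e)) x + G2 R n * gauss (2 * (t + e)) x))).
  by rewrite ler_wpM2l// lerD2l.
by rewrite /Ct le_eqVlt; apply/orP; left; apply/eqP; ring.
Qed.

Lemma pker_cvE t e x : 0 < t -> 0 < e -> pker a (t + e) x = cv (pker a t) (gauss e) x.
Proof.
move=> t0 e0; have := pker_gauss a x (tzero R n) t0 e0; rewrite tsub0 => <-.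
by apply: eq_Rintegral => y _; rewrite [tsub y _](tsub0 y).
Qed.

Lemma gauss_cvE t e x : 0 < t -> 0 < e -> gauss (t + e) x = cv (gauss t) (gauss e) x.
Proof.
move=> t0 e0; have := cv_gauss_gauss x (tzero R n) t0 e0; rewrite tsub0 => <-.
by apply: eq_Rintegral => y _; rewrite [tsub y _](tsub0 y).
Qed.

Lemma Cp_ge0 : 0 <= Cp a.
Proof. by rewrite /Cp !mulr_ge0 ?norm1_ge0 ?G2_ge0. Qed.

Lemma pker_time_diff t e : 0 < e -> e <= t ->
  gker (2 * (t + e)) (Cp a / t * Num.sqrt e * Ct) (fun x => pker a (t + e) x - pker a t x).
Proof.
move=> e0 et; have t0 : 0 < t by exact: lt_le_trans et.
apply: (ker_time_diff e0 et _ (pker_lipker a t0) (pker_gker a t0)).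
- by rewrite divr_ge0 ?Cp_ge0// ltW.
- by apply: measurable_pker => //; exact: measurable_id.
- by move=> x; exact: pker_cvE.
Qed.

Lemma gauss_gker2 t : 0 < t -> gker (2 * t) (G2 R n) (@gauss R n t).
Proof.
move=> t0; split; first exact: measurable_gaussr.
by move=> z; rewrite ger0_norm ?gauss_ge0//; apply: gauss_mono => //; lra.
Qed.

Lemma gauss_time_diff t e : 0 < e -> e <= t ->
  gker (2 * (t + e)) (4 * G2 R n / Num.sqrt t * Num.sqrt e * Ct) (fun x => @gauss R n (t + e) x - gauss t x).
Proof.
move=> e0 et; have t0 : 0 < t by exact: lt_le_trans et.
apply: (ker_time_diff e0 et _ (gauss_lipker n t0) (gauss_gker2 t0)).
- by rewrite divr_ge0 ?sqrtr_ge0// mulr_ge0// G2_ge0.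
- exact: measurable_gaussr.
- by move=> x; exact: gauss_cvE.
Qed.

Lemma cvKB (K1 K2 : V -> R) r c v x r' c' : 0 < r -> 0 < r' -> gker r c K1 -> gker r' c' K2 -> L1 mu v ->
  cv (fun y => K1 y - K2 y) v x = cv K1 v x - cv K2 v x.
Proof.
move=> r0 r0' K1g K2g iv; rewrite /cv -RintegralB//.
- by apply: eq_Rintegral => y _; rewrite mulrBl.
- exact: (L1_cv_integrand _ r0 K1g).
- exact: (L1_cv_integrand _ r0' K2g).
Qed.

Lemma cv_pker_time_diff t e v x M : 0 < e -> e <= t -> L1le mu v M ->
  `|cv (pker a (t + e)) v x - cv (pker a t) v x| <= Cp a / t * Num.sqrt e * Ct * t `^ (- (n%:R / 2)) * M.
Proof.
move=> e0 et vM; have t0 : 0 < t by exact: lt_le_trans et.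
have te0 : 0 < t + e by rewrite addr_gt0.
have t20 : 0 < 2 * t by rewrite mulr_gt0.
have te20 : 0 < 2 * (t + e) by rewrite mulr_gt0.
rewrite -(cvKB x te20 t20 (pker_gker a te0) (pker_gker a t0) (L1le_L1 vM)).
apply: le_trans (cv_sup1 x te20 (pker_time_diff e0 et) vM) _.
have M0 := L1le_ge0 vM.
rewrite ler_wpM2r// ler_wpM2l//.
  by rewrite mulr_ge0 ?Ct_ge0// mulr_ge0 ?sqrtr_ge0// divr_ge0 ?Cp_ge0// ltW.
by apply: ge0_ler_powRN => //; lra.
Qed.

Lemma cv_pker_continuous t v x : 0 < t -> L1 mu v -> {for t, continuous (fun s => cv (pker a s) v x)}.
Proof.
move=> t0 /L1_L1le[M M0 vM].
pose C := Cp a / (t / 2) * Ct * (t / 2) `^ (- (n%:R / 2)) * M.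
have t20 : 0 < t / 2 by rewrite divr_gt0.
have C0 : 0 <= C.
  by rewrite /C mulr_ge0// mulr_ge0 ?powR_ge0// mulr_ge0 ?Ct_ge0// divr_ge0 ?Cp_ge0// ltW.
have D r q : t / 2 <= r -> r < q -> q - r <= t / 2 -> `|cv (pker a q) v x - cv (pker a r) v x| <= C * Num.sqrt (q - r).
  move=> tr rq qr; have e0 : 0 < q - r by rewrite subr_gt0.
  have er : q - r <= r by lra.
  have r0 : 0 < r by lra.
  have := cv_pker_time_diff x e0 er vM; rewrite (_ : r + (q - r) = q); last by ring.
  move/le_trans; apply.
  rewrite /C (_ : _ * M = Cp a / r * Ct * r `^ (- (n%:R / 2)) * M * Num.sqrt (q - r)); last by ring.
  rewrite ler_wpM2r ?sqrtr_ge0// ler_wpM2r// ler_pM ?powR_ge0//.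
  - by rewrite mulr_ge0 ?Ct_ge0// divr_ge0 ?Cp_ge0// ltW.
  - by rewrite ler_wpM2r ?Ct_ge0// ler_wpM2l ?Cp_ge0// lef_pV2 ?posrE.
  - by apply: ge0_ler_powRN.
apply/cvgrPdist_le => /= e e0; near=> s.
have [->|st] := eqVneq s t; first by rewrite subrr normr0 ltW.
have dist : `|t - s| <= t / 4 by near: s; apply: cvgr_dist_le => //; rewrite divr_gt0.
have diste : `|t - s| <= (e / (C + 1)) ^+ 2.
  near: s; apply: cvgr_dist_le => //; rewrite exprn_gt0// divr_gt0//; lra.
have sq : C * Num.sqrt `|t - s| <= e.
  have : Num.sqrt `|t - s| <= e / (C + 1).
    have e1 : 0 <= e / (C + 1) by rewrite divr_ge0 ?addr_ge0 ?(ltW e0).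
    by rewrite -[leRHS](ger0_norm e1) -[leRHS]sqrtr_sqr ler_wsqrtr.
  rewrite ler_pdivlMr; last by lra.
  by have := sqrtr_ge0 `|t - s|; lra.
have [ts|ts] := ltP s t.
  have E : `|t - s| = t - s by rewrite gtr0_norm// subr_gt0.
  rewrite E in dist sq.
  by apply: le_trans (D s t _ ts _) sq; lra.
have {}ts : t < s by rewrite lt_neqAle eq_sym st.
have E : `|t - s| = s - t by rewrite distrC gtr0_norm// subr_gt0.
rewrite E in dist sq; rewrite distrC.
by apply: le_trans (D t s _ ts _) sq; lra.
Unshelve. all: by end_near. Qed.

(** First the kernel moves with the source fixed, then the source moves, in L^1, against a kernel
    whose time stays away from 0. The outcome is the continuity in time required by [jm_carath]. *)
Lemma slice_continuous h t s x r : 0 < r -> s < t -> measurable_fun setT (h s) -> L1 mu (h s) ->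
  (forall e, 0 < e -> exists2 d, 0 < d & forall q, `|q - s| < d -> L1le mu (fun y => h q y - h s y) e) ->
  (forall q, `|q - s| < r -> L1 mu (h q)) ->
  {for s, continuous (fun q => cv (pker a (t - q)) (h q) x)}.
Proof.
move=> r0 st ms is_ hc hL.
have ts0 : 0 < t - s by rewrite subr_gt0.
have c1 : {for s, continuous (fun q => cv (pker a (t - q)) (h s) x)}.
  apply: (@continuous_comp _ _ _ (fun q : R => t - q) (fun q => cv (pker a q) (h s) x)).
    by apply: cvgB; [exact: cvg_cst|exact: cvg_id].
  exact: cv_pker_continuous.
pose C := cP a * ((t - s) / 2) `^ (- (1 / 2)) * (t - s) `^ (- (n%:R / 2)).
have C0 : 0 <= C by rewrite mulr_ge0 ?powR_ge0// mulr_ge0 ?powR_ge0// cP_ge0.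
apply/cvgrPdist_le => /= e e0.
have [d d0 hd] := hc (e / 2 / (C + 1)) (ltac:(rewrite divr_gt0 ?divr_gt0//; lra)).
near=> q.
have qd : `|q - s| < d by rewrite distrC; near: q; exact: cvgr_dist_lt.
have qr : `|q - s| < r by rewrite distrC; near: q; exact: cvgr_dist_lt.
have qts : `|s - q| <= (t - s) / 2 by near: q; apply: cvgr_dist_le => //; rewrite divr_gt0.
have q1 : `|cv (pker a (t - s)) (h s) x - cv (pker a (t - q)) (h s) x| <= e / 2.
  by near: q; have /cvgrPdist_le := c1; apply; rewrite divr_gt0.
have tq : (t - s) / 2 <= t - q by move: qts; rewrite ler_norml => /andP[]; lra.
have tq0 : 0 < t - q by lra.
have tq20 : 0 < 2 * (t - q) by lra.
have q2 : `|cv (pker a (t - q)) (h s) x - cv (pker a (t - q)) (h q) x| <= e / 2.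
  rewrite distrC -(cvB _ tq20 (pker_gkerE a tq0))//; last exact: hL.
  apply: le_trans (cv_sup1 x tq20 (pker_gkerE a tq0) (hd q qd)) _.
  apply: (@le_trans _ _ (C * (e / 2 / (C + 1)))).
    have p1 : (t - q) `^ (- (1 / 2)) <= ((t - s) / 2) `^ (- (1 / 2)) by apply: ge0_ler_powRN => //; lra.
    have p2 : (2 * (t - q)) `^ (- (n%:R / 2)) <= (t - s) `^ (- (n%:R / 2)) by apply: ge0_ler_powRN => //; lra.
    have c0 := cP_ge0 a.
    have e2 : 0 <= e / 2 / (C + 1) by rewrite !divr_ge0 ?(ltW e0)// addr_ge0.
    apply: ler_wpM2r => //.
    apply: (@le_trans _ _ (cP a * ((t - s) / 2) `^ (- (1 / 2)) * (2 * (t - q)) `^ (- (n%:R / 2)))).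
      by apply: ler_wpM2r; [exact: powR_ge0|exact: ler_wpM2l].
    by apply: ler_wpM2l => //; rewrite mulr_ge0 ?powR_ge0.
  rewrite mulrCA ler_piMr ?divr_ge0 ?(ltW e0)// ler_pdivrMr; lra.
rewrite (_ : _ - _ = (cv (pker a (t - s)) (h s) x - cv (pker a (t - q)) (h s) x) +
   (cv (pker a (t - q)) (h s) x - cv (pker a (t - q)) (h q) x)); last by ring.
by rewrite (le_trans (ler_normD _ _))//; lra.
Unshelve. all: by end_near. Qed.

End kernel_time_regularity.

(** * Bounds for the nonlinearity *)

Section nonlinearity.
Variables (R : realType) (n : nat).
Local Notation V := (n.-tuple R).
Local Notation mu := (lebn R n).
Local Notation leb := (@lebesgue_measure R).
Local Notation Rb := (measurableTypeR R).
Variables (f : R -> R) (q b Cf : R).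
Hypotheses (q0 : 0 < q) (qb : n%:R / 2 * q = b) (Cf0 : 0 <= Cf) (f0 : f 0 = 0)
  (mf : measurable_fun setT f)
  (fL : forall xi eta, `|f xi - f eta| <= Cf * (`|xi| `^ q + `|eta| `^ q) * `|xi - eta|).
Implicit Types (v w : V -> R) (M K t : R).

Lemma L1le_dom_ae v w M : measurable_fun setT v -> {ae mu, forall x, `|v x| <= w x} ->
  L1le mu w M -> L1le mu v M.
Proof.
move=> mv vw [mw wM]; split=> //; apply: le_trans wM; apply: ae_ge0_le_integral => //.
- by apply/measurable_EFinP; exact: measurableT_comp.
- by apply/measurable_EFinP; exact: measurableT_comp.
by move: vw; apply: filterS => x xv _; rewrite lee_fin (le_trans xv)// ler_norm.
Qed.

(** A Lipschitz constant of f on [-M, M]. *)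
Definition Lf M := 2 * Cf * M `^ q.

Lemma Lf_ge0 M : 0 <= Lf M.
Proof. by rewrite mulr_ge0 ?powR_ge0// mulr_ge0. Qed.

Lemma f_diff_le M xi eta : `|xi| <= M -> `|eta| <= M -> `|f xi - f eta| <= Lf M * `|xi - eta|.
Proof.
move=> xM eM; apply: le_trans (fL xi eta) _; rewrite ler_wpM2r//.
have M0 : 0 <= M by exact: le_trans xM.
have h1 : `|xi| `^ q <= M `^ q by rewrite ge0_ler_powR ?nnegrE// ltW.
have h2 : `|eta| `^ q <= M `^ q by rewrite ge0_ler_powR ?nnegrE// ltW.
by rewrite /Lf -mulrA mulrCA ler_wpM2l//; lra.
Qed.

Lemma f_le M xi : `|xi| <= M -> `|f xi| <= Lf M * `|xi|.
Proof.
move=> xM; have M0 : `|0 : R| <= M by rewrite normr0; exact: le_trans xM.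
by have := f_diff_le xM M0; rewrite f0 !subr0.
Qed.

Lemma measurable_fcomp v : measurable_fun setT v -> measurable_fun setT (fun x => f (v x)).
Proof. by move=> mv; exact: (measurableT_comp mf mv). Qed.

Lemma f_L1 M K v w : measurable_fun setT v -> measurable_fun setT w ->
  {ae mu, forall x, `|v x| <= M} -> {ae mu, forall x, `|w x| <= M} ->
  L1le mu (fun x => v x - w x) K -> L1le mu (fun x => f (v x) - f (w x)) (Lf M * K).
Proof.
move=> mv mw vM wM [md dK]; have L0 := Lf_ge0 M.
apply: (@L1le_dom_ae _ (fun x => Lf M * `|v x - w x|)).
- by apply: measurable_funB; exact: measurable_fcomp.
- by move: vM wM; apply: filterS2 => x vx wx; exact: f_diff_le.
rewrite -[X in L1le _ _ (X * _)](ger0_norm L0); apply: L1leZ; split.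
  exact: measurableT_comp.
by under eq_integral do rewrite normr_id.
Qed.

Lemma hwq t : hw n t `^ q = t `^ (- b).
Proof. by rewrite /hw -powRrM mulNr qb. Qed.

(** [Lf] at the height M t^(-n/2). The growth of f turns the sup bound into a factor t^(-b) with b =
    n q / 2. *)
Definition Lfb M t := Lf M * t `^ (- b).

Lemma Lf_hw M t : 0 <= M -> Lf (M * hw n t) = Lfb M t.
Proof. by move=> M0; rewrite /Lfb /Lf powRM ?hw_ge0// hwq mulrA. Qed.

Lemma f_bd M K t v w : 0 <= M -> measurable_fun setT v -> measurable_fun setT w ->
  {ae mu, forall x, `|v x| <= M * hw n t} -> {ae mu, forall x, `|w x| <= M * hw n t} ->
  bd t K (fun x => v x - w x) -> bd t (Lfb M t * K) (fun x => f (v x) - f (w x)).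
Proof.
move=> M0 mv mw vM wM [dK db]; rewrite -Lf_hw//; split; first exact: f_L1.
move: vM wM db; apply: filterS3 => x vx wx dx.
by rewrite (le_trans (f_diff_le vx wx))// -mulrA ler_wpM2l// Lf_ge0.
Qed.

Lemma f_bd1 M t v : bd t M v -> bd t (Lfb M t * M) (fun x => f (v x)).
Proof.
move=> vb; have M0 := bd_ge0 vb; have mv := bd_measurable vb.
have mz : measurable_fun setT (fun _ : V => 0 : R) by exact: measurable_cst.
have := @f_bd M M t v (fun=> 0 : R) M0 mv mz.
have e1 : (fun x => v x - 0) = v by apply/funext => x; rewrite subr0.
have e2 : (fun x => f (v x) - f 0) = (fun x => f (v x)) by apply/funext => x; rewrite f0 subr0.
rewrite e1 e2; apply=> //; first by case: vb.
by apply: aeW => x; rewrite normr0 mulr_ge0// hw_ge0.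
Qed.

Lemma f_gauss M K s t v w (x : V) : 0 <= M -> `|v x| <= M * hw n t -> `|w x| <= M * hw n t ->
  `|v x - w x| <= K * gauss s x -> `|f (v x) - f (w x)| <= Lfb M t * K * gauss s x.
Proof.
move=> M0 vM wM vw; rewrite -Lf_hw// (le_trans (f_diff_le vM wM))// -mulrA ler_wpM2l//.
exact: Lf_ge0.
Qed.

Lemma f_gauss1 M K s t v (x : V) : 0 <= M -> `|v x| <= M * hw n t ->
  `|v x| <= K * gauss s x -> `|f (v x)| <= Lfb M t * K * gauss s x.
Proof.
move=> M0 vM vK; rewrite -Lf_hw// (le_trans (f_le vM))// -mulrA ler_wpM2l//.
exact: Lf_ge0.
Qed.

Lemma tbd_cst (lo t M : R) : lo < t -> 0 <= M ->
  tbd `]lo, t[%classic t (fun => M) (M * (2 * (t - lo) `^ (1 / 2))).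
Proof.
move=> lot M0; have [mr ir] := @int_powR_rev R (1 / 2) lo t ltac:(lra) lot.
split => //; first by move=> s; rewrite /= in_itv/= => /andP[].
under eq_integral do rewrite mulrC EFinM.
rewrite ge0_integralZl//; [|exact/measurable_EFinP|by move=> s _; rewrite lee_fin powR_ge0].
rewrite EFinM lee_wpmul2l// (le_trans ir)// lee_fin.
have -> : 1 - 1 / 2 = 1 / 2 :> R by field.
by rewrite mulrC (_ : (1 / 2)^-1 = 2)//; field.
Qed.

End nonlinearity.

Section convolution_sum.
Variables (R : realType) (n : nat).
Local Notation V := (n.-tuple R).
Local Notation mu := (lebn R n).

Lemma cvD t c (K h g : V -> R) x : 0 < t -> gker t c K -> L1 mu h -> L1 mu g ->
  cv K (fun y => h y + g y) x = cv K h x + cv K g x.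
Proof.
move=> t0 Kt ih ig; rewrite /cv -RintegralD//; try exact: (L1_cv_integrand _ t0 Kt).
by apply: eq_Rintegral => y _; rewrite mulrDr.
Qed.

End convolution_sum.

(** * Translation invariance of the Lebesgue integral *)

Section translation_invariance.
Variable R : realType.
Local Notation leb := (@lebesgue_measure R).
Local Notation Rb := (measurableTypeR R).

Definition addr_by (r x : Rb) : Rb := x + r.

Lemma measurable_addr_by r : measurable_fun setT (addr_by r).
Proof. exact: measurable_funD. Qed.

HB.instance Definition _ r := isMeasurableFun.Build _ _ _ _ (addr_by r) (measurable_addr_by r).

Lemma lebesgue_measure_shift (r : R) (A : set R) : measurable A ->
  pushforward leb (addr_by r) A = leb A.
Proof.
move=> mA; apply/esym/lebesgue_measure_unique => //= _ [[a b]] _ <-.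
rewrite /pushforward.
have -> : addr_by r @^-1` `]a, b]%classic = `]a - r, b - r]%classic.
  by apply/seteqP; split => x /=; rewrite !in_itv/= ltrBlDr lerBrDr.
rewrite !lebesgue_measure_itv/= !lte_fin ltrD2; case: ifP => // _.
by rewrite -!EFinD; congr EFin; ring.
Qed.

Lemma ge0_integral_shift (r : R) (g : Rb -> \bar R) : measurable_fun setT g -> (forall x, 0 <= g x)%E ->
  (\int[leb]_x g (x + r)%R = \int[leb]_x g x)%E.
Proof.
move=> mg g0.
transitivity (\int[pushforward leb (addr_by r)]_x g x)%E.
  by rewrite ge0_integral_pushforward// => y _.
by apply: eq_measure_integral => //= A mA _; exact: lebesgue_measure_shift.
Qed.

Lemma measurable_tshift n (j : 'I_n) (r : R) : measurable_fun setT (fun x => tshift x j r).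
Proof.
apply/measurable_fun_tnthP => i; rewrite (_ : _ \o _ = fun x => tnth x i + (if i == j then r else 0)).
  by apply: measurable_funD => //; exact: measurable_tnth.
by apply/funext => x /=; rewrite tnth_mktuple.
Qed.

Lemma tshift_consf_head n (x r : R) (t : n.-tuple R) : tshift (consf (x, t)) ord0 r = consf (x + r, t).
Proof.
apply: eq_from_tnth => i; rewrite tnth_mktuple; case: (unliftP ord0 i) => [k ->|->].
  by rewrite !tnthS addr0.
by rewrite !tnth0.
Qed.

Lemma tshift_consf_tail n (x r : R) (t : n.-tuple R) i :
  tshift (consf (x, t)) (lift ord0 i) r = consf (x, tshift t i r).
Proof.
apply: eq_from_tnth => k; rewrite tnth_mktuple; case: (unliftP ord0 k) => [l ->|->].
  by rewrite !tnthS tnth_mktuple (inj_eq (@lift_inj _ _)).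
by rewrite !tnth0 addr0.
Qed.

Lemma ge0_integral_tshift n (j : 'I_n) (r : R) (g : n.-tuple R -> \bar R) :
  measurable_fun setT g -> (forall x, 0 <= g x)%E ->
  (\int[lebn R n]_x g (tshift x j r) = \int[lebn R n]_x g x)%E.
Proof.
elim: n => [|n IH] in j g *; first by case: j.
move=> mg g0; have mgs : measurable_fun setT (fun x => g (tshift x j r)).
  exact: (measurableT_comp mg (measurable_tshift j r)).
have mgc : measurable_fun setT (g \o @consf R n) by apply: measurableT_comp => //; exact: measurable_consf.
rewrite (ge0_lebnS mg g0) (ge0_lebnS mgs (fun x => g0 _)).
case: (unliftP ord0 j) => [i ->|->].
  apply: eq_integral => x _; under eq_integral do rewrite tshift_consf_tail.
  apply: (IH i (fun t => g (consf (x, t)))) => //.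
  exact: (measurableT_comp mgc (@pair1_measurable _ _ _ _ x)).
under eq_integral do under eq_integral do rewrite tshift_consf_head.
apply: (@ge0_integral_shift r (fun x => \int[lebn R n]_t g (consf (x, t)))%E).
  exact: (measurable_param_integral (lebn R n) mgc).
by move=> x; exact: integral_ge0.
Qed.

Lemma integral_tshift n (j : 'I_n) (r : R) (g : n.-tuple R -> R) : measurable_fun setT g ->
  (\int[lebn R n]_x (g (tshift x j r))%:E = \int[lebn R n]_x (g x)%:E)%E.
Proof.
move=> /measurable_EFinP mg; rewrite [LHS]integralE [RHS]integralE; congr (_ - _)%E.
  rewrite -(ge0_integral_tshift j r (measurable_funepos mg) (funepos_ge0 _)).
  by apply: eq_integral => x _; rewrite !funeposE.
rewrite -(ge0_integral_tshift j r (measurable_funeneg mg) (funeneg_ge0 _)).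
by apply: eq_integral => x _; rewrite !funenegE.
Qed.

Lemma Rintegral_tshift n (j : 'I_n) (r : R) (g : n.-tuple R -> R) : measurable_fun setT g ->
  \int[lebn R n]_x g (tshift x j r) = \int[lebn R n]_x g x.
Proof. by move=> mg; rewrite /Rintegral (integral_tshift j r mg). Qed.

Lemma L1_tshift n (j : 'I_n) (r : R) (g : n.-tuple R -> R) :
  L1 (lebn R n) g -> L1 (lebn R n) (fun x => g (tshift x j r)).
Proof.
move=> gi; have mg := L1_measurable gi.
have mgs : measurable_fun setT (fun x => g (tshift x j r)).
  exact: (measurableT_comp mg (measurable_tshift j r)).
have [M _ [_ gM]] := L1_L1le gi; apply: (@L1le_L1 _ _ _ _ _ M); split => //.
have mag : measurable_fun setT (fun x => (`|g x|)%:E).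
  by apply/measurable_EFinP; exact: measurableT_comp.
by rewrite (@ge0_integral_tshift n j r (fun x => (`|g x|)%:E) mag)// => x; rewrite lee_fin.
Qed.

End translation_invariance.

(** * Orthogonality of W and a . grad f(W) *)

Section zero_flux.
Variables (R : realType) (n : nat).
Local Notation V := (n.-tuple R).
Local Notation mu := (lebn R n).
Local Notation leb := (@lebesgue_measure R).
Local Notation Rb := (measurableTypeR R).

(** A majorant uniform over all shifts of length at most one, as differentiation under the integral
    in the shift requires. It comes from |z + r e_j|^2 >= |z|^2 / 2 - 1. *)
Lemma gauss_shift_le t (z : V) j r : 0 < t -> `|r| <= 1 ->
  gauss t (tshift z j r) <= 2 `^ (n%:R / 2) * expR ((4 * t)^-1) * gauss (2 * t) z.
Proof.
move=> t0 r1.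
have h : tnorm2 z / 2 - 1 <= tnorm2 (tshift z j r).
  rewrite /tnorm2 (bigD1 j)//= [leRHS](bigD1 j)//= tnth_mktuple eqxx mulrDl -addrA addrC -addrA addrC.
  have e : \sum_(i < n | i != j) tnth (tshift z j r) i ^+ 2 = \sum_(i < n | i != j) tnth z i ^+ 2.
    by apply: eq_bigr => i ij; rewrite tnth_mktuple (negbTE ij) addr0.
  rewrite e; have S0 : 0 <= \sum_(i < n | i != j) tnth z i ^+ 2 by rewrite sumr_ge0// => i _; rewrite sqr_ge0.
  have r2 : r ^+ 2 <= 1 by rewrite -real_normK ?num_real// expr_le1.
  have := sqr_ge0 (tnth z j + 2 * r); move: S0; set S := \sum_(_ < _ | _) _ => S0.
  have -> : (tnth z j + 2 * r) ^+ 2 = tnth z j ^+ 2 + 4 * (tnth z j * r) + 4 * r ^+ 2 by ring.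
  have -> : (tnth z j + r) ^+ 2 = tnth z j ^+ 2 + 2 * (tnth z j * r) + r ^+ 2 by ring.
  by move=> ?; lra.
rewrite /gauss (_ : 4 * pi * (2 * t) = 2 * (4 * pi * t)); last by ring.
have p0 : 0 <= 4 * pi * t by rewrite !mulr_ge0 ?pi_ge0 ?(ltW t0).
rewrite (powRM _ _ p0)// mulrACA -[in leRHS]mulrA mulrCA.
have e2 : 2 `^ (- (n%:R / 2)) * 2 `^ (n%:R / 2) = 1 :> R by rewrite powRN mulVf// gt_eqF// powR_gt0.
rewrite [leRHS](_ : _ = (2 `^ (- (n%:R / 2)) * 2 `^ (n%:R / 2)) * ((4 * pi * t) `^ (- (n%:R / 2)) *
   (expR (4 * t)^-1 * expR (- (tnorm2 z / (4 * (2 * t))))))); last by ring.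
rewrite e2 mul1r ler_wpM2l ?powR_ge0// -expRD ler_expR.
have -> : (4 * t)^-1 - tnorm2 z / (4 * (2 * t)) = - ((tnorm2 z / 2 - 1) / (4 * t)) by field; rewrite gt_eqF.
by rewrite lerN2 ler_wpM2r// invr_ge0 mulr_ge0// ltW.
Qed.

Lemma dgauss_shift_le t j : 0 < t ->
  exists2 C, 0 <= C & forall (z : V) r, `|r| <= 1 -> `|dgauss j t (tshift z j r)| <= C * gauss (4 * t) z.
Proof.
move=> t0; have t20 : 0 < 2 * t by rewrite mulr_gt0.
exists (G2 R n / Num.sqrt t * (2 `^ (n%:R / 2) * expR ((4 * (2 * t))^-1))).
  by rewrite mulr_ge0 ?divr_ge0 ?sqrtr_ge0 ?G2_ge0// mulr_ge0 ?powR_ge0 ?expR_ge0.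
move=> z r r1; apply: le_trans (dgauss_le _ _ t0) _; rewrite -!mulrA.
rewrite ler_wpM2l ?G2_ge0// ler_wpM2l ?invr_ge0 ?sqrtr_ge0//.
have := gauss_shift_le z j t20 r1; rewrite -mulrA.
by have -> : 2 * (2 * t) = 4 * t by ring.
Qed.

Lemma is_derive_cv_gauss_at t h x j r : 0 < t -> L1 mu h ->
  is_derive (r : R) 1 (fun s => cv (gauss t) h (tshift x j s)) (cv (dgauss j t) h (tshift x j r)).
Proof.
move=> t0 ih; have D := is_derive_cv_gauss (tshift x j r) j t0 ih.
have e : (fun s => cv (gauss t) h (tshift x j s)) =
    (fun s => cv (gauss t) h (tshift (tshift x j r) j s)) \o (fun s => s - r).
  by apply/funext => s /=; rewrite tshiftD addrC subrK.
rewrite e -[X in is_derive _ _ _ X]mulr1; apply: is_derive1_comp; first by rewrite subrr.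
by apply: is_derive_eq; rewrite subr0.
Qed.

Section antiderivative.
Variables (f : R -> R) (B L : R).
Hypotheses (fc : continuous f) (fL : forall xi, `|xi| <= B -> `|f xi| <= L * `|xi|).
Hypotheses (B0 : 0 <= B) (L0 : 0 <= L).

(** A primitive of f near [-B, B]. The base point lies one unit outside, so that every point of
    [-B, B] is interior for the fundamental theorem. *)
Definition prim (y : R) : R := \int[leb]_(s in `[- (B + 1), y]) f s.

Lemma is_derive_prim (y : R) : `|y| <= B -> is_derive y 1 prim (f y).
Proof.
rewrite ler_norml => /andP[h1 h2].
have fi : leb.-integrable `[- (B + 1), B + 1] (EFin \o f).
  apply: continuous_compact_integrable; first exact: segment_compact.
  exact: continuous_subspaceT.
have fy : {for y, continuous f} by exact: fc.
have [] := @continuous_FTC1_closed _ f (- (B + 1)) y (B + 1) ltac:(lra) fi ltac:(lra) fy.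
by move=> d <-; rewrite derive1E; apply: DeriveDef.
Qed.

Definition prim0 y := prim y - prim 0.

Lemma is_derive_prim0 (y : R) : `|y| <= B -> is_derive y 1 prim0 (f y).
Proof.
move=> yB; have H := is_derive_prim yB.
have -> : prim0 = prim + cst (- prim 0) by [].
rewrite -[f y]addr0; apply: is_deriveD.
Qed.

Lemma prim0_le y : `|y| <= B -> `|prim0 y| <= L * B * `|y|.
Proof.
move=> yB.
have key a c : `|a| <= B -> `|c| <= B -> a <= c -> `|prim c - prim a| <= L * B * `|c - a|.
  move=> aB cB ac.
  have cp z : `|z| <= B -> {for z, continuous prim}.
    by move=> zB; apply: differentiable_continuous; apply/derivable1_diffP; case: (is_derive_prim zB).
  have zB z : a <= z <= c -> `|z| <= B.
    by move=> /andP[az zc]; move: aB cB; rewrite !ler_norml => /andP[? ?] /andP[? ?]; apply/andP; lra.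
  have [] := @MVT_segment _ prim f a c ac.
  - by move=> z; rewrite in_itv/= => /andP[h1 h2]; apply: is_derive_prim; apply: zB; rewrite (ltW h1) (ltW h2).
  - apply: continuous_in_subspaceT => z; rewrite inE/= in_itv/= => /zB; exact: cp.
  move=> z; rewrite in_itv/= => /zB hz ->; rewrite normrM ler_wpM2r//.
  by rewrite (le_trans (fL hz))// ler_wpM2l.
have [y0|y0] := leP 0 y.
  by have := key 0 y; rewrite subr0 normr0; apply.
rewrite /prim0 distrC -[`|y|]normrN -[- y]add0r; apply: key; rewrite ?normr0//; exact: ltW.
Qed.

Lemma measurable_prim : measurable_fun setT (prim : Rb -> R).
Proof.
rewrite (_ : prim = fun y => \int[leb]_s (if (- (B + 1) <= s) && (s <= y) then f s else 0)).
  apply: (measurable_param_Rintegral leb (g := fun w : Rb * Rb =>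
    if (- (B + 1) <= w.2) && (w.2 <= w.1) then f w.2 else 0)).
  apply: measurable_fun_ifT => //.
    by apply: measurable_and => //; exact: measurable_fun_ler.
  apply: (measurableT_comp _ measurable_snd).
  exact: continuous_measurable_fun.
apply/funext => y; rewrite /prim Rintegral_mkcond; apply: eq_Rintegral => s _.
by rewrite patchE mem_setE in_itv.
Qed.

Lemma measurable_prim0 : measurable_fun setT (prim0 : Rb -> R).
Proof. by apply: measurable_funB => //; exact: measurable_prim. Qed.

End antiderivative.

(** With F a primitive of f and W the heat flow of h, the integrand is the derivative of F(W) in
    direction j. The integral of F(W) does not change when W is translated, and differentiating this
    constant in the shift replaces an integration by parts. *)
Lemma cv_dgauss_zero_flux (f : R -> R) (B L : R) t j (h : V -> R) : 0 < t -> continuous f ->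
  (forall xi, `|xi| <= B -> `|f xi| <= L * `|xi|) -> 0 <= L -> L1 mu h -> 0 <= B ->
  {ae mu, forall x, `|h x| <= B} ->
  \int[mu]_x (cv (dgauss j t) h x * f (cv (gauss t) h x)) = 0.
Proof.
move=> t0 fc fL L0 ih B0 hB; have mh := L1_measurable ih.
have UB x : `|cv (gauss t) h x| <= B by rewrite -[B]mul1r; exact: (cv_sup2 _ t0 (gauss_gker n t)).
pose F (r : R) x := prim0 f B (cv (gauss t) h (tshift x j r)).
have dU x (r : R) : is_derive r 1 (fun s : R => cv (gauss t) h (tshift x j s)) (cv (dgauss j t) h (tshift x j r)).
  exact: is_derive_cv_gauss_at.
have D (r : R) x : is_derive r 1 (F ^~ x) (f (cv (gauss t) h (tshift x j r)) * cv (dgauss j t) h (tshift x j r)).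
  have -> : F ^~ x = prim0 f B \o (fun s => cv (gauss t) h (tshift x j s)) by [].
  apply: is_derive1_comp.
  exact: (is_derive_prim0 fc (UB (tshift x j r))).
have mU : measurable_fun setT (cv (gauss t) h) by apply: measurable_cv => //; exact: measurable_gaussr.
have mU' r : measurable_fun setT (fun x => cv (gauss t) h (tshift x j r)).
  exact: (measurableT_comp mU (measurable_tshift j r)).
have mF0 : measurable_fun setT (fun x => prim0 f B (cv (gauss t) h x)).
  exact: (measurableT_comp (measurable_prim0 B fc) mU).
have mF r : measurable_fun setT (F r).
  exact: (measurableT_comp mF0 (measurable_tshift j r)).
have [C C0 dC] := dgauss_shift_le j t0.
have t40 : 0 < 4 * t by rewrite mulr_gt0.
have iN : L1 mu (fun y => `|h y|) by exact: integrable_norm.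
have iG : L1 mu (cv (gauss (4 * t)) (fun y => `|h y|)).
  by have [M _ hM] := L1_L1le iN; exact: L1le_L1 (cv_L1le t40 (gauss_gker n _) hM).
pose H x := L * B * (C * cv (gauss (4 * t)) (fun y => `|h y|) x).
have iH : mu.-integrable setT (EFin \o H) by apply: L1Z; apply: L1Z.
have H0 x : 0 <= H x.
  rewrite mulr_ge0 ?mulr_ge0//; apply: Rintegral_ge0 => y _.
  by rewrite mulr_ge0 ?gauss_ge0.
have F0 r : \int[mu]_x F r x = \int[mu]_x F 0 x.
  transitivity (\int[mu]_x prim0 f B (cv (gauss t) h x)); first exact: (Rintegral_tshift j r mF0).
  by apply: eq_Rintegral => x _; rewrite /F tshift0.
have I0 : `](-1), 1[%classic (0 : R) by rewrite /= in_itv/= ltrN10 ltr01.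
have iU : L1 mu (cv (gauss t) h).
  by have [M _ hM] := L1_L1le ih; exact: L1le_L1 (cv_L1le t0 (gauss_gker n t) hM).
have iF0 : L1 mu (fun x => prim0 f B (cv (gauss t) h x)).
  apply: (@L1_dom _ _ _ mu _ (fun x => L * B * `|cv (gauss t) h x|)) => //.
    by move=> x; exact: prim0_le.
  by apply: L1Z; exact: integrable_norm.
have intf r : `](-1), 1[%classic r -> mu.-integrable setT (EFin \o F r).
  by move=> _; exact: (L1_tshift j r iF0).
have der r y : `](-1), 1[%classic r -> [set: V] y -> derivable (F ^~ y) r 1.
  by move=> _ _; case: (D r y).
have hU x y r : `|r| <= 1 -> `|dgauss j t (tsub (tshift x j r) y) * h y| <= C * (gauss (4 * t) (tsub x y) * `|h y|).
  by move=> r1; rewrite normrM tsub_tshift mulrA ler_wpM2r// dC.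
have ub r x : `](-1), 1[%classic r -> [set: V] x -> `|partial1of2 F r x| <= H x.
  rewrite /= in_itv/= => r1 _; rewrite partial1of2E (@derive_val _ _ _ _ _ _ _ (D r x)) normrM.
  apply: ler_pM => //; first by rewrite (le_trans (fL _ (UB _)))// ler_wpM2l.
  have t20 : 0 < 2 * t by rewrite mulr_gt0.
  have i1 := L1_cv_integrand (tshift x j r) t20 (dgauss_gker j t0) ih.
  have i2 := L1_cv_integrand x t40 (gauss_gker n _) iN.
  apply: le_trans (le_normr_Rintegral measurableT i1) _; rewrite /cv -RintegralZl//.
  apply: le_Rintegral => //; [exact: integrable_norm|exact: L1Z|].
  by move=> y _; apply: hU; rewrite ler_norml; lra.
have := @differentiation_under_integral _ _ _ mu F setT measurableT 0 (-1) 1 I0 intf der _ H0 iH ub.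
rewrite (_ : (fun r => _) = cst (\int[mu]_x F 0 x)); last by apply/funext => r; exact: F0.
rewrite derive1_cst => /esym <-; apply: eq_Rintegral => x _.
by rewrite partial1of2E (@derive_val _ _ _ _ _ _ _ (D 0 x)) tshift0 mulrC.
Qed.

Lemma cv_pker_zero_flux (a : V) (f : R -> R) (B L : R) t (h : V -> R) : 0 < t -> continuous f ->
  (forall xi, `|xi| <= B -> `|f xi| <= L * `|xi|) -> 0 <= L -> L1 mu h -> 0 <= B ->
  {ae mu, forall x, `|h x| <= B} ->
  \int[mu]_x (cv (pker a t) h x * f (cv (gauss t) h x)) = 0.
Proof.
move=> t0 fc fL L0 ih B0 hB; have t20 : 0 < 2 * t by rewrite mulr_gt0.
have [M _ hM] := L1_L1le ih; have mh := L1_measurable ih.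
have UB x : `|cv (gauss t) h x| <= B by rewrite -[B]mul1r; exact: (cv_sup2 _ t0 (gauss_gker n t)).
have mU : measurable_fun setT (cv (gauss t) h) by apply: measurable_cv => //; exact: measurable_gaussr.
have iP j : L1 mu (cv (dgauss j t) h) := L1le_L1 (cv_L1le t20 (dgauss_gker j t0) hM).
have mf : measurable_fun setT (fun x => f (cv (gauss t) h x)).
  exact: (measurableT_comp (continuous_measurable_fun fc) mU).
have i1 j : L1 mu (fun x => tnth a j * (f (cv (gauss t) h x) * cv (dgauss j t) h x)).
  apply: L1Z; apply: (L1_mulbd (M := L * B) mf) => // x.
  by rewrite (le_trans (fL _ (UB x)))// ler_wpM2l.
transitivity (\int[mu]_x \sum_(j < n) (tnth a j * (f (cv (gauss t) h x) * cv (dgauss j t) h x))).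
  apply: eq_Rintegral => x _; rewrite -adv_cv// /adv mulr_suml; apply: eq_bigr => j _.
  by rewrite pderiv_heat//; ring.
rewrite Rintegral_bigsum// big1// => j _; rewrite RintegralZl//.
  under eq_Rintegral do rewrite mulrC.
  by rewrite (cv_dgauss_zero_flux j t0 fc fL)// mulr0.
by apply: (L1_mulbd (M := L * B) mf) => // x; rewrite (le_trans (fL _ (UB x)))// ler_wpM2l.
Qed.

End zero_flux.

(** * Energy inequality and smallness of the solution *)

Lemma cvNk (R : realType) n t c (K h : n.-tuple R -> R) x : 0 < t -> gker t c K -> L1 (lebn R n) h ->
  cv (fun y => - K y) h x = - cv K h x.
Proof.
move=> t0 Kt ih; rewrite /cv -mulN1r -(RintegralZl _ measurableT (L1_cv_integrand x t0 Kt ih)).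
by apply: eq_Rintegral => y _; rewrite mulN1r mulNr.
Qed.

Lemma Rintegral_AMGM (R : realType) n (g h : n.-tuple R -> R) : L1 (lebn R n) (fun x => g x ^+ 2) ->
  L1 (lebn R n) (fun x => g x * h x) -> L1 (lebn R n) (fun x => h x ^+ 2) ->
  2 * (\int[lebn R n]_x (g x * h x)) <= \int[lebn R n]_x (g x ^+ 2) + \int[lebn R n]_x (h x ^+ 2).
Proof.
move=> gg gh hh; rewrite -(RintegralZl _ measurableT gh) -(RintegralD measurableT gg hh).
apply: le_Rintegral => //; [exact: (L1Z 2 gh)|exact: (L1D gg hh)|].
move=> x _; have := sqr_ge0 (g x - h x); rewrite sqrrB; move: (g x) (h x) => w1 w2.
by rewrite -mulr_natl => ?; lra.
Qed.

Lemma second_difference (R : realType) (x y z : R) : 2 * x <= y + z -> x - z <= y - x.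
Proof. by move=> ?; lra. Qed.

(** The decrements of a convex sequence decrease, so N steps drop by at most N times the first
    decrement. *)
Lemma convex_drop (R : realType) (phi : nat -> R) N :
  (forall j, phi j.+1 - phi j.+2 <= phi j - phi j.+1) ->
  phi 0%N - phi N <= N%:R * (phi 0%N - phi 1%N).
Proof.
move=> C; have d j : phi j - phi j.+1 <= phi 0%N - phi 1%N.
  by elim: j => // j; exact: le_trans.
elim: N => [|N IH]; first by rewrite mul0r subrr.
by have := d N; rewrite -[N.+1%:R]natr1 mulrDl mul1r => H; lra.
Qed.

Lemma drop_arith (R : realType) (x y z w : R) : 2 * x <= z - w -> y <= x -> w + y <= z - x.
Proof. by move=> *; lra. Qed.

Lemma int_scale_le (R : realType) (D : set (measurableTypeR R)) (k : R -> R) C I :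
  measurable D -> measurable_fun D (k : measurableTypeR R -> R) -> (forall s, D s -> 0 <= k s) -> 0 <= C ->
  (\int[@lebesgue_measure R]_(s in D) (k s)%:E <= I%:E)%E ->
  (\int[@lebesgue_measure R]_(s in D) (C * k s)%:E <= (C * I)%:E)%E.
Proof.
move=> mD mk k0 C0 kI; under eq_integral do rewrite EFinM.
by rewrite ge0_integralZl//; [rewrite EFinM lee_wpmul2l|exact/measurable_EFinP].
Qed.

Section mild_solution.
Variables (R : realType) (n : nat) (a : n.-tuple R).
Local Notation V := (n.-tuple R).
Local Notation mu := (lebn R n).
Local Notation leb := (@lebesgue_measure R).
Local Notation Rb := (measurableTypeR R).
Variables (f : R -> R) (q b Cf : R).
Hypotheses (q0 : 0 < q) (qb : n%:R / 2 * q = b) (Cf0 : 0 <= Cf) (f0 : f 0 = 0)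
  (mf : measurable_fun setT f)
  (fL : forall xi eta, `|f xi - f eta| <= Cf * (`|xi| `^ q + `|eta| `^ q) * `|xi - eta|).
Variables (u0 : V -> R) (u : R -> V -> R) (B : R).
Hypotheses (u0b : bd 1 B u0) (ub : forall t, 0 < t -> bd 1 B (u t))
  (uc : forall t0, 0 < t0 -> forall e, 0 < e -> exists2 d, 0 < d & forall t, 0 < t -> `|t - t0| < d ->
     L1le mu (fun x => u t x - u t0 x) e).
Implicit Types (s t T lo hi : R).

Definition fu s (y : V) : R := f (u s y).
Definition Bf := Lf q Cf B * B.

Lemma hw1 : hw n 1 = 1 :> R.
Proof. by rewrite /hw powR1. Qed.

Lemma B_ge0 : 0 <= B. Proof. exact: bd_ge0 u0b. Qed.

Lemma Bf_ge0 : 0 <= Bf. Proof. by rewrite mulr_ge0 ?B_ge0 ?Lf_ge0. Qed.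

Lemma u_le t : 0 < t -> {ae mu, forall x, `|u t x| <= B}.
Proof. by move=> /ub[_]; rewrite hw1 mulr1. Qed.

Lemma measurable_u t : 0 < t -> measurable_fun setT (u t).
Proof. by move=> /ub; exact: bd_measurable. Qed.

Lemma fu_bd s : 0 < s -> bd 1 Bf (fu s).
Proof.
by move=> s0; have := f_bd1 q0 qb Cf0 f0 mf fL (ub s0); rewrite /Lfb powR1 mulr1.
Qed.

Lemma fu_L1cont s : 0 < s -> forall e, 0 < e -> exists2 d, 0 < d &
  forall r, `|r - s| < d -> L1le mu (fun y => fu r y - fu s y) e.
Proof.
move=> s0 e e0; have L0 := Lf_ge0 q Cf0 B.
have L1 : 0 < Lf q Cf B + 1 by rewrite ltr_wpDl.
have [d d0 ud] := uc s0 (divr_gt0 e0 L1).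
exists (Num.min d s); first by rewrite lt_min d0.
move=> r; rewrite lt_min => /andP[rd rs].
have r0 : 0 < r by move: rs; rewrite ltr_norml => /andP[]; lra.
have := f_L1 q0 Cf0 mf fL (measurable_u r0) (measurable_u s0) (u_le r0) (u_le s0) (ud r r0 rd).
by apply: L1le_weak; rewrite mulrCA ler_piMr ?(ltW e0)// ler_pdivrMr// mul1r lerDl.
Qed.

(** A solution comes with measurability at each time only. Joint measurability of the Duhamel
    integrand is recovered from continuity of u in L^1, which makes its values continuous in s at
    each fixed point. *)
Lemma fu_jm lo hi t : 0 <= lo -> lo < hi -> hi <= t -> jmD a `]lo, hi[%classic t fu.
Proof.
move=> lo0 lohi hit; apply: jm_carath => // [s /andP[los shi]|x s /andP[los shi]].
  have s0 : 0 < s by exact: le_lt_trans los.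
  apply: measurable_cv; last exact: bd_measurable (fu_bd s0).
  by apply: measurable_pker => //; exact: measurable_id.
have s0 : 0 < s by exact: le_lt_trans los.
apply: (@slice_continuous _ _ a fu t s x s s0) => //.
- exact: lt_le_trans hit.
- exact: bd_measurable (fu_bd s0).
- exact: bd_L1 (fu_bd s0).
- exact: fu_L1cont.
move=> r rs; have r0 : 0 < r by move: rs; rewrite ltr_norml => /andP[]; lra.
exact: bd_L1 (fu_bd r0).
Qed.

Hypothesis mild : forall t, 0 < t ->
  {ae mu, forall x, u t x = cv (gauss t) u0 x + Duh a `]0, t[%classic t fu x}.

Lemma Duh_fu_measurable lo hi t : 0 <= lo -> lo < hi -> hi <= t -> measurable_fun setT (Duh a `]lo, hi[%classic t fu).
Proof. by move=> lo0 lohi hit; apply: measurable_tint; exact: fu_jm. Qed.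

Lemma fu_slice_L1 s t : 0 < s -> s < t -> L1le mu (cv (pker a (t - s)) (fu s)) (cP a * Bf * (t - s) `^ (- (1 / 2))).
Proof.
move=> s0 st; have ts0 : 0 < t - s by rewrite subr_gt0.
have ts20 : 0 < 2 * (t - s) by rewrite mulr_gt0.
have [fb _] := fu_bd s0; have := cv_L1le ts20 (pker_gkerE a ts0) fb.
by rewrite mulrAC.
Qed.

Definition Bft T := (T + 1) `^ (n%:R / 2) * Bf.

Lemma fu_bdt s T : 0 < s -> s < T -> bd (s + 1) (Bft T) (fu s).
Proof.
move=> s0 sT; have sT1 : s + 1 <= (T + 1) * 1 by lra.
by apply: (bd_time _ ltr01 _ sT1 (fu_bd s0)); lra.
Qed.

Lemma tbd_fut lo t : 0 <= lo -> lo < t ->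
  tbd `]lo, t[%classic t (fun => Bft t) (Bft t * (2 * (t - lo) `^ (1 / 2))).
Proof. by move=> lo0 lot; apply: tbd_cst => //; rewrite mulr_ge0 ?powR_ge0// Bf_ge0. Qed.

Lemma fu_slice_integrable x lo t : 0 <= lo -> lo < t ->
  leb.-integrable `]lo, t[ (fun s => (cv (pker a (t - s)) (fu s) x)%:E).
Proof.
move=> lo0 lot; apply: (Duh_integrable x (tbd_fut lo0 lot) (c := 1)); first by lra.
- exact: fu_jm.
- by move=> s; rewrite /= in_itv/= => /andP[los _]; lra.
- by move=> s; rewrite /= in_itv/= => /andP[los st]; apply: fu_bdt => //; lra.
Qed.

Lemma Duh_fu_bde lo t : 0 <= lo -> lo < t ->
  bde (t + 1) (G2 R n * cP a * (Bft t * (2 * (t - lo) `^ (1 / 2)))) (Duh a `]lo, t[%classic t fu).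
Proof.
move=> lo0 lot; apply: (Duh_bde (tbd_fut lo0 lot)).
- exact: fu_jm.
- by move=> s; rewrite /= in_itv/= => /andP[los _]; lra.
- by move=> s; rewrite /= in_itv/= => /andP[los st]; apply: fu_bdt => //; lra.
Qed.

(** Under the time integral the heat flow only lengthens the kernel time, from T - s to T + r -
    s. *)
Lemma cv_Duh r lo T x : 0 < r -> 0 <= lo -> lo < T ->
  cv (gauss r) (Duh a `]lo, T[%classic T fu) x = Duh a `]lo, T[%classic (T + r) fu x.
Proof.
move=> r0 lo0 loT; have C0 : 0 <= cP a * Bf by rewrite mulr_ge0 ?cP_ge0 ?Bf_ge0.
have [mr ir] := @int_powR_rev R (1 / 2) lo T ltac:(lra) loT.
have mC : measurable_fun `]lo, T[ (fun s : Rb => cP a * Bf * (T - s) `^ (- (1 / 2))) by exact: measurable_funM.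
transitivity (tint `]lo, T[%classic (fun s => cv (gauss r) (cv (pker a (T - s)) (fu s))) x); last first.
  apply: eq_tint => s; rewrite /= in_itv/= => /andP[los sT].
  have s0 : 0 < s by exact: le_lt_trans los.
  have Ts0 : 0 < T - s by rewrite subr_gt0.
  have Ts20 : 0 < 2 * (T - s) by rewrite mulr_gt0.
  apply: (cv_assoc r0 Ts20 (gauss_gker n r) (pker_gker a Ts0)); last exact: bd_L1 (fu_bd s0).
  by move=> y; rewrite gauss_pker// (_ : r + _ = T + r - s)//; ring.
have mj := fu_jm lo0 loT (lexx T).
apply: (@cv_tint _ _ `]lo, T[%classic (gauss r) r 1 _ (fun s => cP a * Bf * (T - s) `^ (- (1 / 2)))
   (cP a * Bf * ((T - lo) `^ (1 - 1 / 2) / (1 - 1 / 2))) x r0 (gauss_gker n r) _ mj mC).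
- exact: measurable_itv.
- by move=> s _; rewrite mulr_ge0 ?powR_ge0.
- by apply: int_scale_le => // s _; exact: powR_ge0.
- move=> s; rewrite /= in_itv/= => /andP[los sT]; apply: fu_slice_L1 => //.
  exact: le_lt_trans los.
Qed.

(** The part of the Duhamel integral up to T is the heat flow of the whole Duhamel integral at time
    T, so u(T) can serve as a new datum. *)
Lemma restart T t : 0 < T -> T < t ->
  {ae mu, forall x, u t x = cv (gauss (t - T)) (u T) x + Duh a `]T, t[%classic t fu x}.
Proof.
move=> T0 Tt; have t0 : 0 < t by exact: lt_trans Tt.
have r0 : 0 < t - T by rewrite subr_gt0.
have iu0 := bd_L1 u0b.
have mD := Duh_fu_measurable (lexx 0) T0 (lexx T).
have iD : L1 mu (Duh a `]0, T[%classic T fu).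
  exact: bd_L1 (bde_bd (Duh_fu_bde (lexx 0) T0)).
have iH : L1 mu (cv (gauss T) u0).
  by have [M M0 u0M] := L1_L1le iu0; exact: L1le_L1 (cv_L1le T0 (gauss_gker n T) u0M).
have mH : measurable_fun setT (cv (gauss T) u0) by exact: L1_measurable iH.
have HT x : cv (gauss (t - T)) (u T) x = cv (gauss t) u0 x + Duh a `]0, T[%classic t fu x.
  have mS : measurable_fun setT (fun y => cv (gauss T) u0 y + Duh a `]0, T[%classic T fu y).
    exact: measurable_funD.
  rewrite (cv_ae x (measurable_gaussr _ (@measurable_id _ _ setT)) (measurable_u T0) mS (mild T0)).
  transitivity (cv (gauss (t - T)) (cv (gauss T) u0) x + cv (gauss (t - T)) (Duh a `]0, T[%classic T fu) x).
    exact: (cvD x r0 (gauss_gker n _) iH iD).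
  have -> : cv (gauss (t - T)) (Duh a `]0, T[%classic T fu) x = Duh a `]0, T[%classic t fu x.
    by rewrite (cv_Duh x r0 (lexx 0) T0) addrC subrK.
  congr (_ + _); apply: (cv_assoc r0 T0 (gauss_gker n _) (gauss_gker n _) _ iu0).
  by move=> y; rewrite cv_gauss_gauss// subrK.
move: (mild t0); apply: filterS => x ->; rewrite HT -addrA; congr (_ + _).
by rewrite /Duh; apply: tint_split => //; exact: fu_slice_integrable.
Qed.

Lemma cv_restart r T t x : 0 < r -> 0 < T -> T < t ->
  cv (gauss r) (u t) x = cv (gauss (t - T + r)) (u T) x + Duh a `]T, t[%classic (t + r) fu x.
Proof.
move=> r0 T0 Tt; have t0 : 0 < t by exact: lt_trans Tt.
have tT : 0 < t - T by rewrite subr_gt0.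
have iT := bd_L1 (ub T0); have mt := measurable_u t0.
have mS : measurable_fun setT (fun y => cv (gauss (t - T)) (u T) y + Duh a `]T, t[%classic t fu y).
  apply: measurable_funD; first by apply: measurable_cv; [exact: measurable_gaussr|exact: measurable_u].
  by apply: measurable_tint; apply: fu_jm => //; exact: ltW.
have iD := bd_L1 (bde_bd (Duh_fu_bde (ltW T0) Tt)).
have iH : L1 mu (cv (gauss (t - T)) (u T)).
  by have [M _ uM] := L1_L1le iT; exact: L1le_L1 (cv_L1le tT (gauss_gker n _) uM).
rewrite (cv_ae x (measurable_gaussr _ (@measurable_id _ _ setT)) mt mS (restart T0 Tt)).
have -> : cv [eta gauss r] (fun y => cv (gauss (t - T)) (u T) y + Duh a `]T, t[%classic t fu y) x =
    cv (gauss r) (cv (gauss (t - T)) (u T)) x + cv (gauss r) (Duh a `]T, t[%classic t fu) x.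
  exact: (cvD x r0 (gauss_gker n r) iH iD).
rewrite (cv_Duh x r0 (ltW T0) Tt); congr (_ + _).
apply: (cv_assoc r0 tT (gauss_gker n _) (gauss_gker n _) _ iT).
by move=> y; rewrite cv_gauss_gauss// addrC.
Qed.

(** * Hoelder moduli of the solution in space and time *)

Hypothesis fc : continuous f.

Definition Cmod := G2 R n * (Cp a * Ct R n + 2 * cP a).

Lemma Cmod_ge0 : 0 <= Cmod.
Proof. by rewrite /Cmod mulr_ge0 ?G2_ge0// addr_ge0// mulr_ge0 ?Cp_ge0 ?Ct_ge0 ?cP_ge0. Qed.

(** Moved in time from t to t + e, the gradient kernel changes by order sqrt e / t if e <= t, and by
    order t^(-1/2) otherwise. Both are below e^(3/8) t^(-7/8). The power 1/2 of e would leave 1/t,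
    which is not integrable at 0, while 3/8 is still large enough for the energy step. *)
Lemma holder_small t e : 0 < e -> e <= t -> Num.sqrt e / t <= e `^ (3 / 8) * t `^ (- (7 / 8)).
Proof.
move=> e0 et; have t0 : 0 < t by exact: lt_le_trans et.
have -> : Num.sqrt e = e `^ (3 / 8) * e `^ (1 / 8).
  rewrite -powRD ?(gt_eqF e0) ?implybT// -powR12_sqrt ?(ltW e0)//; congr (_ `^ _); by field.
have -> : t `^ (- (7 / 8)) = t `^ (1 / 8) / t.
  rewrite -(powR_inv1 (ltW t0)) -powRD ?(gt_eqF t0) ?implybT//; congr (_ `^ _); by field.
rewrite -mulrA ler_wpM2l ?powR_ge0// ler_wpM2r ?invr_ge0 ?(ltW t0)//.
by rewrite ge0_ler_powR ?nnegrE ?(ltW e0) ?(ltW t0).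
Qed.

Lemma holder_large t e : 0 < t -> t <= e -> t `^ (- (1 / 2)) <= e `^ (3 / 8) * t `^ (- (7 / 8)).
Proof.
move=> t0 te.
have -> : t `^ (- (1 / 2)) = t `^ (3 / 8) * t `^ (- (7 / 8)).
  rewrite -powRD ?(gt_eqF t0) ?implybT//; congr (_ `^ _); by field.
rewrite ler_wpM2r ?powR_ge0// ge0_ler_powR ?nnegrE ?(ltW t0)//.
by apply: le_trans te; exact: ltW.
Qed.

Lemma bdeB t M N (h g : V -> R) : bde t M h -> bde t N g -> bde t (M + N) (fun x => h x - g x).
Proof.
move=> [hM hb] [gN gb]; split; first exact: L1leB.
by move=> x; rewrite mulrDl (le_trans (ler_normB _ _))// lerD.
Qed.

Lemma pker_slice_bde1 t M v : 0 < t -> bd 1 M v -> bde 1 (G2 R n * (cP a * t `^ (- (1 / 2))) * M) (cv (pker a t) v).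
Proof.
move=> t0 vb; have t20 : 0 < 2 * t by rewrite mulr_gt0.
by apply: (cv_bde t20 ltr01 ltr01 _ (pker_gkerE a t0) vb); right; lra.
Qed.

Lemma pker_diff_bde1 t e M v : 0 < t -> 0 < e -> bd 1 M v ->
  bde 1 (Cmod * (e `^ (3 / 8) * t `^ (- (7 / 8))) * M) (fun x => cv (pker a (t + e)) v x - cv (pker a t) v x).
Proof.
move=> t0 e0 vb; have M0 := bd_ge0 vb; have iv := bd_L1 vb.
have te0 : 0 < t + e by rewrite addr_gt0.
have t20 : 0 < 2 * t by rewrite mulr_gt0.
have te20 : 0 < 2 * (t + e) by rewrite mulr_gt0.
have CC : 0 <= Cp a * Ct R n := mulr_ge0 (Cp_ge0 a) (Ct_ge0 R n).
have W0 : 0 <= e `^ (3 / 8) * t `^ (- (7 / 8)) by rewrite mulr_ge0 ?powR_ge0.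
have [et|te] := leP e t.
  have e1 : (fun x => cv (pker a (t + e)) v x - cv (pker a t) v x) = cv (fun y => pker a (t + e) y - pker a t y) v.
    by apply/funext => x; rewrite (cvKB x te20 t20 (pker_gker a te0) (pker_gker a t0) iv).
  rewrite e1; have h12 : 1 <= 2 * (2 * (t + e)) \/ 1 <= 2 * 1 :> R by right; lra.
  apply: bde_weak (cv_bde te20 ltr01 ltr01 h12 (pker_time_diff a e0 et) vb).
  rewrite ler_wpM2r// /Cmod -[leRHS]mulrA ler_wpM2l ?G2_ge0//.
  rewrite [leLHS](_ : _ = Cp a * Ct R n * (Num.sqrt e / t)); last by ring.
  apply: ler_pM (holder_small e0 et) => //; first by rewrite divr_ge0 ?sqrtr_ge0// ltW.
  by rewrite lerDl mulr_ge0// cP_ge0.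
apply: bde_weak (bdeB (pker_slice_bde1 te0 vb) (pker_slice_bde1 t0 vb)).
rewrite -mulrDl ler_wpM2r// -mulrDr /Cmod -[leRHS]mulrA ler_wpM2l ?G2_ge0// -mulrDr.
rewrite [leRHS]mulrDl ler_wpDl//; first exact: mulr_ge0.
rewrite [X in _ <= X * _]mulrC -[leRHS]mulrA ler_wpM2l ?cP_ge0//.
have h1 := holder_large t0 (ltW te).
have h2 : (t + e) `^ (- (1 / 2)) <= t `^ (- (1 / 2)) by apply: ge0_ler_powRN => //; lra.
lra.
Qed.

Lemma Duh_fu_bde1 lo hi t : 0 <= lo -> lo < hi -> hi <= t ->
  bde 1 (G2 R n * cP a * Bf * (2 * (hi - lo) `^ (1 / 2))) (Duh a `]lo, hi[%classic t fu).
Proof.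
move=> lo0 lohi hit; have [mr ir] := @int_powR_rev R (1 / 2) lo hi ltac:(lra) lohi.
have C0 : 0 <= G2 R n * cP a * Bf by rewrite mulr_ge0 ?Bf_ge0// mulr_ge0 ?G2_ge0 ?cP_ge0.
apply: (@bde_tint _ _ _ (fun s => G2 R n * cP a * Bf * (hi - s) `^ (- (1 / 2)))).
- exact: measurable_itv.
- exact: measurable_funM.
- apply: int_scale_le => //; first by move=> s _; exact: powR_ge0.
  rewrite (le_trans ir)// lee_fin.
  have -> : 1 - 1 / 2 = 1 / 2 :> R by field.
  by rewrite mulrC (_ : (1 / 2)^-1 = 2)//; field.
- by move=> s _; rewrite mulr_ge0 ?powR_ge0.
- exact: fu_jm.
move=> s; rewrite /= in_itv/= => /andP[los sh]; have s0 : 0 < s by exact: le_lt_trans los.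
apply: bde_weak (pker_slice_bde1 _ (fu_bd s0)); last by rewrite subr_gt0 (lt_le_trans sh).
rewrite [leLHS](_ : _ = G2 R n * cP a * Bf * (t - s) `^ (- (1 / 2))); last by ring.
rewrite ler_wpM2l//; by apply: ge0_ler_powRN; lra.
Qed.

Definition Cu := G2 R n * (4 * G2 R n / Num.sqrt (1 / 2) * Ct R n) * B + Cmod * Bf * 8.

(** The solution is restarted half a unit earlier. The linear part is then regular, with kernel time
    1/2, and the Duhamel part inherits the modulus of the kernels; the factor 8 in [Cu] is the
    integral of (t-s)^(-7/8). *)
Lemma u_modulus t e : 1 <= t -> 0 < e -> e <= 1 / 2 ->
  bd 1 (Cu * e `^ (3 / 8)) (fun x => cv (gauss e) (u t) x - u t x).
Proof.
move=> t1 e0 e1; pose T := t - 1 / 2.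
have t0 : 0 < t by lra.
have T0 : 0 < T by rewrite /T; lra.
have Tt : T < t by rewrite /T; lra.
have tT : t - T = 1 / 2 by rewrite /T; ring.
have h0 : 0 < 1 / 2 :> R by lra.
have iT := bd_L1 (ub T0).
have mt := measurable_u t0.
pose d1 x := cv (fun y => gauss (1 / 2 + e) y - gauss (1 / 2) y) (u T) x.
pose d2 := tint `]T, t[%classic (fun s y => cv (pker a (t - s + e)) (fu s) y - cv (pker a (t - s)) (fu s) y).
have E : {ae mu, forall x, d1 x + d2 x = cv (gauss e) (u t) x - u t x}.
  have C0 : 0 <= G2 R n * cP a * Bf by rewrite mulr_ge0 ?Bf_ge0// mulr_ge0 ?G2_ge0 ?cP_ge0.
  move: (restart T0 Tt); apply: filterS => x ux.
  rewrite (cv_restart x e0 T0 Tt) ux tT.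
  have r0 : 0 < 1 / 2 + e by lra.
  rewrite /d1 (cvKB x r0 h0 (gauss_gker n _) (gauss_gker n _) iT).
  suff e2 : d2 x = Duh a `]T, t[%classic (t + e) fu x - Duh a `]T, t[%classic t fu x.
    by rewrite [X in _ + X = _]e2; move: (cv _ _ _) (cv _ _ _) (Duh _ _ _ _ _) (Duh _ _ _ _ _) => w1 w2 w3 w4; ring.
  have te : t <= t + e by lra.
  have [mr ir] := @int_powR_rev R (1 / 2) T t ltac:(lra) Tt.
  pose k s := G2 R n * cP a * Bf * (t - s) `^ (- (1 / 2)).
  have kI := int_scale_le (measurable_itv _) mr (fun s _ => powR_ge0 _ _) C0 ir.
  have mk : measurable_fun `]T, t[ (k : Rb -> R) by exact: measurable_funM.
  have k0 s : `]T, t[%classic s -> 0 <= k s by move=> _; rewrite mulr_ge0 ?powR_ge0.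
  have FB s : `]T, t[%classic s -> `|cv (pker a (t + e - s)) (fu s) x| <= k s * 1.
    rewrite /= in_itv/= => /andP[Ts st]; have s0 : 0 < s by exact: lt_trans Ts.
    have tes : 0 < t + e - s by lra.
    have [_ /(_ x)] := pker_slice_bde1 tes (fu_bd s0); rewrite hw1 !mulr1 => /le_trans; apply.
    rewrite [leLHS](_ : _ = G2 R n * cP a * Bf * (t + e - s) `^ (- (1 / 2))); last by ring.
    by rewrite ler_wpM2l//; apply: ge0_ler_powRN; lra.
  have GB s : `]T, t[%classic s -> `|cv (pker a (t - s)) (fu s) x| <= k s * 1.
    rewrite /= in_itv/= => /andP[Ts st]; have s0 : 0 < s by exact: lt_trans Ts.
    have ts : 0 < t - s by lra.
    have [_ /(_ x)] := pker_slice_bde1 ts (fu_bd s0); rewrite hw1 !mulr1 => /le_trans; apply.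
    by rewrite [leLHS](_ : _ = G2 R n * cP a * Bf * (t - s) `^ (- (1 / 2)))//; ring.
  have tB := tintB (measurable_itv _) mk kI k0 (fu_jm (ltW T0) Tt te) (fu_jm (ltW T0) Tt (lexx t)) FB GB ler01.
  transitivity (tint `]T, t[%classic (fun s y => cv (pker a (t + e - s)) (fu s) y - cv (pker a (t - s)) (fu s) y) x).
    by apply: eq_tint => s _; rewrite addrAC.
  exact: tB.
have b1 : bd 1 (G2 R n * (4 * G2 R n / Num.sqrt (1 / 2) * Ct R n) * B * e `^ (3 / 8)) d1.
  have r0 : 0 < 2 * (1 / 2 + e) by lra.
  have h12 : 1 <= 2 * (2 * (1 / 2 + e)) \/ 1 <= 2 * 1 :> R by right; lra.
  apply: bde_bd; apply: bde_weak (cv_bde r0 ltr01 ltr01 h12 (gauss_time_diff n e0 e1) (ub T0)).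
  have c0 : 0 <= G2 R n * (4 * G2 R n / Num.sqrt (1 / 2) * Ct R n) * B.
    apply: mulr_ge0 B_ge0; apply: mulr_ge0 (G2_ge0 _ _) (mulr_ge0 _ (Ct_ge0 _ _)).
    by rewrite divr_ge0 ?sqrtr_ge0// mulr_ge0 ?G2_ge0.
  rewrite [leLHS](_ : _ = G2 R n * (4 * G2 R n / Num.sqrt (1 / 2) * Ct R n) * B * Num.sqrt e); last by ring.
  rewrite ler_wpM2l// -powR12_sqrt ?(ltW e0)//.
  by apply: ger_powR; [rewrite e0/=; lra|lra].
have b2 : bd 1 (Cmod * Bf * 8 * e `^ (3 / 8)) d2.
  have [mr ir] := @int_powR_rev R (7 / 8) T t ltac:(lra) Tt.
  have C0 : 0 <= Cmod * Bf * e `^ (3 / 8) by exact: (mulr_ge0 (mulr_ge0 Cmod_ge0 Bf_ge0) (powR_ge0 _ _)).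
  have kI := int_scale_le (measurable_itv _) mr (fun s _ => powR_ge0 _ _) C0 ir.
  apply: bde_bd; apply: bde_weak (@bde_tint _ _ _ _ _ (measurable_itv _) _ kI _ _ 1 _ _).
  - rewrite [leRHS]mulrAC ler_wpM2l// tT.
    have -> : 1 - 7 / 8 = 1 / 8 :> R by field.
    rewrite (_ : (1 / 8)^-1 = 8); last by field.
    have p1 : (1 / 2) `^ (1 / 8) <= 1 `^ (1 / 8) :> R by apply: ge0_ler_powR; rewrite ?nnegrE; lra.
    by move: p1; rewrite powR1 => p1; rewrite ler_piMl.
  - exact: measurable_funM.
  - by move=> s _; rewrite mulr_ge0 ?powR_ge0.
  - apply: jmB; last by apply: fu_jm => //; exact: ltW.
    have te : t <= t + e by lra.
    by apply: eq_jm (fu_jm (ltW T0) Tt te) => s x _; rewrite addrAC.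
  move=> s; rewrite /= in_itv/= => /andP[Ts st]; have s0 : 0 < s by exact: lt_trans Ts.
  have ts : 0 < t - s by lra.
  apply: bde_weak (pker_diff_bde1 ts e0 (fu_bd s0)).
  by rewrite le_eqVlt; apply/orP; left; apply/eqP; ring.
rewrite /Cu mulrDl; apply: bd_ae E (bdD b1 b2).
apply: measurable_funB => //; apply: measurable_cv => //; exact: measurable_gaussr.
Qed.

Lemma Cu_ge0 : 0 <= Cu.
Proof.
have h0 : 0 < 1 / 2 :> R by lra.
by have := bd_ge0 (u_modulus (lexx 1) h0 (lexx _)); rewrite pmulr_lge0// powR_gt0.
Qed.

Definition Ctm := Cu + G2 R n * cP a * Bf * 2.

Lemma Ctm_ge0 : 0 <= Ctm.
Proof.
have C0 : 0 <= G2 R n * cP a * Bf by rewrite mulr_ge0 ?Bf_ge0// mulr_ge0 ?G2_ge0 ?cP_ge0.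
by apply: addr_ge0 Cu_ge0 _; exact: mulr_ge0.
Qed.

Lemma u_time_modulus t s : 1 <= t -> 0 < s -> s <= 1 / 2 ->
  L1le mu (fun x => u (t + s) x - u t x) (Ctm * s `^ (3 / 8)).
Proof.
move=> t1 s0 s1; have t0 : 0 < t by lra.
have ts : t < t + s by lra.
have [m1 _] := u_modulus t1 s0 s1.
have [m2 _] := Duh_fu_bde1 (ltW t0) ts (lexx (t + s)).
have C0 : 0 <= G2 R n * cP a * Bf by rewrite mulr_ge0 ?Bf_ge0// mulr_ge0 ?G2_ge0 ?cP_ge0.
have E : t + s - t = s by ring.
have s38 : s `^ (1 / 2) <= s `^ (3 / 8) by apply: ger_powR; [rewrite s0/=; lra|lra].
apply: (@L1le_weak _ _ _ _ _ (Cu * s `^ (3 / 8) + G2 R n * cP a * Bf * (2 * (t + s - t) `^ (1 / 2)))).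
  by rewrite E /Ctm [leRHS]mulrDl lerD2l -[leRHS]mulrA ler_wpM2l//; lra.
apply: L1le_ae (L1leD m1 m2).
  by apply: measurable_funB; apply: measurable_u => //; lra.
by move: (restart t0 ts); rewrite E; apply: filterS => x ->; ring.
Qed.

(** An interpolation: u(t) is split into its mollification at scale e, whose gradient costs
    e^(-1/2), and a remainder of order e^(3/8). For small r and a suitable e this improves on the
    direct bound r^(-1/2) B, and the energy step relies on the improvement. *)
Lemma pker_u_sup t r e x : 1 <= t -> 0 < r -> 0 < e -> e <= 1 / 2 ->
  `|cv (pker a r) (u t) x| <= cP a * (r `^ (- (1 / 2)) * (Cu * e `^ (3 / 8)) + e `^ (- (1 / 2)) * B).
Proof.
move=> t1 r0 e0 e1; have t0 : 0 < t by lra.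
have iu := bd_L1 (ub t0); have r20 : 0 < 2 * r by lra.
have re20 : 0 < 2 * (r + e) by lra.
have re0 : 0 < r + e by lra.
have [M _ uM] := L1_L1le iu; have iG := L1le_L1 (cv_L1le e0 (gauss_gker n e) uM).
have [m1 m2] := u_modulus t1 e0 e1; have mm : measurable_fun setT (fun x => cv (gauss e) (u t) x - u t x) by case: m1.
have E : cv (pker a r) (u t) x =
  cv (pker a (r + e)) (u t) x - cv (pker a r) (fun y => cv (gauss e) (u t) y - u t y) x.
  rewrite (cvB x r20 (pker_gker a r0) iG iu).
  have -> : cv (pker a r) (cv (gauss e) (u t)) x = cv (pker a (r + e)) (u t) x.
    by apply: (cv_assoc r20 e0 (pker_gker a r0) (gauss_gker n e) _ iu) => y; rewrite pker_gauss.
  by rewrite subKr.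
rewrite E; apply: le_trans (ler_normB _ _) _; rewrite addrC mulrDr; apply: lerD.
  rewrite mulrA; apply: (cv_sup2 x r20 (pker_gkerE a r0) mm); last exact: L1le_ge0 m1.
  by move: m2; rewrite hw1 mulr1.
apply: le_trans (cv_sup2 x re20 (pker_gkerE a re0) (measurable_u t0) (u_le t0) B_ge0) _.
rewrite -mulrA ler_wpM2l ?cP_ge0// ler_wpM2r ?B_ge0//.
by apply: ge0_ler_powRN => //; rewrite lerDr ltW.
Qed.

(** * The mollified energy and its decay *)

Definition energy e t := \int[mu]_x (cv (gauss e) (u t) x ^+ 2).

Lemma L1le_mulbd (h g : V -> R) M N : measurable_fun setT g -> (forall x, `|g x| <= N) -> L1le mu h M ->
  L1le mu (fun x => g x * h x) (N * M).
Proof.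
move=> mg gN hM; have N0 : 0 <= N by exact: le_trans (gN (tzero R n)).
have [mh _] := hM.
apply: (@L1le_dom _ _ _ _ _ (fun x => N * `|h x|)); first exact: measurable_funM.
  by move=> x; rewrite normrM ler_wpM2r.
rewrite -[N in X in L1le _ _ X](ger0_norm N0); apply: L1leZ; case: hM => _ hM; split.
  exact: measurableT_comp.
by under eq_integral do rewrite normr_id.
Qed.

Definition Se e eta := cP a * (e `^ (- (1 / 2)) * (Cu * eta `^ (3 / 8)) + eta `^ (- (1 / 2)) * B).

(** The mollification time is the one that [energy_step] produces when all kernels are moved onto
    u(t). It lies between e and 4 e. *)
Lemma u_near_mollified t s e h : 1 <= t -> 0 < h -> h <= e -> e <= 1 / 8 -> t < s -> s < t + h ->
  L1le mu (fun x => u s x - cv (gauss (2 * (e + h) + t - s)) (u t) x) ((Ctm + 4 * Cu) * e `^ (3 / 8)).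
Proof.
move=> t1 h0 he e1 ts sth; have e0 : 0 < e by lra.
have t0 : 0 < t by lra.
pose r := 2 * (e + h) + t - s; have r0 : 0 < r by rewrite /r; lra.
have r1 : r <= 1 / 2 by rewrite /r; lra.
have st0 : 0 < s - t by lra.
have st1 : s - t <= 1 / 2 by lra.
have [m1 _] := u_modulus t1 r0 r1.
have := u_time_modulus t1 st0 st1; rewrite [t + _]addrC subrK => m2.
have p1 : (s - t) `^ (3 / 8) <= e `^ (3 / 8).
  by apply: ge0_ler_powR; rewrite ?nnegrE; lra.
have p2 : r `^ (3 / 8) <= 4 * e `^ (3 / 8).
  apply: (@le_trans _ _ ((4 * e) `^ (3 / 8))).
    by apply: ge0_ler_powR; rewrite ?nnegrE /r; lra.
  rewrite powRM ?(ltW e0)// ler_wpM2r ?powR_ge0//.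
  rewrite -[leRHS]powRr1//; apply: ler_powR; lra.
apply: (@L1le_weak _ _ _ _ _ (Ctm * (s - t) `^ (3 / 8) + Cu * r `^ (3 / 8))).
  rewrite [leRHS]mulrDl; apply: lerD; first by rewrite ler_wpM2l// Ctm_ge0.
  by rewrite [4 * Cu]mulrC -[leRHS]mulrA ler_wpM2l// Cu_ge0.
have := L1leB m2 m1; apply: L1le_ae; last by apply: aeW => x; ring.
apply: measurable_funB; first by apply: measurable_u; lra.
by apply: measurable_cv; [exact: measurable_gaussr|exact: measurable_u].
Qed.

Definition CD := G2 R n * cP a * Bf.

(** The mollified u(t + h) is g + D, with g a heat flow of u(t) and D a Duhamel integral over (t, t
    + h). In the cross term the gradient kernel is moved onto g, which leaves at each s the pairing
    of P = a . grad W with f(u(s)), where W is u(t) mollified at time rho. Against f(W) this pairing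
    vanishes; the replacement costs sup |P| times the L^1 distance of f(u(s)) and f(W). The last
    error term bounds the integral of D squared. *)
Lemma energy_step t e h eta : 1 <= t -> 0 < h -> h <= e -> e <= 1 / 8 -> 0 < eta -> eta <= 1 / 2 ->
  energy e (t + h) <= energy (e + h) t +
    2 * (Se e eta * (Lf q Cf B * ((Ctm + 4 * Cu) * e `^ (3 / 8))) * h) +
    (CD * e `^ (- (1 / 2)) * h) * (CD * e `^ (- (1 / 2)) * h).
Proof.
move=> t1 h0 he e1 eta0 eta1; have e0 : 0 < e by lra.
have t0 : 0 < t by lra.
have th0 : 0 < t + h by lra.
have tth : t < t + h by lra.
have eh0 : 0 < e + h by lra.
have the : t + h <= t + h + e by lra.
have iu := bd_L1 (ub t0); have mt := measurable_u t0.
have [M _ uM] := L1_L1le iu.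
pose g := cv (gauss (e + h)) (u t).
pose D : set Rb := `]t, t + h[%classic.
pose F s := cv (pker a (t + h + e - s)) (fu s).
pose K := CD * e `^ (- (1 / 2)).
have CD0 : 0 <= CD by rewrite mulr_ge0 ?Bf_ge0// mulr_ge0 ?G2_ge0 ?cP_ge0.
have K0 : 0 <= K by rewrite mulr_ge0 ?powR_ge0.
have mDD : measurable D by exact: measurable_itv.
have lD : (leb D <= h%:E)%E.
  by rewrite lebesgue_measure_itv/= lte_fin tth -EFinD lee_fin lerBlDl.
have kI : (\int[leb]_(s in D) K%:E <= (K * h)%:E)%E.
  by rewrite integral_cst// (EFinM K) lee_wpmul2l.
have mj : jm D F by exact: fu_jm (ltW t0) tth the.
have Fb s : D s -> bde 1 K (F s).
  rewrite /D /= in_itv/= => /andP[ts sth]; have s0 : 0 < s by exact: lt_trans ts.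
  have r0 : 0 < t + h + e - s by lra.
  apply: bde_weak (pker_slice_bde1 r0 (fu_bd s0)).
  rewrite [leLHS](_ : _ = CD * (t + h + e - s) `^ (- (1 / 2))); last by rewrite /CD; ring.
  by rewrite ler_wpM2l//; apply: ge0_ler_powRN => //; lra.
have [bD1 bD2] : bde 1 (K * h) (tint D F) by apply: (@bde_tint _ _ D (fun => K)).
have bD x : `|tint D F x| <= K * h by have := bD2 x; rewrite hw1 mulr1.
have mD : measurable_fun setT (tint D F) by case: bD1.
have gB x : `|g x| <= B.
  by have := cv_sup2 x eh0 (gauss_gker n (e + h)) mt (u_le t0) B_ge0; rewrite mul1r.
have ig : L1 mu g := L1le_L1 (cv_L1le eh0 (gauss_gker n _) uM).
have mg : measurable_fun setT g := L1_measurable ig.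
have E x : cv (gauss e) (u (t + h)) x = g x + tint D F x.
  by rewrite (cv_restart x e0 t0 tth) (_ : t + h - t + e = e + h)//; ring.
have i1 : L1 mu (fun x => g x * g x) by exact: L1_mulbd mg gB ig.
have i2 : L1 mu (fun x => g x * tint D F x) by exact: L1_mulbd mg gB (L1le_L1 bD1).
have i3 : L1 mu (fun x => tint D F x * tint D F x) by exact: L1_mulbd mD bD (L1le_L1 bD1).
have -> : energy e (t + h) = energy (e + h) t + 2 * (\int[mu]_x (g x * tint D F x)) + \int[mu]_x (tint D F x * tint D F x).
  transitivity (\int[mu]_x (g x * g x + (2 * (g x * tint D F x) + tint D F x * tint D F x))).
    by apply: eq_Rintegral => x _; rewrite E; ring.
  rewrite (RintegralD measurableT i1 (L1D (L1Z 2 i2) i3)) (RintegralD measurableT (L1Z 2 i2) i3).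
  by rewrite (RintegralZl _ measurableT i2) addrA.
have h1 : `|\int[mu]_x (tint D F x * tint D F x)| <= K * h * (K * h).
  by apply: Rintegral_L1le; exact: L1le_mulbd.
have c0 : 0 <= Se e eta * (Lf q Cf B * ((Ctm + 4 * Cu) * e `^ (3 / 8))).
  apply: mulr_ge0.
    apply: mulr_ge0 (cP_ge0 a) _; apply: addr_ge0; apply: mulr_ge0 (powR_ge0 _ _) _ => //; last exact: B_ge0.
    exact: mulr_ge0 Cu_ge0 (powR_ge0 _ _).
  apply: mulr_ge0 (Lf_ge0 _ Cf0 _) (mulr_ge0 _ (powR_ge0 _ _)).
  by apply: addr_ge0 Ctm_ge0 _; apply: mulr_ge0 Cu_ge0.
have h2 : `|\int[mu]_x (g x * tint D F x)| <= Se e eta * (Lf q Cf B * ((Ctm + 4 * Cu) * e `^ (3 / 8))) * h.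
  apply: (@Rintegral_tint_le _ _ D F (fun => K) (K * h) g B) => //.
    by move=> s /Fb[].
  move=> s; rewrite /D /= in_itv/= => /andP[ts sth]; have s0 : 0 < s by exact: lt_trans ts.
  pose r := t + h + e - s; have r0 : 0 < r by rewrite /r; lra.
  have r20 : 0 < 2 * r by rewrite mulr_gt0.
  (* The kernel time r of the slice and the mollification e + h of g compose to rho, so u(s) has to
     be compared with u(t) mollified at rho and at no other scale. *)
  pose rho := 2 * (e + h) + t - s; have rho0 : 0 < rho by rewrite /rho; lra.
  have rr : r + (e + h) = rho by rewrite /r /rho; ring.
  pose P := cv (pker a rho) (u t); pose W := cv (gauss rho) (u t).
  have PS x : `|P x| <= Se e eta.
    apply: le_trans (pker_u_sup x t1 rho0 eta0 eta1) _.
    rewrite ler_wpM2l ?cP_ge0// lerD2r ler_wpM2r ?(mulr_ge0 Cu_ge0 (powR_ge0 _ _))//.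
    by apply: ge0_ler_powRN => //; rewrite /rho; lra.
  have mP : measurable_fun setT P.
    by apply: measurable_cv => //; apply: measurable_pker => //; exact: measurable_id.
  have iW : L1 mu W := L1le_L1 (cv_L1le rho0 (gauss_gker n _) uM).
  have WB x : `|W x| <= B.
    by have := cv_sup2 x rho0 (gauss_gker n rho) mt (u_le t0) B_ge0; rewrite mul1r.
  have ifs := bd_L1 (fu_bd s0).
  have fW := f_L1 q0 Cf0 mf fL (measurable_u s0) (L1_measurable iW) (u_le s0) (aeW _ WB)
    (u_near_mollified t1 h0 he e1 ts sth).
  have idf : L1 mu (fun x => P x * (f (u s x) - f (W x))) by exact: L1_mulbd mP PS (L1le_L1 fW).
  have fLB xi : `|xi| <= B -> `|f xi| <= Lf q Cf B * `|xi| by exact: f_le.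
  have ifW : L1 mu (fun x => P x * f (W x)).
    apply: (L1_mulbd mP PS); apply: (@L1_dom _ _ _ mu _ (fun x => Lf q Cf B * `|W x|)).
    - exact: (measurable_fcomp mf (L1_measurable iW)).
    - by move=> x; exact: (fLB _ (WB x)).
    - by apply: L1Z; exact: integrable_norm.
  have zf := cv_pker_zero_flux a rho0 fc fLB (Lf_ge0 _ Cf0 _) iu B_ge0 (u_le t0).
  have gP x : cv (pker a r) g x = P x.
    rewrite /P -rr; apply: (cv_assoc r20 eh0 (pker_gker a r0) (gauss_gker n _) _ iu).
    by move=> y; rewrite pker_gauss.
  have -> : \int[mu]_x (g x * F s x) = - \int[mu]_x (P x * (f (u s x) - f (W x))).
    transitivity (\int[mu]_x (cv (pker a r) (fu s) x * g x)); first by apply: eq_Rintegral => x _; rewrite mulrC.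
    rewrite (cv_adjoint (K' := fun z => - pker a r z) r20 (pker_gker a r0) (pkerC a r) ifs ig).
    transitivity (\int[mu]_x (-1 * (P x * (f (u s x) - f (W x)) + P x * f (W x)))).
      apply: eq_Rintegral => x _; rewrite (cvNk _ r20 (pker_gker a r0) ig) gP /fu; ring.
    rewrite (RintegralZl _ measurableT (L1D idf ifW)) (RintegralD measurableT idf ifW).
    by rewrite [X in _ + X](zf) addr0 mulN1r.
  rewrite normrN; apply: Rintegral_L1le; exact: L1le_mulbd.
move: h1 h2; rewrite !ler_norml -/K => /andP[_ h1] /andP[_ h2].
by rewrite lerD// lerD2l ler_wpM2l.
Qed.

Lemma pow_powR (d p : R) m k : 0 <= d -> m%:R * p = k%:R -> (d ^+ m) `^ p = d ^+ k.
Proof. by move=> d0 mp; rewrite -(powR_mulrn m d0) -powRrM mp powR_mulrn. Qed.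

Definition Cstep := 2 * (cP a * (Cu + B) * (Lf q Cf B * (Ctm + 4 * Cu))) + CD * CD.

Lemma Cstep_ge0 : 0 <= Cstep.
Proof.
have h1 : 0 <= cP a * (Cu + B) := mulr_ge0 (cP_ge0 a) (addr_ge0 Cu_ge0 B_ge0).
have h2 : 0 <= Ctm + 4 * Cu by apply: addr_ge0 Ctm_ge0 _; apply: mulr_ge0 Cu_ge0.
have h3 := mulr_ge0 h1 (mulr_ge0 (Lf_ge0 q Cf0 B) h2).
by apply: addr_ge0; [exact: mulr_ge0|rewrite -expr2 sqr_ge0].
Qed.

(* The mollification scale e = d^16, the time step d^18 and the auxiliary scale d^8 make the
   errors of [energy_step] small compared with the time step. *)
Lemma energy_step_pow t d : 1 <= t -> 0 < d -> d <= 1 / 2 ->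
  energy (d ^+ 16) (t + d ^+ 18) <= energy (d ^+ 16 + d ^+ 18) t + Cstep * d * d ^+ 18.
Proof.
move=> t1 d0 d1; have d0' := ltW d0; have d01 : d <= 1 by lra.
have dn m : 0 < d ^+ m by rewrite exprn_gt0.
have dle m k : (k <= m)%N -> d ^+ m <= d ^+ k by move=> km; exact: ler_wiXn2l.
have e18 : d ^+ 16 <= 1 / 8.
  apply: le_trans (dle 16%N 3%N isT) _.
  have : d ^+ 3 <= (1 / 2) ^+ 3 by rewrite lerXn2r// nnegrE; lra.
  by rewrite (_ : (1 / 2) ^+ 3 = 1 / 8 :> R)//; field.
have eta12 : d ^+ 8 <= 1 / 2 by apply: le_trans (dle 8%N 1%N isT) _; rewrite expr1.
apply: le_trans (energy_step t1 (dn 18%N) (dle 18%N 16%N isT) e18 (dn 8%N) eta12) _.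
have p1 : (d ^+ 16) `^ (3 / 8) = d ^+ 6 by apply: pow_powR => //; field.
have p2 : (d ^+ 16) `^ (1 / 2) = d ^+ 8 by apply: pow_powR => //; field.
have p3 : (d ^+ 8) `^ (3 / 8) = d ^+ 3 by apply: pow_powR => //; field.
have p4 : (d ^+ 8) `^ (1 / 2) = d ^+ 4 by apply: pow_powR => //; field.
rewrite -addrA lerD2l /Se !powRN p1 p2 p3 p4.
have e1 : 2 * (cP a * (d ^- 8 * (Cu * d ^+ 3) + d ^- 4 * B) *
      (Lf q Cf B * ((Ctm + 4 * Cu) * d ^+ 6)) * d ^+ 18) =
    2 * (cP a * (Cu + B * d) * (Lf q Cf B * (Ctm + 4 * Cu))) * d * d ^+ 18.
  by move: Cu (Lf q Cf B) Ctm (cP a) => w1 w2 w3 w4; field; rewrite gt_eqF.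
have e2 : CD * d ^- 8 * d ^+ 18 * (CD * d ^- 8 * d ^+ 18) = CD * CD * d * d * d ^+ 18.
  by move: CD => w; field; rewrite gt_eqF.
rewrite e1 e2 -mulrDl ler_wpM2r ?(ltW (dn _))// -mulrDl ler_wpM2r// /Cstep.
apply: lerD.
  rewrite ler_wpM2l// ler_wpM2r//.
    apply: mulr_ge0 (Lf_ge0 _ Cf0 _) _; apply: addr_ge0 Ctm_ge0 _; exact: mulr_ge0 Cu_ge0.
  by rewrite ler_wpM2l ?cP_ge0// lerD2l ler_piMr ?B_ge0.
by rewrite ler_piMr// -expr2 sqr_ge0.
Qed.

Lemma cv_gauss_sqr_integrable r t : 0 < r -> 0 < t ->
  L1le mu (fun x => cv (gauss r) (u t) x ^+ 2) (r `^ (- (n%:R / 2)) * B * B).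
Proof.
move=> r0 t0; have [[mt tB] _] := ub t0.
have bx x : `|cv (gauss r) (u t) x| <= r `^ (- (n%:R / 2)) * B.
  by have := cv_sup1 x r0 (gauss_gker n r) (conj mt tB); rewrite mul1r.
have h1 := cv_L1le r0 (gauss_gker n r) (conj mt tB); rewrite mul1r in h1.
have [mc _] := h1; have := L1le_mulbd mc bx h1.
by under eq_fun do rewrite -expr2.
Qed.

Lemma energy_le r t : 0 < r -> 0 < t -> energy r t <= r `^ (- (n%:R / 2)) * B * B.
Proof.
by move=> r0 t0; apply: le_trans (ler_norm _) _; exact: Rintegral_L1le (cv_gauss_sqr_integrable r0 t0).
Qed.

Lemma energy_ge0 r t : 0 <= energy r t.
Proof. by apply: Rintegral_ge0 => x _; exact: sqr_ge0. Qed.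

(** Self-adjointness of the heat flow makes the pairing of v_r with v_{r+2h} equal to the energy at
    r + h; the inequality of the means then gives midpoint convexity in r. *)
Lemma energy_convex r h t : 0 < r -> 0 < h -> 0 < t ->
  energy (r + h) t - energy (r + h + h) t <= energy r t - energy (r + h) t.
Proof.
move=> r0 h0 t0; have iu := bd_L1 (ub t0); have [M _ uM] := L1_L1le iu.
have rh0 : 0 < r + h by rewrite addr_gt0.
have rhh0 : 0 < r + h + h by rewrite addr_gt0.
pose v s := cv (gauss s) (u t).
have iv s : 0 < s -> L1 mu (v s) by move=> s0; exact: L1le_L1 (cv_L1le s0 (gauss_gker n s) uM).
have i2 s : 0 < s -> L1 mu (fun x => v s x ^+ 2).
  by move=> s0; exact: L1le_L1 (cv_gauss_sqr_integrable s0 t0).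
have vh s x : 0 < s -> cv (gauss h) (v s) x = v (s + h) x.
  move=> s0; apply: (cv_assoc h0 s0 (gauss_gker n _) (gauss_gker n _) _ iu).
  by move=> y; rewrite cv_gauss_gauss// addrC.
have cross : \int[mu]_x (v r x * v (r + h + h) x) = energy (r + h) t.
  transitivity (\int[mu]_x (cv (gauss h) (v r) x * v (r + h) x)).
    transitivity (\int[mu]_x (v r x * cv (gauss h) (v (r + h)) x)); first by apply: eq_Rintegral => x _; rewrite vh.
    apply/esym; apply: (cv_adjoint (K' := gauss h) h0 (gauss_gker n h) _ (iv _ r0) (iv _ rh0)).
    by move=> x y; exact: gaussC.
  by apply: eq_Rintegral => x _; rewrite vh.
have bnd x : `|v r x| <= B.
  by have := cv_sup2 x r0 (gauss_gker n r) (measurable_u t0) (u_le t0) B_ge0; rewrite mul1r.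
have ix : L1 mu (fun x => v r x * v (r + h + h) x).
  exact: (L1_mulbd (L1_measurable (iv _ r0)) bnd (iv _ rhh0)).
have H : 2 * energy (r + h) t <= energy r t + energy (r + h + h) t.
  by rewrite -cross; exact: Rintegral_AMGM (i2 _ r0) ix (i2 _ rhh0).
exact: (second_difference H).
Qed.

Lemma energyE r t : energy r t = \int[mu]_x (cv (gauss r) (u t) x ^+ 2).
Proof. by []. Qed.

Opaque energy.

Lemma energy_drop r h t N : 0 < r -> 0 < h -> 0 < t ->
  energy r t - energy (r + N%:R * h) t <= N%:R * (energy r t - energy (r + h) t).
Proof.
move=> r0 h0 t0; pose phi j := energy (r + j%:R * h) t.
have rj j : 0 < r + j%:R * h by rewrite ltr_wpDr// mulr_ge0// ltW.
have e1 j : r + j.+1%:R * h = r + j%:R * h + h by rewrite -natr1 mulrDl mul1r addrA.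
have C j : phi j.+1 - phi j.+2 <= phi j - phi j.+1.
  by rewrite /phi !e1; exact: energy_convex.
by have := @convex_drop R phi N C; rewrite /phi mul0r addr0 mul1r.
Qed.

Hypothesis n0 : (0 < n)%N.

Lemma energy_small nu e0 : 0 < nu -> 0 < e0 ->
  exists e t, [/\ 0 < e, e <= e0, 1 <= t & energy e t <= nu].
Proof.
move=> nu0 e00; have B0 := B_ge0; have Z0 := Cstep_ge0.
(* L is a smoothing time after which the energy is at most nu / 2, because L^(-n/2) <= L^(-1/2) =
   1/l. *)
pose l := 2 * B * B / nu + 1; have l1 : 1 <= l by rewrite lerDr divr_ge0 ?(ltW nu0)// !mulr_ge0.
have l0 : 0 < l by lra.
pose L := l ^+ 2; have L0 : 0 < L by rewrite exprn_gt0.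
have L1 : 1 <= L by rewrite expr_ge1// ltW.
have LB r : L <= r -> r `^ (- (n%:R / 2)) * B * B <= nu / 2.
  move=> Lr; have h1 : r `^ (- (n%:R / 2)) <= l^-1.
    apply: (@le_trans _ _ (L `^ (- (n%:R / 2)))); first by apply: ge0_ler_powRN; rewrite ?n2_ge0.
    apply: (@le_trans _ _ (L `^ (- (1 / 2)))).
      by apply: ler_powR => //; rewrite lerN2 ler_wpM2r ?invr_ge0// ler1n.
    by rewrite powRN /L (pow_powR (k := 1) (ltW l0)) ?expr1//; field.
  have BB : 0 <= B * B by rewrite mulr_ge0.
  rewrite -mulrA; apply: le_trans (ler_wpM2r BB h1) _.
  rewrite mulrC ler_pdivrMr// /l mulrDr mulr1 -mulrA.
  have -> : nu / 2 * (2 * B * (B / nu)) = B * B by field; rewrite gt_eqF.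
  by rewrite lerDl divr_ge0 ?(ltW nu0).
(* Convexity will give a drop of at least nu h / (4 L) = 2 kap h when the mollification grows by h.
   The step d is so small that the error of [energy_step_pow] consumes at most half of it. *)
pose kap := nu / (8 * L); have kap0 : 0 < kap by rewrite divr_gt0// mulr_gt0.
pose d := Num.min (Num.min (1 / 2) e0) (kap / (Cstep + 1)).
have h12 : 0 < 1 / 2 :> R by rewrite divr_gt0.
have hk : 0 < kap / (Cstep + 1) by apply: divr_gt0 kap0 _; exact: ltr_wpDl.
have d0 : 0 < d by rewrite !lt_min h12 e00 hk.
have d12 : d <= 1 / 2 by rewrite !ge_min lexx.
have de0 : d <= e0 by rewrite !ge_min lexx orbT.
have dk : Cstep * d <= kap.
  have : d <= kap / (Cstep + 1) by rewrite !ge_min lexx !orbT.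
  rewrite ler_pdivlMr ?ltr_wpDl// mulrC => /(le_trans _); apply.
  by rewrite ler_wpM2r ?(ltW d0)// lerDl.
pose e := d ^+ 16; pose h := d ^+ 18.
have e_0 : 0 < e by rewrite exprn_gt0.
have h_0 : 0 < h by rewrite exprn_gt0.
have d1 : d <= 1 by lra.
have ed : e <= e0 by apply: le_trans de0; rewrite -[leRHS]expr1; apply: ler_wiXn2l => //; exact: ltW.
have h1 : h <= 1 by rewrite exprn_ile1// ltW.
(* N increments of length h cover a smoothing time between L and 2 L. *)
pose N := (Num.truncn (L / h)).+1.
have /andP[N0 N1'] : (Num.truncn (L / h))%:R <= L / h < N%:R by rewrite truncn_itv// divr_ge0// ltW.
have N1 : L <= N%:R * h by rewrite -ler_pdivrMr// ltW.
have N2 : N%:R * h <= 2 * L.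
  rewrite /N -natr1 mulrDl mul1r [2 * L]mulr_natl mulr2n; apply: lerD; last exact: le_trans L1.
  by rewrite -ler_pdivlMr.
pose E m := energy e (1 + m%:R * h).
have [//|C] := pselect (exists m, E m <= nu).
  by move=> [m Em]; exists e, (1 + m%:R * h); split => //; rewrite lerDl mulr_ge0// ltW.
have Eg m : nu < E m by rewrite ltNge; apply/negP => Em; apply: C; exists m.
have S m : E m.+1 <= E m - kap * h.
  pose t := 1 + m%:R * h; have t1 : 1 <= t by rewrite lerDl mulr_ge0// ltW.
  have t0 : 0 < t by exact: lt_le_trans t1.
  have tS : 1 + m.+1%:R * h = t + h by rewrite /t -natr1 mulrDl mul1r addrA.
  have s1 := energy_step_pow t1 d0 d12.
  have s2 := energy_drop N e_0 h_0 t0.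
  have s3 : energy (e + N%:R * h) t <= nu / 2.
    have eN : L <= e + N%:R * h by rewrite ler_wpDl// ltW.
    apply: le_trans (energy_le _ t0) (LB _ eN); exact: lt_le_trans eN.
  have s4 := Eg m; rewrite /E -/t in s4.
  have s5 : Cstep * d * h <= kap * h by rewrite ler_wpM2r// ltW.
  have NN : 0 < N%:R :> R by rewrite ltr0n.
  have D : nu / 2 <= N%:R * (energy e t - energy (e + h) t).
    apply: le_trans s2; rewrite lerBrDr; apply: le_trans (lerD (lexx _) s3) _.
    by rewrite -splitr ltW.
  have D2 : 2 * (kap * h) <= energy e t - energy (e + h) t.
    have D0 : 0 <= energy e t - energy (e + h) t.
      by rewrite -(pmulr_rge0 _ NN); apply: le_trans D; rewrite divr_ge0// ltW.
    have : nu / 2 * h <= 2 * L * (energy e t - energy (e + h) t).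
      apply: le_trans (ler_wpM2r D0 N2); rewrite [leRHS]mulrAC.
      exact: (ler_wpM2r (ltW h_0) D).
    rewrite [2 * L * _]mulrC -ler_pdivrMr ?mulr_gt0// => /(le_trans _); apply.
    by rewrite le_eqVlt; apply/orP; left; apply/eqP; rewrite /kap; field; rewrite gt_eqF.
  rewrite /E tS -/t; apply: le_trans s1 _; rewrite -/e -/h.
  move: D2 s5; set x := kap * h; set y := Cstep * d * h; set z := energy e t; set w := energy (e + h) t.
  exact: drop_arith.
have SS m : E m <= E 0%N - m%:R * (kap * h).
  elim: m => [|m IH]; first by rewrite mul0r subr0.
  by rewrite -natr1 mulrDl mul1r opprD addrA; apply: le_trans (S m) _; rewrite lerD2r.
have kh0 : 0 < kap * h by rewrite mulr_gt0.
(* A drop of kap h at every step would make the energy negative after finitely many steps. *)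
have E0 : 0 <= E 0%N by exact: energy_ge0.
have /andP[_ M1] := truncn_itv (divr_ge0 E0 (ltW kh0)).
have := le_trans (energy_ge0 _ _) (SS (Num.truncn (E 0%N / (kap * h))).+1).
by rewrite subr_ge0 leNgt -ltr_pdivrMr// M1.
Qed.

(** The inequality |v| <= l/2 + v^2 / (2 l) is integrated against a kernel of mass one and height at
    most hw r; l stays free to balance the two terms. *)
Lemma cv_gauss_le_energy r e t l x : 0 < r -> 0 < e -> 0 < t -> 0 < l ->
  `|cv (gauss r) (cv (gauss e) (u t)) x| <= l / 2 + hw n r * energy e t / (2 * l).
Proof.
move=> r0 e0 t0 l0; pose v := cv (gauss e) (u t).
have [M _ uM] := L1_L1le (bd_L1 (ub t0)).
have iv : L1 mu v := L1le_L1 (cv_L1le e0 (gauss_gker n e) uM).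
have i2 : L1 mu (fun x => v x ^+ 2) := L1le_L1 (cv_gauss_sqr_integrable e0 t0).
have ig := L1le_L1 (gker_L1le x r0 (gauss_gker n r)).
have i1 := L1_cv_integrand x r0 (gauss_gker n r) iv.
have i3 := L1D (L1Z (l / 2) ig) (L1Z (hw n r / (2 * l)) i2).
apply: le_trans (le_normr_Rintegral measurableT i1) _.
apply: (@le_trans _ _ (\int[mu]_y (l / 2 * gauss r (tsub x y) + hw n r / (2 * l) * v y ^+ 2))).
  apply: le_Rintegral => //; first exact: integrable_norm.
  move=> y _; rewrite normrM (ger0_norm (gauss_ge0 _ _)).
  have g0 := gauss_ge0 r (tsub x y); have gh := gauss_le (tsub x y) r0.
  apply: (@le_trans _ _ (gauss r (tsub x y) * (l / 2 + v y ^+ 2 / (2 * l)))).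
    rewrite ler_wpM2l// -(real_normK (num_real (v y))); move: `|v y| => w.
    rewrite -subr_ge0 (_ : _ - _ = (w - l) ^+ 2 / (2 * l)); last by field; rewrite gt_eqF.
    by rewrite divr_ge0 ?sqr_ge0// mulr_ge0// ltW.
  rewrite mulrDr [gauss _ _ * (l / 2)]mulrC lerD2l [leRHS]mulrAC -[leRHS]mulrA.
  by rewrite ler_wpM2r// divr_ge0 ?sqr_ge0// mulr_ge0// ltW.
rewrite (RintegralD measurableT (L1Z (l / 2) ig) (L1Z (hw n r / (2 * l)) i2)).
rewrite (RintegralZl _ measurableT ig) (RintegralZl _ measurableT i2).
have G1 : \int[mu]_y gauss r (tsub x y) = 1 by rewrite /Rintegral integral_gauss.
by rewrite G1 mulr1 lerD2l -energyE [leRHS]mulrAC.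
Qed.

(** One further step of length h: the heat flow turns small energy into small sup, and the Duhamel
    contribution is of order sqrt h. *)
Lemma u_small m : 0 < m -> exists2 T, 0 < T & {ae mu, forall x, `|u T x| <= m}.
Proof.
move=> m0; have CD0 : 0 <= CD by rewrite /CD mulr_ge0 ?Bf_ge0// mulr_ge0 ?G2_ge0 ?cP_ge0.
pose z := m / (4 * (CD + 1)); have z0 : 0 < z by rewrite divr_gt0// mulr_gt0// ltr_wpDl.
pose h := Num.min 1 (z ^+ 2).
have h0 : 0 < h by rewrite lt_min ltr01 exprn_gt0.
have hz : h `^ (1 / 2) <= z.
  rewrite -[leRHS]expr1 -(pow_powR (p := 1 / 2) (m := 2) (ltW z0)); last by field.
  by apply: ge0_ler_powR; rewrite ?nnegrE ?exprn_ge0 ?(ltW h0) ?(ltW z0)// ge_min lexx orbT.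
have h20 : 0 < h / 2 by rewrite divr_gt0.
have H0 := hw_gt0 n h20.
(* With l = m / 2 this makes each of the two terms of [cv_gauss_le_energy] at most m / 4. *)
pose nu := m ^+ 2 / 4 / hw n (h / 2); have nu0 : 0 < nu by rewrite !divr_gt0// exprn_gt0.
(* The mollification e <= h / 2 leaves a heat time of at least h / 2 for the passage from energy to
   sup. *)
have [e [t [e0 eh t1 Ee]]] := energy_small nu0 h20.
have t0 : 0 < t by exact: lt_le_trans t1.
have tth : t < t + h by rewrite ltrDl.
exists (t + h); first by rewrite addr_gt0.
have D x := (Duh_fu_bde1 (ltW t0) tth (lexx _)).2 x.
move: (restart t0 tth); apply: filterS => x ->.
apply: le_trans (ler_normD _ _) _; rewrite [leRHS](_ : m = m / 2 + m / 2); last by field.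
have th : t + h - t = h by rewrite addrAC subrr add0r.
apply: lerD; last first.
  apply: le_trans (D x) _; rewrite hw1 mulr1 th -/CD.
  apply: (@le_trans _ _ (CD * (2 * z))); first by rewrite ler_wpM2l// ler_wpM2l.
  rewrite /z (_ : CD * _ = CD * m / (2 * (CD + 1))); last by field; rewrite gt_eqF// ltr_wpDl.
  rewrite ler_pdivrMr ?mulr_gt0 ?ltr_wpDl// mulrA divfK// mulrC ler_wpM2l ?(ltW m0)//.
  by rewrite lerDl.
have he0 : 0 < h - e by rewrite subr_gt0 (le_lt_trans eh)// ltr_pdivrMr// mulr_natr mulr2n ltrDl.
have -> : cv (gauss (t + h - t)) (u t) x = cv (gauss (h - e)) (cv (gauss e) (u t)) x.
  rewrite th; apply/esym; apply: (cv_assoc he0 e0 (gauss_gker n _) (gauss_gker n _) _ (bd_L1 (ub t0))).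
  by move=> y; rewrite cv_gauss_gauss// subrK.
have m20 : 0 < m / 2 by rewrite divr_gt0.
apply: le_trans (cv_gauss_le_energy x he0 e0 t0 m20) _.
have hh : hw n (h - e) <= hw n (h / 2).
  by apply: hw_mono => //; rewrite lerBrDr -lerBrDl (_ : h - h / 2 = h / 2)//; field.
have E1 : hw n (h - e) * energy e t <= hw n (h / 2) * nu.
  by apply: ler_pM; rewrite ?hw_ge0 ?energy_ge0.
have E2 : hw n (h / 2) * nu = m ^+ 2 / 4 by rewrite /nu mulrC divfK// gt_eqF.
rewrite -lerBrDl ler_pdivrMr ?mulr_gt0//; apply: le_trans E1 _; rewrite E2.
by rewrite le_eqVlt; apply/orP; left; apply/eqP; field.
Qed.

End mild_solution.

(** * Decay of the solution *)

Section beta_shift.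
Variable R : realType.
Local Notation leb := (@lebesgue_measure R).
Local Notation Rb := (measurableTypeR R).

Lemma ge0_integral_itv_shift (r lo hi : R) (g : R -> R) : measurable_fun `]lo + r, hi + r[ (g : Rb -> R) ->
  (forall s, lo + r < s < hi + r -> 0 <= g s) ->
  (\int[leb]_(s in `](lo + r)%R, (hi + r)%R[) (g s)%:E = \int[leb]_(s in `]lo, hi[) (g (s + r)%R)%:E)%E.
Proof.
move=> mg g0; rewrite integral_mkcond [RHS]integral_mkcond.
have mk : measurable_fun setT ((fun s => (g s)%:E) \_ `]lo + r, hi + r[ : Rb -> \bar R).
  by apply/(measurable_restrictT _ (measurable_itv _)); exact/measurable_EFinP.
rewrite -(ge0_integral_shift r mk).
  apply: eq_integral => s _; rewrite !patchE !mem_setE !in_itv/= !ltrD2.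
  by case: ifP.
by move=> s; rewrite patchE mem_setE in_itv/=; case: ifP => // h; rewrite lee_fin g0.
Qed.

(** The exponents add up to one, so the integral is independent of t - T and the continuation bound
    does not deteriorate with time. *)
Lemma int_beta_half : exists2 C : R, 0 <= C & forall T t, T < t ->
  (\int[leb]_(s in `]T, t[) ((t - s) `^ (- (1 / 2)) * (s - T) `^ (- (1 / 2)))%:E <= C%:E)%E.
Proof.
have [C C0 H] := @int_beta R (1 / 2) ltac:(lra) ltac:(lra).
exists C => // T t Tt; have tT : 0 < t - T by rewrite subr_gt0.
have := H _ tT; rewrite subrr powRr0 mulr1; apply: le_trans.
have -> : `]T, t[%classic = `]0 + T, t - T + T[%classic by rewrite add0r subrK.
rewrite ge0_integral_itv_shift.
- rewrite le_eqVlt; apply/orP; left; apply/eqP; apply: eq_integral => s _.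
  by rewrite addrK opprD addrA addrAC.
- apply: (measurable_funS measurableT (@subsetT _ _)); apply: measurable_funM.
    by apply: (measurableT_comp (measurable_powR (- (1 / 2)))); exact: measurable_funB.
  by apply: (measurableT_comp (measurable_powR (- (1 / 2)))); exact: measurable_funB.
by move=> s _; rewrite mulr_ge0 ?powR_ge0.
Qed.

End beta_shift.

Section decay.
Variables (R : realType) (n : nat) (a : n.-tuple R).
Local Notation V := (n.-tuple R).
Local Notation mu := (lebn R n).
Local Notation leb := (@lebesgue_measure R).
Local Notation Rb := (measurableTypeR R).
Variables (f : R -> R) (q b sigma Cf : R).
Hypotheses (q0 : 0 < q) (qb : n%:R / 2 * q = b) (Cf0 : 0 <= Cf) (f0 : f 0 = 0)
  (mf : measurable_fun setT f)
  (fL : forall xi eta, `|f xi - f eta| <= Cf * (`|xi| `^ q + `|eta| `^ q) * `|xi - eta|)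
  (bs : b = sigma + 1 / 2) (sigma0 : 0 < sigma).
Variables (u : R -> V -> R) (B : R).
Hypotheses (ub : forall t, 0 < t -> bd 1 B (u t))
  (ucoo : forall t0, 0 < t0 -> forall e, 0 < e -> exists2 d, 0 < d & forall t, 0 < t -> `|t - t0| < d ->
     {ae mu, forall x, `|u t x - u t0 x| <= e})
  (restart : forall T t, 0 < T -> T < t ->
    {ae mu, forall x, u t x = cv (gauss (t - T)) (u T) x + Duh a `]T, t[%classic t (fu f u) x})
  (fu_jm : forall lo hi t, 0 <= lo -> lo < hi -> hi <= t -> jmD a `]lo, hi[%classic t (fu f u))
  (small : forall m, 0 < m -> exists2 T, 0 < T & {ae mu, forall x, `|u T x| <= m}).
Implicit Types (s t T L M : R).

(** The power b = sigma + 1/2 of the age L + (s - T) is shared out: sigma goes to L and gives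
    smallness, 1/2 goes to s - T and is integrable. *)
Lemma kernel_decay L T s M : 0 < L -> T < s -> 0 <= M ->
  Lfb q b Cf M (s + (L - T)) * M <= Lf q Cf M * M * L `^ (- sigma) * (s - T) `^ (- (1 / 2)).
Proof.
move=> L0 Ts M0; have sT : 0 < s - T by rewrite subr_gt0.
have e : s + (L - T) = L + (s - T) by ring.
rewrite /Lfb mulrAC -[leRHS]mulrA ler_wpM2l//; first by rewrite mulr_ge0// Lf_ge0.
have p0 : 0 < L + (s - T) by exact: addr_gt0.
have h0 : 0 <= 1 / 2 :> R by rewrite divr_ge0.
rewrite e bs opprD powRD ?(gt_eqF p0) ?implybT//.
apply: ler_pM; rewrite ?powR_ge0//.
  by apply: (ge0_ler_powRN L0 _ (ltW sigma0)); rewrite lerDl ltW.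
by apply: (ge0_ler_powRN sT _ h0); rewrite lerDr ltW.
Qed.

Lemma bootstrap : exists2 K, 0 <= K & forall L T t M, 0 < L -> 0 < T -> T < t -> 0 <= M ->
  (forall s, T < s -> s < t -> bd (s + (L - T)) M (u s)) ->
  bde (t + (L - T)) (K * (Lf q Cf M * M * L `^ (- sigma))) (Duh a `]T, t[%classic t (fu f u)).
Proof.
have [C C0 HC] := @int_beta_half R.
exists (G2 R n * cP a * C); first by rewrite mulr_ge0// mulr_ge0 ?G2_ge0 ?cP_ge0.
move=> L T t M L0 T0 Tt M0 uM.
pose C1 := Lf q Cf M * M * L `^ (- sigma).
have C10 : 0 <= C1 by rewrite mulr_ge0 ?powR_ge0// mulr_ge0// Lf_ge0.
have mk : measurable_fun `]T, t[ ((fun s => C1 * (s - T) `^ (- (1 / 2))) : Rb -> R).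
  by apply: measurable_funM => //; exact: measurable_powR_subr.
have mb : measurable_fun `]T, t[ ((fun s => (t - s) `^ (- (1 / 2)) * (s - T) `^ (- (1 / 2))) : Rb -> R).
  by apply: measurable_funM; [exact: measurable_powR_subl|exact: measurable_powR_subr].
have Tb : tbd `]T, t[%classic t (fun s => C1 * (s - T) `^ (- (1 / 2))) (C1 * C).
  split => //.
  - by move=> s; rewrite /= in_itv/= => /andP[].
  - by move=> s _; rewrite mulr_ge0 ?powR_ge0.
  under eq_integral do rewrite mulrCA.
  apply: int_scale_le => //; [by move=> s _; rewrite mulr_ge0 ?powR_ge0|exact: HC].
have := @Duh_bde _ _ a _ t (fu f u) _ _ (L - T) Tb (fu_jm (ltW T0) Tt (lexx t)).
rewrite -/C1 -[_ * C * C1]mulrA [C * C1]mulrC; apply.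
- by move=> s; rewrite /= in_itv/= => /andP[Ts st]; lra.
move=> s; rewrite /= in_itv/= => /andP[Ts st].
apply: bd_weak (kernel_decay L0 Ts M0) _.
exact: f_bd1 (uM s Ts st).
Qed.

Lemma hw_continuous (p e : R) : 0 < p -> 0 < e ->
  exists2 d, 0 < d & forall r, `|r - p| < d -> `|hw n r - hw n p| < e.
Proof.
move=> p0 e0; have := continuous_powRx (b := - (n%:R / 2)) p0.
move/cvgrPdist_lt => /(_ e e0) /nbhs_ballP[d /= d0 H]; exists d => // r rp.
by rewrite distrC; apply: H; rewrite /ball/= distrC.
Qed.

Lemma u_decay : exists2 M, 0 <= M & forall t, 0 < t -> bd (1 + t) M (u t).
Proof.
have [K K0 boot] := bootstrap.
have B0 : 0 <= B := bd_ge0 (ub ltr01).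
have G1 := G2_ge1 R n.
pose B1 := B + 1; have B10 : 0 < B1 by rewrite ltr_wpDl.
(* Twice the contribution of the heat flow of u(T), which is at most [G2] times [B1] by [cv_bde]. *)
pose M := 2 * (G2 R n * B1).
have MB : 2 * B1 <= M by rewrite /M ler_wpM2l// ler_peMl// ltW.
have BM : B <= M by apply: le_trans MB; rewrite /B1; lra.
have M0 : 0 < M by apply: lt_le_trans MB; rewrite mulr_gt0.
(* X will be L^sigma, which brings the Duhamel contribution down to M / 4. With M / 2 from the heat
   flow, a margin of M / 4 is left. *)
pose X := 4 * (K * Lf q Cf M + 1).
have KL : 0 <= K * Lf q Cf M by rewrite mulr_ge0// Lf_ge0.
have X1 : 1 <= X by rewrite /X; lra.
have X0 : 0 < X by exact: lt_le_trans X1.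
pose L := X `^ sigma^-1.
have L1 : 1 <= L by rewrite ge1_powR// invr_ge0 ltW.
have L0 : 0 < L by exact: lt_le_trans L1.
have LX : L `^ (- sigma) = X^-1.
  by rewrite /L -powRrM mulrN mulVf ?gt_eqF// powR_inv1// ltW.
have small_term : K * (Lf q Cf M * M * L `^ (- sigma)) <= M / 4.
  rewrite LX [leLHS](_ : _ = M * (K * Lf q Cf M) / X); last by ring.
  rewrite ler_pdivrMr// [leRHS](_ : _ = M * (K * Lf q Cf M + 1)); last by rewrite /X; field.
  by rewrite ler_wpM2l ?(ltW M0)// lerDl.
(* T is found after L, and L does not depend on T. At this T the solution satisfies the bounds of a
   flow of age L. *)
have [T T0 uT] := small (mulr_gt0 B10 (hw_gt0 n L0)).
have bT : bd L B1 (u T).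
  by split => //; have [h _] := ub T0; apply: L1le_weak h; rewrite lerDl.
have step t : T < t -> (forall s, T < s -> s < t -> bd (s + (L - T)) M (u s)) ->
    bd (t + (L - T)) (3 / 4 * M) (u t).
  move=> Tt us; have t0 : 0 < t by exact: lt_trans Tt.
  have tT : 0 < t - T by rewrite subr_gt0.
  have tL0 : 0 < t + (L - T) by lra.
  have h12 : t + (L - T) <= 2 * (t - T) \/ t + (L - T) <= 2 * L.
    by have [h|h] := leP L (t - T); [left|right]; lra.
  have h1 := bde_bd (cv_bde tT L0 tL0 h12 (gauss_gker n (t - T)) bT).
  have h2 := bde_bd (bde_weak small_term (boot L T t M L0 T0 Tt (ltW M0) us)).
  have := bdD h1 h2; rewrite (_ : G2 R n * 1 * B1 + M / 4 = 3 / 4 * M); last by rewrite /M; field.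
  apply: bd_ae; first by case: (ub t0) => -[].
  by move: (restart T0 Tt); apply: filterS => x ->.
have all t : T <= t -> bd (t + (L - T)) M (u t).
  move=> Tt; apply: contrapT => nt.
  (* At the infimum of the failing times the bound holds with 3/4 M. Continuity of u in sup norm and
     of the weight then gives it with M slightly beyond, contrary to the choice of the infimum. The
     L^1 half holds at all times by [BM]. *)
  pose S := [set s | T <= s /\ ~ bd (s + (L - T)) M (u s)].
  have S0 : S !=set0 by exists t.
  have Sl : has_lbound S by exists T => s [].
  pose ts := inf S; have Tts : T <= ts by apply: lb_le_inf => // s [].
  have before s : T < s -> s < ts -> bd (s + (L - T)) M (u s).
    move=> Ts sts; apply: contrapT => ns.
    by have := ge_inf Sl (conj (ltW Ts) ns); rewrite leNgt sts.
  have ts0 : 0 < ts by exact: lt_le_trans Tts.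
  have p0 : 0 < ts + (L - T) by lra.
  have bts : bd (ts + (L - T)) (3 / 4 * M) (u ts).
    move: Tts; rewrite le_eqVlt => /orP[/eqP <-|Tts]; last exact: step.
    by rewrite addrC subrK; apply: bd_weak bT; lra.
  have w0 := hw_gt0 n p0.
  have e0 : 0 < M * hw n (ts + (L - T)) / 8 by rewrite divr_gt0// mulr_gt0.
  have e1 : 0 < hw n (ts + (L - T)) / 8 by rewrite divr_gt0.
  have [d1 d10 hd1] := hw_continuous p0 e1.
  have [d2 d20 hd2] := ucoo ts0 e0.
  have d0 : 0 < Num.min d1 d2 by rewrite lt_min d10.
  have [s [Ts ns]] := inf_adherent d0 (conj S0 Sl); rewrite -/ts => sd.
  have tss : ts <= s by exact: ge_inf.
  have s0 : 0 < s by exact: lt_le_trans tss.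
  have : `|s - ts| < Num.min d1 d2 by rewrite ger0_norm ?subr_ge0// ltrBlDl.
  rewrite lt_min => /andP[sd1 sd2].
  apply: ns; split; first by have [h _] := ub s0; exact: L1le_weak h.
  have [_ uts] := bts; move: uts (hd2 s s0 sd2); apply: filterS2 => x h1 h2.
  have h3 : `|s + (L - T) - (ts + (L - T))| < d1 by rewrite opprD addrACA subrr addr0.
  have := hd1 _ h3; rewrite ltr_norml => /andP[h4 _].
  move: w0 e0 h4 h1 h2; set w := hw n (ts + (L - T)); set w' := hw n (s + (L - T)) => w0 e0 h4 h1 h2.
  have h5 : 7 / 8 * w <= w' by lra.
  have h6 : M * (7 / 8 * w) <= M * w' by rewrite ler_wpM2l// ltW.
  have := ler_normD (u s x - u ts x) (u ts x); rewrite subrK => h7.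
  apply: le_trans h7 _; apply: le_trans (lerD h2 h1) _; apply: le_trans h6.
  by rewrite le_eqVlt; apply/orP; left; apply/eqP; field.
(* The age t + (L - T) is exchanged for 1 + t, and the times up to T are covered by the uniform
   bound. *)
exists ((1 + T) `^ (n%:R / 2) * (M + B)); first by rewrite mulr_ge0 ?powR_ge0// addr_ge0// ltW.
move=> t t0; have c1 : 1 <= 1 + T by rewrite lerDl ltW.
have t10 : 0 < 1 + t by rewrite addr_gt0.
have [tT|Tt] := leP t T.
  apply: (bd_time t10 ltr01 c1); first by rewrite mulr1 lerD2l.
  by apply: bd_weak (ub t0); rewrite lerDr ltW.
have p0 : 0 < t + (L - T) by lra.
apply: (bd_time t10 p0 c1).
  rewrite mulrDl mul1r; have : T * 1 <= T * (t + (L - T)) by rewrite ler_wpM2l ?(ltW T0)//; lra.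
  by rewrite mulr1 => ?; lra.
by apply: bd_weak (all t (ltW Tt)); rewrite lerDl.
Qed.

End decay.

(** * Asymptotic profiles *)

Section asymptotic_profiles.
Variables (R : realType) (n : nat) (a : n.-tuple R).
Local Notation V := (n.-tuple R).
Local Notation mu := (lebn R n).
Local Notation leb := (@lebesgue_measure R).
Local Notation Rb := (measurableTypeR R).
Variables (f : R -> R) (q b sigma Cf : R).
Hypotheses (q0 : 0 < q) (qb : n%:R / 2 * q = b) (Cf0 : 0 <= Cf) (f0 : f 0 = 0)
  (mf : measurable_fun setT f)
  (fL : forall xi eta, `|f xi - f eta| <= Cf * (`|xi| `^ q + `|eta| `^ q) * `|xi - eta|)
  (bs : b = sigma + 1 / 2) (sigma0 : 0 < sigma) (sigma1 : sigma < 1 / 2).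
Variable m : R.
Implicit Types (s t T L M : R).

Definition fA0 s (y : V) : R := f (m * gauss s y).

(** The profiles [A0k] with the mass as a parameter and Duhamel integrals over open intervals;
    [A0kE] identifies the two for t > 1. *)
Fixpoint Ak (k : nat) : R -> V -> R :=
  match k with
  | 0 => fun t x => m * gauss t x
  | k'.+1 => fun t x => m * gauss t x + Duh a `]0, 1[%classic t fA0 x
                        + Duh a `]1, t[%classic t (fun s y => f (Ak k' s y)) x
  end.

Definition fAk k s (y : V) : R := f (Ak k s y).

Lemma jm_f (D : set Rb) (F : R -> V -> R) : jm D F -> jm D (fun s y => f (F s y)).
Proof.
move=> mF; rewrite /jm (_ : ext D _ = f \o ext D F); first exact: measurableT_comp.
by apply/funext => z; rewrite /ext/=; case: ifP.
Qed.

Lemma jm_setT (D : set Rb) (F : R -> V -> R) : measurable D ->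
  measurable_fun setT (fun w : Rb * V => F w.1 w.2) -> jm D F.
Proof.
by move=> mD mF; apply: measurable_fun_ifT => //; apply: measurable_mem => //; exact: measurable_fst.
Qed.

Lemma measurable_A0 : measurable_fun setT (fun w : Rb * V => m * gauss w.1 w.2).
Proof.
apply: measurable_funM => //; apply: measurable_gauss; [exact: measurable_fst|exact: measurable_snd].
Qed.

Lemma jm_fA0 (D : set Rb) : measurable D -> jm D fA0.
Proof.
by move=> mD; apply: jm_f; apply: (@jm_setT _ (fun s y => m * gauss s y)) => //; exact: measurable_A0.
Qed.

Lemma jm_ext (D : set Rb) (F : R -> V -> R) (G : Rb * V -> R) : measurable D -> measurable_fun setT G ->
  (forall s x, D s -> F s x = G (s, x)) -> jm D F.
Proof.
move=> mD mG FG; apply: (@eq_jm _ _ _ (fun s x => G (s, x))); first by move=> s x /FG.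
by apply: jm_setT => //; apply: (eq_measurable_fun G) => // -[s x] _.
Qed.

(** Joint measurability follows the recursion, with the moving end point treated by [jm_duhamel].
    For s > 1 the condition r < s does not cut (0, 1) and cuts (1, oo) to (1, s). *)
Lemma jm_Ak k : jm `]1, +oo[ (Ak k).
Proof.
have mD : measurable (`]1, +oo[%classic : set Rb) by exact: measurable_itv.
have mI : measurable (`]0, 1[%classic : set Rb) by exact: measurable_itv.
elim: k => [|k IH]; first by apply: (@jm_setT _ (fun s y => m * gauss s y)) => //; exact: measurable_A0.
pose G (w : Rb * V) := m * gauss w.1 w.2
  + tint (`]0, 1[%classic `&` [set r | r < w.1]) (fun r => cv (pker a (w.1 - r)) (fA0 r)) w.2
  + tint (`]1, +oo[%classic `&` [set r | r < w.1]) (fun r => cv (pker a (w.1 - r)) (fAk k r)) w.2.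
apply: (@jm_ext _ _ G) => //.
  apply: measurable_funD; first apply: measurable_funD.
  - exact: measurable_A0.
  - exact: (jm_duhamel a (jm_fA0 mI)).
  - exact: (jm_duhamel a (jm_f IH)).
move=> s x; rewrite /= in_itv/= andbT => s1; rewrite /G /Duh /=.
have -> : `]0, 1[%classic `&` [set r | r < s] = `]0, 1[%classic.
  by apply/seteqP; split => [r []//|r] /=; rewrite in_itv/= => /andP[r0 r1]; rewrite r0 r1 (lt_trans r1).
have -> // : `]1, +oo[%classic `&` [set r | r < s] = `]1, s[%classic.
by apply/seteqP; split => r /=; rewrite !in_itv/= andbT; [move=> [-> ->]|move=> /andP[-> ->]].
Qed.

Lemma jmD_fAk k t : jmD a `]1, t[%classic t (fAk k).
Proof.
apply: jm_cv; apply: jm_f; apply: (jm_sub _ _ (jm_Ak k)); first exact: measurable_itv.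
by move=> s /=; rewrite !in_itv/= => /andP[-> _].
Qed.

Lemma measurable_Ak k t : 1 < t -> measurable_fun setT (Ak k t).
Proof. by move=> t1; apply: jm_measurable (jm_Ak k); rewrite /= in_itv/= t1. Qed.

Lemma b_ge0 : 0 <= b. Proof. by rewrite bs addr_ge0 ?divr_ge0// ltW. Qed.

Lemma b_lt1 : b < 1.
Proof. by rewrite bs (lt_le_trans (y := 1 / 2 + 1 / 2)) ?ltrD2r// -splitr. Qed.

(** For t > 1 and s < 1 one has t (1 - s) <= t - s. So t^(-1/2) factors out and the beta integral at
    time 1 remains. *)
Lemma tbd_head : exists2 C, 0 <= C & forall t c, 1 < t -> 0 <= c ->
  tbd `]0, 1[%classic t (fun s => c * s `^ (- b)) (C * c * t `^ (- (1 / 2))).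
Proof.
have [C C0 H] := @int_beta R b b_ge0 b_lt1.
exists C => // t c t1 c0; have t0 : 0 < t by exact: lt_trans t1.
have mI : measurable (`]0, 1[%classic : set Rb) by exact: measurable_itv.
split => //.
- by move=> s; rewrite /= in_itv/= => /andP[_ s1]; exact: lt_trans s1 t1.
- by apply: measurable_funM => //; exact: measurable_powRN.
- by move=> s _; rewrite mulr_ge0 ?powR_ge0.
have k0 : 0 <= c * t `^ (- (1 / 2)) by rewrite mulr_ge0 ?powR_ge0.
have H1 := H 1 ltr01; rewrite powR1 mulr1 in H1.
have := int_scale_le mI (@measurable_beta R b 0 1) (fun s _ => mulr_ge0 (powR_ge0 _ _) (powR_ge0 _ _)) k0 H1.
rewrite (_ : c * _ * C = C * c * t `^ (- (1 / 2))); last by ring.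
apply: le_trans; apply: ge0_le_integral => //.
- by move=> s _; rewrite lee_fin !mulr_ge0 ?powR_ge0.
- apply/measurable_EFinP; apply: measurable_funM; last by apply: measurable_funM => //; exact: measurable_powRN.
  exact: measurable_powR_subl.
- by apply/measurable_EFinP; apply: measurable_funM => //; exact: measurable_beta.
move=> s; rewrite /= in_itv/= => /andP[s0 s1]; rewrite lee_fin.
have s10 : 0 < 1 - s by rewrite subr_gt0.
rewrite mulrCA [leRHS](_ : _ = c * ((t * (1 - s)) `^ (- (1 / 2)) * s `^ (- b))).
  rewrite ler_wpM2l// ler_wpM2r ?powR_ge0//; apply: ge0_ler_powRN; rewrite ?mulr_gt0 ?divr_ge0//.
  by rewrite mulrBr mulr1 lerD2l lerN2 ler_peMl// ltW.
by rewrite powRM ?(ltW t0) ?(ltW s10)//; ring.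
Qed.

(** The integral from 1 is bounded by the one from 0, which scales exactly. At be = b the power 1/2
    - b is the gain of -sigma. *)
Lemma tbd_tail be : 0 <= be -> be < 1 -> exists2 C, 0 <= C & forall t c, 1 < t -> 0 <= c ->
  tbd `]1, t[%classic t (fun s => c * s `^ (- be)) (C * c * t `^ (1 / 2 - be)).
Proof.
move=> be0 be1; have [C C0 H] := @int_beta R be be0 be1.
exists C => // t c t1 c0; have t0 : 0 < t by lra.
have mI : measurable (`]1, t[%classic : set Rb) by exact: measurable_itv.
have mI0 : measurable (`]0, t[%classic : set Rb) by exact: measurable_itv.
split => //.
- by move=> s; rewrite /= in_itv/= => /andP[].
- by apply: measurable_funM => //; exact: measurable_powRN.
- by move=> s _; rewrite mulr_ge0 ?powR_ge0.
under eq_integral do rewrite mulrCA.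
rewrite (_ : C * c * _ = c * (C * t `^ (1 / 2 - be))); last by ring.
apply: int_scale_le => //; first exact: measurable_beta.
  by move=> s _; rewrite mulr_ge0 ?powR_ge0.
apply: le_trans (H t t0); apply: ge0_subset_integral => //.
- by apply/measurable_EFinP; exact: measurable_beta.
- by move=> s _; rewrite lee_fin mulr_ge0 ?powR_ge0.
by apply: subset_itvr; rewrite bnd_simp.
Qed.

Lemma tbd_tail1 de : 0 < de -> exists2 C, 0 <= C & forall t c, 1 < t -> 0 <= c ->
  tbd `]1, t[%classic t (fun s => c * s `^ (- (1 + de))) (C * c * t `^ (- (1 / 2))).
Proof.
move=> de0; have [C C0 H] := @int_beta_tail R de de0.
exists C => // t c t1 c0.
have mI : measurable (`]1, t[%classic : set Rb) by exact: measurable_itv.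
split => //.
- by move=> s; rewrite /= in_itv/= => /andP[].
- by apply: measurable_funM => //; exact: measurable_powRN.
- by move=> s _; rewrite mulr_ge0 ?powR_ge0.
under eq_integral do rewrite mulrCA.
rewrite (_ : C * c * _ = c * (C * t `^ (- (1 / 2)))); last by ring.
apply: int_scale_le => //; [exact: measurable_beta| |exact: H].
by move=> s _; rewrite mulr_ge0 ?powR_ge0.
Qed.

Lemma gauss_hw s (y : V) : 0 < s -> gauss (2 * s) y <= hw n s.
Proof.
move=> s0; have s20 : 0 < 2 * s by rewrite mulr_gt0.
by apply: le_trans (gauss_le y s20) _; apply: hw_mono => //; rewrite ler_peMl ?(ltW s0)// ler1n.
Qed.

Lemma gauss_double s (y : V) : 0 < s -> gauss s y <= G2 R n * gauss (2 * s) y.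
Proof. by move=> s0; apply: gauss_mono => //; lra. Qed.

Lemma gauss_bd_hw M s (v : R) (y : V) : 0 < s -> 0 <= M -> `|v| <= M * gauss (2 * s) y -> `|v| <= M * hw n s.
Proof. by move=> s0 M0 /le_trans; apply; rewrite ler_wpM2l// gauss_hw. Qed.

Lemma A0_gauss s (y : V) : 0 < s -> `|m * gauss s y| <= `|m| * G2 R n * gauss (2 * s) y.
Proof.
by move=> s0; rewrite normrM (ger0_norm (gauss_ge0 _ _)) -mulrA ler_wpM2l// gauss_double.
Qed.

Definition cA0 := Lf q Cf (`|m| * G2 R n) * (`|m| * G2 R n).

Lemma mG_ge0 : 0 <= `|m| * G2 R n.
Proof. by rewrite mulr_ge0 ?G2_ge0. Qed.

Lemma cA0_ge0 : 0 <= cA0.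
Proof. by rewrite /cA0 mulr_ge0 ?Lf_ge0 ?mG_ge0. Qed.

Lemma fA0_gauss s y : 0 < s -> `|fA0 s y| <= cA0 * s `^ (- b) * gauss (2 * s) y.
Proof.
move=> s0; have h := A0_gauss y s0.
have := f_gauss1 (v := fun y => m * gauss s y) q0 qb Cf0 f0 fL mG_ge0 (gauss_bd_hw s0 mG_ge0 h) h.
by rewrite /Lfb -/(fA0 s y) [Lf _ _ _ * _ * _]mulrAC.
Qed.

Lemma measurable_fA0 s : measurable_fun setT (fA0 s).
Proof.
apply: measurable_fcomp => //; apply: measurable_funM => //.
exact: (measurable_gaussr s (@measurable_id _ _ setT)).
Qed.

Lemma tail_exp be t : 1 < t -> 0 <= be -> t `^ (- be) <= 1.
Proof. by move=> t1 be0; rewrite -(powRr0 t); apply: ler_powR; [exact: ltW|rewrite oppr_le0]. Qed.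

Lemma head_gauss : exists2 C, 0 <= C & forall t x, 1 < t ->
  `|Duh a `]0, 1[%classic t fA0 x| <= C * t `^ (- (1 / 2)) * gauss (2 * t) x.
Proof.
have [C C0 H] := tbd_head; exists (cP a * (C * cA0)).
  by rewrite mulr_ge0 ?cP_ge0// mulr_ge0// cA0_ge0.
move=> t x t1; rewrite -[cP a * _ * _]mulrA.
apply: (Duh_gauss _ (H t cA0 t1 cA0_ge0)).
- by apply: jm_cv; apply: jm_fA0; exact: measurable_itv.
- by move=> s; rewrite /= in_itv/= => /andP[].
- by move=> s _; exact: measurable_fA0.
- by move=> s y; rewrite /= in_itv/= => /andP[s0 _]; exact: fA0_gauss.
Qed.

Lemma fAk_gauss k C s y : 0 <= C -> 1 < s -> `|Ak k s y| <= C * gauss (2 * s) y ->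
  `|fAk k s y| <= Lf q Cf C * C * s `^ (- b) * gauss (2 * s) y.
Proof.
move=> C0 s1 h; have s0 : 0 < s by exact: lt_trans s1.
have := f_gauss1 (v := Ak k s) q0 qb Cf0 f0 fL C0 (gauss_bd_hw s0 C0 h) h.
by rewrite /Lfb -/(fAk k s y) [Lf _ _ _ * _ * _]mulrAC.
Qed.

Lemma measurable_fAk k s : 1 < s -> measurable_fun setT (fAk k s).
Proof. by move=> s1; apply: measurable_fcomp => //; exact: measurable_Ak. Qed.

Lemma tail_gauss k C : 0 <= C -> (forall t x, 1 < t -> `|Ak k t x| <= C * gauss (2 * t) x) ->
  exists2 C', 0 <= C' & forall t x, 1 < t ->
    `|Duh a `]1, t[%classic t (fAk k) x| <= C' * t `^ (- sigma) * gauss (2 * t) x.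
Proof.
move=> C0 AC; have [C1 C10 H] := tbd_tail b_ge0 b_lt1.
have c0 : 0 <= Lf q Cf C * C by rewrite mulr_ge0// Lf_ge0.
exists (cP a * (C1 * (Lf q Cf C * C))); first by rewrite mulr_ge0 ?cP_ge0// mulr_ge0.
move=> t x t1; rewrite -[cP a * _ * _]mulrA.
have := H t _ t1 c0; rewrite (_ : 1 / 2 - b = - sigma); last by rewrite bs; ring.
move=> T; apply: (Duh_gauss _ T).
- exact: jmD_fAk.
- by move=> s; rewrite /= in_itv/= => /andP[s1 _]; exact: lt_trans s1.
- by move=> s; rewrite /= in_itv/= => /andP[s1 _]; exact: measurable_fAk.
- by move=> s y; rewrite /= in_itv/= => /andP[s1 _]; apply: fAk_gauss => //; exact: AC.
Qed.

Lemma Ak_gauss k : exists2 C, 0 <= C & forall t x, 1 < t -> `|Ak k t x| <= C * gauss (2 * t) x.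
Proof.
elim: k => [|k [C C0 AC]].
  exists (`|m| * G2 R n); first exact: mG_ge0.
  by move=> t x t1; apply: A0_gauss; exact: lt_trans t1.
have [C1 C10 H1] := head_gauss; have [C2 C20 H2] := tail_gauss C0 AC.
exists (`|m| * G2 R n + C1 + C2); first by rewrite !addr_ge0 ?mG_ge0.
move=> t x t1; have t0 : 0 < t by exact: lt_trans t1.
have g0 := gauss_ge0 (2 * t) x.
rewrite /= [leRHS]mulrDl; apply: le_trans (ler_normD _ _) _; apply: lerD.
  rewrite [leRHS]mulrDl; apply: le_trans (ler_normD _ _) _; apply: lerD; first exact: A0_gauss.
  apply: le_trans (H1 t x t1) _; rewrite ler_wpM2r// ler_piMr//.
  by apply: tail_exp => //; rewrite divr_ge0.
apply: le_trans (H2 t x t1) _; rewrite ler_wpM2r// ler_piMr//.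
by apply: tail_exp => //; exact: ltW.
Qed.

(** * Differences of consecutive profiles *)

Definition psi k s (y : V) : R := fAk k.+1 s y - fAk k s y.
Definition Mpsi k s : R := \int[mu]_y psi k s y.

Lemma jm_fAk k t : jm `]1, t[ (fAk k).
Proof.
apply: jm_f; apply: (jm_sub _ _ (jm_Ak k)); first exact: measurable_itv.
by move=> s /=; rewrite !in_itv/= => /andP[-> _].
Qed.

Lemma jm_psi k t : jm `]1, t[ (psi k).
Proof. by apply: jmB; exact: jm_fAk. Qed.

Lemma measurable_psi k s : 1 < s -> measurable_fun setT (psi k s).
Proof. by move=> s1; apply: measurable_funB; exact: measurable_fAk. Qed.

Lemma Duh_fAk_diff k t x : 1 < t ->
  Duh a `]1, t[%classic t (fAk k.+1) x - Duh a `]1, t[%classic t (fAk k) x = Duh a `]1, t[%classic t (psi k) x.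
Proof.
move=> t1; have [C1 C10 H1] := Ak_gauss k; have [C2 C20 H2] := Ak_gauss k.+1.
have C120 : 0 <= C1 + C2 by rewrite addr_ge0.
have [C4 C40 H4] := tbd_tail b_ge0 b_lt1.
pose c := Lf q Cf (C1 + C2) * (C1 + C2); have c0 : 0 <= c by rewrite mulr_ge0// Lf_ge0.
have w1 s y : 1 < s -> `|Ak k s y| <= (C1 + C2) * gauss (2 * s) y.
  by move=> s1; apply: le_trans (H1 s y s1) _; rewrite ler_wpM2r ?gauss_ge0// lerDl.
have w2 s y : 1 < s -> `|Ak k.+1 s y| <= (C1 + C2) * gauss (2 * s) y.
  by move=> s1; apply: le_trans (H2 s y s1) _; rewrite ler_wpM2r ?gauss_ge0// lerDr.
have D0 s : `]1, t[%classic s -> 0 < s.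
  by rewrite /= in_itv/= => /andP[s1 _]; exact: lt_trans s1.
have Dm i s : `]1, t[%classic s -> measurable_fun setT (fAk i s).
  by rewrite /= in_itv/= => /andP[s1 _]; exact: measurable_fAk.
apply/esym; apply: (DuhB_gauss x (H4 t c t1 c0) (jmD_fAk k.+1 t) (jmD_fAk k t) D0 (Dm _) (Dm _)).
- by move=> s y; rewrite /= in_itv/= => /andP[s1 _]; apply: fAk_gauss => //; exact: w2.
- by move=> s y; rewrite /= in_itv/= => /andP[s1 _]; apply: fAk_gauss => //; exact: w1.
Qed.

(** A_1 - A_0 consists of both Duhamel integrals. Later differences consist of the tail only, since
    the part over (0, 1) is common to all profiles with positive index. Each tail gains t^(-sigma)
    while the exponent b + (j + 1) sigma of its source stays below 1. *)
Lemma Ak_diff j : j.+1%:R * sigma < 1 / 2 -> exists2 C, 0 <= C &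
  forall t x, 1 < t -> `|Ak j.+1 t x - Ak j t x| <= C * t `^ (- (j.+1%:R * sigma)) * gauss (2 * t) x.
Proof.
elim: j => [|j IH] js.
  have [C0 C00 H0] := Ak_gauss 0.
  have [C1 C10 H1] := head_gauss; have [C2 C20 H2] := tail_gauss C00 H0.
  exists (C1 + C2); first by rewrite addr_ge0.
  move=> t x t1.
  have -> : Ak 1 t x - Ak 0 t x = Duh a `]0, 1[%classic t fA0 x + Duh a `]1, t[%classic t (fAk 0) x.
    have e (x1 x2 x3 : R) : x1 + x2 + x3 - x1 = x2 + x3 by ring.
    exact: e.
  rewrite mul1r [(C1 + C2) * _]mulrDl [leRHS]mulrDl.
  apply: le_trans (ler_normD _ _) _; apply: lerD; last exact: H2.
  apply: le_trans (H1 t x t1) _; rewrite ler_wpM2r ?gauss_ge0// ler_wpM2l//.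
  by apply: ler_powR; [exact: ltW|rewrite lerN2 ltW].
have js' : j.+1%:R * sigma < 1 / 2.
  by apply: le_lt_trans js; rewrite ler_wpM2r ?(ltW sigma0)// ler_nat.
have [C C0 H] := IH js'.
have [C1 C10 H1] := Ak_gauss j; have [C2 C20 H2] := Ak_gauss j.+1.
have C120 : 0 <= C1 + C2 by rewrite addr_ge0.
pose be := b + j.+1%:R * sigma.
have be0 : 0 <= be by rewrite addr_ge0 ?b_ge0// mulr_ge0// ltW.
have ebe : 1 / 2 - be = - (j.+2%:R * sigma) by rewrite /be bs -[j.+2%:R]natr1; ring.
have be1 : be < 1.
  have -> : be = 1 / 2 + j.+2%:R * sigma by rewrite /be bs -[j.+2%:R]natr1; ring.
  by rewrite (lt_le_trans (y := 1 / 2 + 1 / 2)) ?ltrD2l// -splitr.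
have [C3 C30 H3] := tbd_tail be0 be1.
pose d := Lf q Cf (C1 + C2) * C; have d0 : 0 <= d by rewrite mulr_ge0// Lf_ge0.
exists (cP a * (C3 * d)); first by rewrite mulr_ge0 ?cP_ge0// mulr_ge0.
move=> t x t1.
have w1 s y : 1 < s -> `|Ak j s y| <= (C1 + C2) * gauss (2 * s) y.
  by move=> s1; apply: le_trans (H1 s y s1) _; rewrite ler_wpM2r ?gauss_ge0// lerDl.
have w2 s y : 1 < s -> `|Ak j.+1 s y| <= (C1 + C2) * gauss (2 * s) y.
  by move=> s1; apply: le_trans (H2 s y s1) _; rewrite ler_wpM2r ?gauss_ge0// lerDr.
have E : Ak j.+2 t x - Ak j.+1 t x = Duh a `]1, t[%classic t (psi j) x.
  have e (x1 x2 x3 : R) : x1 + x2 - (x1 + x3) = x2 - x3 by ring.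
  by rewrite -Duh_fAk_diff//; exact: e.
rewrite E -[cP a * _ * _]mulrA -ebe.
apply: (Duh_gauss _ (H3 t d t1 d0)) => //.
- by apply: jm_cv; exact: jm_psi.
- by move=> s; rewrite /= in_itv/= => /andP[s1 _]; exact: lt_trans s1.
- by move=> s; rewrite /= in_itv/= => /andP[s1 _]; exact: measurable_psi.
move=> s y; rewrite /= in_itv/= => /andP[s1 _]; have s0 : 0 < s by exact: lt_trans s1.
have := f_gauss (v := Ak j.+1 s) (w := Ak j s) q0 qb Cf0 fL C120 (gauss_bd_hw s0 C120 (w2 s y s1))
  (gauss_bd_hw s0 C120 (w1 s y s1)) (H s y s1).
rewrite /Lfb -/(fAk j.+1 s y) -/(fAk j s y) -/(psi j s y).
rewrite (_ : Lf _ _ _ * _ * _ = d * s `^ (- be))// /be opprD powRD ?(gt_eqF s0) ?implybT// /d.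
ring.
Qed.

(** The exponents meet exactly at one: b + (k + 1) sigma = 1/2 + (k + 2) sigma = 1. *)
Lemma psi_gauss k : k.+2%:R * sigma = 1 / 2 -> exists2 P, 0 <= P &
  forall s y, 1 < s -> `|psi k s y| <= P / s * gauss (2 * s) y.
Proof.
move=> ks; have e : k.+2%:R * sigma = sigma + k.+1%:R * sigma by rewrite -[k.+2%:R]natr1; ring.
have ks' : k.+1%:R * sigma < 1 / 2 by rewrite -ks e ltrDr.
have [C C0 H] := Ak_diff ks'.
have [C1 C10 H1] := Ak_gauss k; have [C2 C20 H2] := Ak_gauss k.+1.
have C120 : 0 <= C1 + C2 by rewrite addr_ge0.
exists (Lf q Cf (C1 + C2) * C); first by rewrite mulr_ge0// Lf_ge0.
move=> s y s1; have s0 : 0 < s by exact: lt_trans s1.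
have w1 : `|Ak k s y| <= (C1 + C2) * gauss (2 * s) y.
  by apply: le_trans (H1 s y s1) _; rewrite ler_wpM2r ?gauss_ge0// lerDl.
have w2 : `|Ak k.+1 s y| <= (C1 + C2) * gauss (2 * s) y.
  by apply: le_trans (H2 s y s1) _; rewrite ler_wpM2r ?gauss_ge0// lerDr.
have := f_gauss (v := Ak k.+1 s) (w := Ak k s) q0 qb Cf0 fL C120 (gauss_bd_hw s0 C120 w2)
  (gauss_bd_hw s0 C120 w1) (H s y s1).
rewrite -/(fAk k.+1 s y) -/(fAk k s y) -/(psi k s y) /Lfb.
have e1 : s^-1 = s `^ (- b) * s `^ (- (k.+1%:R * sigma)).
  rewrite -powRD ?(gt_eqF s0) ?implybT// -powR_inv1 ?(ltW s0)//; congr (_ `^ _).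
  by rewrite bs -opprD addrAC -e ks -splitr.
by rewrite e1 (_ : Lf _ _ _ * _ * _ = Lf q Cf (C1 + C2) * C * (s `^ (- b) * s `^ (- (k.+1%:R * sigma))))//; ring.
Qed.

Lemma jm_Mpsi k t (c : V -> R) : measurable_fun setT c -> jm `]1, t[ (fun s x => Mpsi k s * c x).
Proof.
move=> mc; pose G (w : Rb * V) := (\int[mu]_y ext `]1, t[ (psi k) (w.1, y)) * c w.2.
apply: (@jm_ext _ _ G); first exact: measurable_itv.
  apply: measurable_funM; last exact: (measurableT_comp mc measurable_snd).
  apply: (measurableT_comp (f := fun s : Rb => \int[mu]_y ext `]1, t[ (psi k) (s, y))); last exact: measurable_fst.
  exact: (measurable_param_Rintegral mu (g := fun w : Rb * V => ext `]1, t[ (psi k) w) (jm_psi k t)).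
move=> s x Ds; rewrite /G /Mpsi /=; congr (_ * _); apply: eq_Rintegral => y _.
by rewrite /ext/= mem_set.
Qed.

Lemma bde_dom t K N (F G : V -> R) : measurable_fun setT F -> 0 <= K -> (forall x, `|F x| <= K * `|G x|) ->
  bde t N G -> bde t (K * N) F.
Proof.
move=> mF K0 FG [GN Gb]; split.
  apply: (@L1le_dom _ _ _ _ _ (fun x => K * `|G x|)) => //.
  rewrite -[K in X in L1le _ _ X](ger0_norm K0); apply: L1leZ; case: GN => mG GN; split.
    exact: measurableT_comp.
  by under eq_integral do rewrite normr_id.
by move=> x; apply: le_trans (FG x) _; rewrite -mulrA ler_wpM2l.
Qed.

Lemma bdeD t M N (h g : V -> R) : bde t M h -> bde t N g -> bde t (M + N) (fun x => h x + g x).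
Proof.
move=> [hM hb] [gN gb]; split; first exact: L1leD.
by move=> x; rewrite mulrDl (le_trans (ler_normD _ _))// lerD.
Qed.

Lemma gauss_bde t r : 0 < t -> t <= r -> bde t 1 (@gauss R n r).
Proof.
move=> t0 tr; apply: (@bde_gauss _ _ (r / t)) => //.
- by rewrite ler_pdivlMr// mul1r.
- exact: (measurable_gaussr r (@measurable_id _ _ setT)).
- by move=> x; rewrite divfK ?gt_eqF// mul1r ger0_norm// gauss_ge0.
Qed.

Definition cslice := 2 * Cp a * (Cm R n * 2 * (1 + G2 R n)) * 2 + 2 * cP a.

Lemma cslice_ge0 : 0 <= cslice.
Proof.
apply: addr_ge0; last by rewrite mulr_ge0 ?cP_ge0.
apply: mulr_ge0 (ler0n _ _); apply: mulr_ge0 (mulr_ge0 (ler0n _ _) (Cp_ge0 a)) _.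
by apply: mulr_ge0 (mulr_ge0 (Cm_ge0 _ _) (ler0n _ _)) _; rewrite addr_ge0 ?G2_ge0.
Qed.

Lemma mass_gauss_le s P (psi : V -> R) : 0 < s -> 0 <= P -> measurable_fun setT psi ->
  (forall y, `|psi y| <= P * gauss (2 * s) y) -> `|\int[mu]_y psi y| <= P.
Proof.
move=> s0 P0 mpsi psiP; have s20 : 0 < 2 * s by rewrite mulr_gt0.
apply: Rintegral_L1le; apply: (L1le_dom mpsi psiP).
rewrite -[P in X in L1le _ _ X]mulr1 -[X in L1le _ _ (X * _)](ger0_norm P0); apply: L1leZ.
have := gker_L1le (tzero R n) s20 (gauss_gker n (2 * s)).
by under eq_fun do rewrite gaussC [tsub _ _]tsub0.
Qed.

(** The mass is placed on G_s and not at a point: the kernel at t - s convolved with G_s is exactly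
    the kernel at t, while psi - M G_s has mass zero and keeps a Gaussian bound, so [cv_zero_mass]
    applies. This is used for s <= t/2. *)
Lemma psi_slice t s P (psi : V -> R) : 0 < s -> s < t -> 0 <= P -> measurable_fun setT psi ->
  (forall y, `|psi y| <= P / s * gauss (2 * s) y) ->
  bde t (cslice * P * (t^-1 * (s `^ (- (1 / 2)) + (t - s) `^ (- (1 / 2)))))
    (fun x => cv (pker a (t - s)) psi x - (\int[mu]_y psi y) * pker a t x).
Proof.
move=> s0 st P0 mpsi psiP; have t0 : 0 < t by exact: lt_trans st.
have ts0 : 0 < t - s by rewrite subr_gt0.
have ts20 : 0 < 2 * (t - s) by rewrite mulr_gt0.
have s20 : 0 < 2 * s by rewrite mulr_gt0.
have Ps0 : 0 <= P / s by rewrite divr_ge0// ltW.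
have G20 := G2_ge0 R n.
pose c1 := 2 * Cp a * (Cm R n * 2 * (1 + G2 R n)) * 2.
have c10 : 0 <= c1.
  apply: mulr_ge0 (ler0n _ _); apply: mulr_ge0 (mulr_ge0 (ler0n _ _) (Cp_ge0 a)) _.
  by apply: mulr_ge0 (mulr_ge0 (Cm_ge0 _ _) (ler0n _ _)) _; rewrite addr_ge0.
have w1 : 0 <= s `^ (- (1 / 2)) by exact: powR_ge0.
have w2 : 0 <= (t - s) `^ (- (1 / 2)) by exact: powR_ge0.
have ipsi : L1 mu psi by apply: (L1_dom mpsi psiP); apply: L1Z; exact: L1_gaussx.
pose M := \int[mu]_y psi y.
have MP : `|M| <= P / s := mass_gauss_le s0 Ps0 mpsi psiP.
have mF : measurable_fun setT (fun x => cv (pker a (t - s)) psi x - M * pker a t x).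
  apply: measurable_funB.
    by apply: measurable_cv => //; apply: measurable_pker => //; exact: measurable_id.
  by apply: measurable_funM => //; apply: measurable_pker => //; exact: measurable_id.
have [sle|slt] := leP s (t / 2).
  pose h y := psi y - M * gauss s y.
  have ig : L1 mu (gauss s) by exact: L1_gaussx.
  have mh : measurable_fun setT h.
    by apply: measurable_funB => //; apply: measurable_funM => //; exact: (measurable_gaussr s (@measurable_id _ _ setT)).
  pose P1 := P / s * (1 + G2 R n).
  have P10 : 0 <= P1 by rewrite mulr_ge0// addr_ge0.
  have hP y : `|h y| <= P1 * gauss (2 * s) y.
    rewrite /P1 mulrDr mulr1 [leRHS]mulrDl; apply: le_trans (ler_normB _ _) _; apply: lerD => //.
    rewrite normrM (ger0_norm (gauss_ge0 _ _)) -mulrA; apply: ler_pM => //; first exact: gauss_ge0.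
    exact: gauss_double.
  have h0 : \int[mu]_y h y = 0.
    by rewrite (RintegralB measurableT ipsi (L1Z M ig)) (RintegralZl _ measurableT ig) Rintegral_gauss// mulr1 subrr.
  have cvh x : cv (pker a (t - s)) h x = cv (pker a (t - s)) psi x - M * pker a t x.
    rewrite (cvB x ts20 (pker_gker a ts0) ipsi (L1Z M ig)) (cvZ x M ts20 (pker_gker a ts0) ig).
    by rewrite -pker_cvE// subrK.
  have A0 : 0 <= Cp a / (t - s) by rewrite divr_ge0 ?Cp_ge0// ltW.
  have H x := cv_zero_mass x s20 ts20 A0 (pker_lipker a ts0) (pker_gker a ts0) mh hP P10.
  pose K := Cp a / (t - s) * (Cm R n * Num.sqrt (2 * s) * P1).
  have K0 : 0 <= K by rewrite mulr_ge0// mulr_ge0// mulr_ge0 ?Cm_ge0 ?sqrtr_ge0.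
  have g1 : bde t 1 (@gauss R n (2 * (t - s) + 2 * (2 * s))) by apply: gauss_bde => //; lra.
  have g2 : bde t 1 (@gauss R n (2 * (t - s))) by apply: gauss_bde => //; lra.
  apply: bde_weak (bde_dom mF K0 _ (bdeD g1 g2)); last first.
    move=> x; have := H x; rewrite h0 mul0r subr0 cvh => /le_trans; apply.
    by rewrite ler_wpM2l// ler_norm.
  have tsI : (t - s)^-1 <= 2 * t^-1.
    rewrite -(ler_pM2l ts0) divff ?gt_eqF// mulrA ler_pdivlMr// mul1r; lra.
  have sq : Num.sqrt (2 * s) / s <= 2 * s `^ (- (1 / 2)).
    rewrite -invsqrtE//; have q0' : 0 < Num.sqrt s by rewrite sqrtr_gt0.
    have -> : Num.sqrt (2 * s) / s = Num.sqrt 2 / Num.sqrt s.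
      rewrite sqrtrM// -{2}(sqr_sqrtr (ltW s0)); move: q0'; move: (Num.sqrt s) (Num.sqrt 2) => x1 x2 x10.
      by field; rewrite gt_eqF.
    rewrite ler_wpM2r ?invr_ge0 ?(ltW q0')//.
    have : Num.sqrt 2 <= Num.sqrt (2 ^+ 2) :> R by rewrite ler_wsqrtr// expr2 ler_peMr// ler1n.
    by rewrite sqrtr_sqr ger0_norm.
  apply: (@le_trans _ _ (c1 * P * (t^-1 * s `^ (- (1 / 2))))).
    pose c0 := Cp a * Cm R n * (1 + G2 R n) * P.
    have c00 : 0 <= c0.
      apply: mulr_ge0 (mulr_ge0 (mulr_ge0 (Cp_ge0 a) (Cm_ge0 _ _)) _) P0.
      by rewrite addr_ge0.
    rewrite (_ : K * (1 + 1) = 2 * (c0 * ((t - s)^-1 * (Num.sqrt (2 * s) / s)))); last by rewrite /K /P1 /c0; ring.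
    apply: (@le_trans _ _ (2 * (c0 * ((2 * t^-1) * (2 * s `^ (- (1 / 2))))))).
      rewrite ler_wpM2l// ler_wpM2l//; apply: ler_pM => //; first by rewrite invr_ge0 ltW.
      by rewrite divr_ge0 ?sqrtr_ge0// ltW.
    by rewrite le_eqVlt; apply/orP; left; apply/eqP; rewrite /c1 /c0; ring.
  have ti : 0 <= t^-1 by rewrite invr_ge0 ltW.
  apply: ler_pM; [exact: mulr_ge0| exact: mulr_ge0| |].
    by rewrite ler_wpM2r// lerDl mulr_ge0 ?cP_ge0.
  by rewrite ler_wpM2l// lerDl.
have w3 : s^-1 <= 2 * t^-1.
  rewrite -(ler_pM2l s0) divff ?gt_eqF// mulrA ler_pdivlMr// mul1r; lra.
have w4 : t `^ (- (1 / 2)) <= s `^ (- (1 / 2)).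
  by apply: ge0_ler_powRN; rewrite ?divr_ge0// ltW.
apply: (@bde_gauss _ _ 2 t) => //.
- by rewrite ler1n.
- apply: mulr_ge0 (mulr_ge0 cslice_ge0 P0) _; apply: mulr_ge0 (addr_ge0 w1 w2).
  by rewrite invr_ge0 ltW.
move=> x; apply: (@le_trans _ _ ((2 * cP a * P * (t^-1 * (s `^ (- (1 / 2)) + (t - s) `^ (- (1 / 2))))) * gauss (2 * t) x)).
  have hx := pker_gauss_le a x s0 st mpsi psiP Ps0.
  have [_ pg] := pker_gkerE a t0.
  apply: le_trans (ler_normB _ _) _; rewrite [_ + (t - s) `^ _]addrC mulrDr mulrDr mulrDl.
  have Pt : P / s <= P * (2 * t^-1) by rewrite ler_wpM2l.
  apply: lerD.
    apply: le_trans hx _; rewrite ler_wpM2r ?gauss_ge0//.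
    rewrite [leRHS](_ : _ = cP a * ((t - s) `^ (- (1 / 2)) * (P * (2 * t^-1)))); last by ring.
    by rewrite ler_wpM2l ?cP_ge0// ler_wpM2l.
  rewrite normrM; apply: (@le_trans _ _ ((P * (2 * t^-1)) * (cP a * s `^ (- (1 / 2)) * gauss (2 * t) x))).
    apply: ler_pM => //; first exact: le_trans Pt.
    by apply: le_trans (pg x) _; rewrite ler_wpM2r ?gauss_ge0// ler_wpM2l ?cP_ge0.
  by rewrite le_eqVlt; apply/orP; left; apply/eqP; ring.
rewrite ler_wpM2r ?gauss_ge0// ler_wpM2r//.
  by apply: mulr_ge0 (addr_ge0 w1 w2); rewrite invr_ge0 ltW.
by rewrite ler_wpM2r// lerDr.
Qed.


Lemma Mpsi_integrable k t : k.+2%:R * sigma = 1 / 2 -> 1 < t ->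
  leb.-integrable `]1, t[ (EFin \o Mpsi k).
Proof.
move=> ks t1; have [P P0 HP] := psi_gauss ks.
have mD : measurable (`]1, t[%classic : set Rb) by exact: measurable_itv.
have lI : (leb (`]1%R, t[%classic : set Rb) <= (t - 1)%:E)%E.
  by rewrite lebesgue_measure_itv/= lte_fin t1 -EFinD.
have mo : measurable_fun setT (fun _ : V => 1 : R) by exact: measurable_cst.
have bo s : `]1, t[%classic s -> `|Mpsi k s * 1| <= P * 1.
  rewrite /= in_itv/= => /andP[s1 st]; have s0 : 0 < s by exact: lt_trans s1.
  have Ps0 : 0 <= P / s by rewrite divr_ge0// ltW.
  rewrite !mulr1; apply: le_trans (mass_gauss_le s0 Ps0 (measurable_psi k s1) (fun y => HP s y s1)) _.
  by rewrite ler_pdivrMr// ler_peMr// ltW.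
have PI : (\int[leb]_(s in `]1%R, t[) P%:E <= (P * (t - 1))%:E)%E.
  by rewrite integral_cst// (EFinM P) lee_wpmul2l.
have io := L1le_L1 (@ext_L1le _ _ _ (fun=> P) _ mD (measurable_cst _) PI (fun _ _ => P0) _ (tzero R n) 1
  (jm_Mpsi k t mo) bo ler01).
apply/(integrable_mkcond _ mD); move: io; rewrite /L1.
congr (_.-integrable _ _); apply/funext => s; rewrite patchE /ext/= mulr1.
by case: ifP.
Qed.

(** The critical weight 1/s alone would produce a logarithm. Removing the mass improves the slices
    to t^(-1) (s^(-1/2) + (t-s)^(-1/2)), whose integral is at most 4 t^(-1/2). *)
Lemma last_bde k : k.+2%:R * sigma = 1 / 2 -> exists2 C, 0 <= C & forall t, 1 < t ->
  bde t (C * t `^ (- (1 / 2))) (fun x => Duh a `]1, t[%classic t (fAk k.+1) x -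
    Duh a `]1, t[%classic t (fAk k) x - (\int[leb]_(s in `]1, t[) Mpsi k s) * pker a t x).
Proof.
move=> ks; have [P P0 HP] := psi_gauss ks; have cs0 := cslice_ge0.
exists (cslice * P * 4); first by rewrite mulr_ge0// mulr_ge0.
move=> t t1; have t0 : 0 < t by exact: lt_trans t1.
have D1 s : `]1, t[%classic s -> 1 < s /\ s < t by rewrite /= in_itv/= => /andP[].
have mD : measurable (`]1, t[%classic : set Rb) by exact: measurable_itv.
have mp : measurable_fun setT (pker a t) by apply: measurable_pker => //; exact: measurable_id.
pose F1 s := cv (pker a (t - s)) (psi k s); pose F2 s x := Mpsi k s * pker a t x.
have j1 : jm `]1, t[ F1 by apply: jm_cv; exact: jm_psi.
have j2 : jm `]1, t[ F2 by exact: jm_Mpsi.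
pose kk s := cslice * P * (t^-1 * (s `^ (- (1 / 2)) + (t - s) `^ (- (1 / 2)))).
have sl s : `]1, t[%classic s -> bde t (kk s) (fun x => F1 s x - F2 s x).
  move=> /D1[s1 st]; apply: psi_slice => //; [exact: lt_trans s1|exact: measurable_psi|].
  by move=> y; exact: HP.
have [m1 i1] := @int_powR R (1 / 2) 1 t ltac:(lra) ler01 t1.
have [m2 i2] := @int_powR_rev R (1 / 2) 1 t ltac:(lra) t1.
have mk : measurable_fun `]1, t[ (kk : Rb -> R).
  by apply: measurable_funM => //; apply: measurable_funM => //; exact: measurable_funD.
have kk0 s : 0 <= kk s.
  by apply: mulr_ge0 (mulr_ge0 cs0 P0) _; apply: mulr_ge0 (addr_ge0 (powR_ge0 _ _) (powR_ge0 _ _)); rewrite invr_ge0 ltW.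
have kkI : (\int[leb]_(s in `]1%R, t[) (kk s)%:E <= (cslice * P * 4 * t `^ (- (1 / 2)))%:E)%E.
  rewrite /kk.
  have c0 : 0 <= cslice * P * t^-1 by apply: mulr_ge0 (mulr_ge0 cs0 P0) _; rewrite invr_ge0 ltW.
  have i12 : (\int[leb]_(s in `]1%R, t[) (s `^ (- (1 / 2)) + (t - s) `^ (- (1 / 2)))%:E <= (4 * t `^ (1 / 2))%:E)%E.
    under eq_integral do rewrite EFinD.
    rewrite ge0_integralD//; last 4 first.
    - by move=> s _; rewrite lee_fin powR_ge0.
    - exact/measurable_EFinP.
    - by move=> s _; rewrite lee_fin powR_ge0.
    - exact/measurable_EFinP.
    have h : 1 - 1 / 2 = 1 / 2 :> R by field.
    have h2 : (1 / 2)^-1 = 2 :> R by field.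
    rewrite h h2 in i1; rewrite h h2 in i2.
    apply: le_trans (leeD i1 i2) _; rewrite -EFinD lee_fin.
    have : (t - 1) `^ (1 / 2) <= t `^ (1 / 2).
      by apply: ge0_ler_powR; rewrite ?nnegrE ?subr_ge0 ?(ltW t1) ?(ltW t0) ?gerBl// divr_ge0.
    by move=> ?; lra.
  have := int_scale_le mD (measurable_funD m1 m2) (fun s _ => addr_ge0 (powR_ge0 _ _) (powR_ge0 _ _)) c0 i12.
  have -> : cslice * P * t^-1 * (4 * t `^ (1 / 2)) = cslice * P * 4 * t `^ (- (1 / 2)).
    have tt : t^-1 * t `^ (1 / 2) = t `^ (- (1 / 2)).
      rewrite -powR_inv1 ?(ltW t0)// -powRD ?(gt_eqF t0) ?implybT//; congr (_ `^ _); by field.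
    by rewrite -tt; ring.
  apply: le_trans; rewrite le_eqVlt; apply/orP; left; apply/eqP; apply: eq_integral => s _.
  by rewrite mulrA.
have Z : bde t (cslice * P * 4 * t `^ (- (1 / 2))) (tint `]1, t[ (fun s x => F1 s x - F2 s x)).
  by apply: (@bde_tint _ _ _ kk) => //; exact: jmB.
rewrite (_ : (fun x => _) = tint `]1, t[ (fun s x => F1 s x - F2 s x))//; apply/funext => x.
rewrite Duh_fAk_diff//.
have lI : (leb (`]1%R, t[%classic : set Rb) <= (t - 1)%:E)%E.
  by rewrite lebesgue_measure_itv/= lte_fin t1 -EFinD.
pose B2 := P * `|pker a t x|; have B20 : 0 <= B2 by rewrite mulr_ge0.
have F2b s : `]1, t[%classic s -> `|F2 s x| <= B2.
  move=> /D1[s1 st]; have s0 : 0 < s by exact: lt_trans s1.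
  have Ps0 : 0 <= P / s by rewrite divr_ge0// ltW.
  rewrite normrM ler_wpM2r//.
  apply: le_trans (mass_gauss_le s0 Ps0 (measurable_psi k s1) (fun y => HP s y s1)) _.
  by rewrite ler_pdivrMr// ler_peMr// ltW.
(* A coarse integrable bound at a fixed point x, used only to split the integral of the difference
   into a difference of integrals. *)
pose k' s := kk s * hw n t + B2.
have h0 := hw_ge0 n t.
have mk' : measurable_fun `]1, t[ (k' : Rb -> R) by apply: measurable_funD => //; exact: measurable_funM.
have k'0 s : `]1, t[%classic s -> 0 <= k' s by move=> _; rewrite addr_ge0// mulr_ge0.
have k'I : (\int[leb]_(s in `]1%R, t[) (k' s)%:E <=
    (hw n t * (cslice * P * 4 * t `^ (- (1 / 2))) + B2 * (t - 1))%:E)%E.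
  under eq_integral do rewrite EFinD.
  rewrite ge0_integralD//;
    [|by move=> s _; rewrite lee_fin mulr_ge0|by apply/measurable_EFinP; exact: measurable_funM].
  rewrite EFinD; apply: leeD.
    by under eq_integral do rewrite mulrC; apply: int_scale_le.
  by rewrite integral_cst// (EFinM B2) lee_wpmul2l.
have b1 s : `]1, t[%classic s -> `|F1 s x| <= k' s * 1.
  move=> Ds; have [_ /(_ x) h1] := sl s Ds; rewrite mulr1 -[F1 s x](subrK (F2 s x)).
  by apply: le_trans (ler_normD _ _) _; apply: lerD => //; exact: F2b.
have b2 s : `]1, t[%classic s -> `|F2 s x| <= k' s * 1.
  by move=> Ds; rewrite mulr1; apply: le_trans (F2b s Ds) _; rewrite lerDr mulr_ge0.
rewrite (tintB mD mk' k'I k'0 j1 j2 b1 b2 ler01); congr (_ - _).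
by rewrite /tint RintegralZr//; exact: Mpsi_integrable.
Qed.


(** * Comparison of the solution with the profiles *)

Variables (u : R -> V -> R) (u0 : V -> R) (Mu : R).
Hypotheses (ub : forall t, 0 < t -> bd t Mu (u t))
  (fuj : forall lo hi t, 0 <= lo -> lo < hi -> hi <= t -> jmD a `]lo, hi[%classic t (fu f u))
  (usplit : forall t, 1 < t -> {ae mu, forall x, u t x = cv (gauss t) u0 x +
     Duh a `]0, 1[%classic t (fu f u) x + Duh a `]1, t[%classic t (fu f u) x})
  (heat_moment : exists2 C, 0 <= C & forall t, 1 < t ->
     bd t (C * t `^ (- (1 / 2))) (fun x => cv (gauss t) u0 x - m * gauss t x)).

Lemma Mu_ge0 : 0 <= Mu. Proof. exact: bd_ge0 (ub ltr01). Qed.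

Definition cfu := Lf q Cf Mu * Mu.

Lemma cfu_ge0 : 0 <= cfu.
Proof. by rewrite /cfu mulr_ge0 ?Lf_ge0 ?Mu_ge0. Qed.

Lemma fu_decay s : 0 < s -> bd s (cfu * s `^ (- b)) (fu f u s).
Proof.
by move=> s0; have := f_bd1 q0 qb Cf0 f0 mf fL (ub s0); rewrite /Lfb mulrAC.
Qed.

Lemma fA0_bd s : 0 < s -> bd s (cA0 * s `^ (- b)) (fA0 s).
Proof.
move=> s0; apply: bde_bd; apply: (@bde_gauss _ _ 2 s) => //.
- by rewrite ler1n.
- by rewrite mulr_ge0 ?powR_ge0 ?cA0_ge0.
- exact: measurable_fA0.
- by move=> x; exact: fA0_gauss.
Qed.

Lemma fAk_bd k C s : 0 <= C -> 1 < s -> (forall t x, 1 < t -> `|Ak k t x| <= C * gauss (2 * t) x) ->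
  bd s (Lf q Cf C * C * s `^ (- b)) (fAk k s).
Proof.
move=> C0 s1 AC; have s0 : 0 < s by exact: lt_trans s1.
apply: bde_bd; apply: (@bde_gauss _ _ 2 s) => //.
- by rewrite ler1n.
- by rewrite mulr_ge0 ?powR_ge0// mulr_ge0// Lf_ge0.
- exact: measurable_fAk.
- by move=> x; apply: fAk_gauss => //; exact: AC.
Qed.

(** The separate bounds k1 and k2 justify linearity of the Duhamel integral; the rate comes from the
    finer bound k of the difference. *)
Lemma Duh_diff_bde (D : set Rb) t (h g : R -> V -> R) k1 I1 k2 I2 k I : 0 < t ->
  tbd D t k1 I1 -> tbd D t k2 I2 -> tbd D t k I ->
  jmD a D t h -> jmD a D t g -> (forall s, D s -> 0 < s) ->
  (forall s, D s -> bd s (k1 s) (h s)) -> (forall s, D s -> bd s (k2 s) (g s)) ->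
  (forall s, D s -> bd s (k s) (fun y => h s y - g s y)) ->
  bde t (G2 R n * cP a * I) (fun x => Duh a D t h x - Duh a D t g x).
Proof.
move=> t0 T1 T2 T mh mg D0 hb gb hg.
have [mD Dt mk1 k10 kI1] := T1; have [_ _ mk2 k20 kI2] := T2.
have mp : measurable_fun D (fun s : Rb => (t - s) `^ (- (1 / 2))).
  exact: measurable_powR_subl.
have T12 : tbd D t (fun s => k1 s + k2 s) (I1 + I2).
  split => //; [exact: measurable_funD|by move=> s Ds; rewrite addr_ge0 ?k10 ?k20|].
  under eq_integral do rewrite mulrDr EFinD.
  rewrite ge0_integralD//; first by rewrite EFinD leeD.
  - by move=> s Ds; rewrite lee_fin mulr_ge0 ?powR_ge0 ?k10.
  - by apply/measurable_EFinP; exact: measurable_funM.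
  - by move=> s Ds; rewrite lee_fin mulr_ge0 ?powR_ge0 ?k20.
  - by apply/measurable_EFinP; exact: measurable_funM.
have t00 : 0 < t + 0 by rewrite addr0.
have D00 s : D s -> 0 < s + 0 by rewrite addr0; exact: D0.
have hb' s : D s -> bd (s + 0) (k1 s + k2 s) (h s).
  by move=> Ds; rewrite addr0; apply: bd_weak (hb s Ds); rewrite lerDl k20.
have gb' s : D s -> bd (s + 0) (k1 s + k2 s) (g s).
  by move=> Ds; rewrite addr0; apply: bd_weak (gb s Ds); rewrite lerDr k10.
have E x : Duh a D t h x - Duh a D t g x = Duh a D t (fun s y => h s y - g s y) x.
  by rewrite (DuhB x T12 t00 mh mg D00 hb' gb').
rewrite (_ : (fun x => _) = Duh a D t (fun s y => h s y - g s y)); last by apply/funext => x.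
have := @Duh_bde _ _ a D t (fun s y => h s y - g s y) k I 0 T; rewrite addr0; apply => //.
- by apply: jmDB => // s Ds; [exact: bd_L1 (hb s Ds)|exact: bd_L1 (gb s Ds)].
- by move=> s Ds; rewrite addr0; exact: hg.
Qed.

Lemma GP_ge0 : 0 <= G2 R n * cP a.
Proof. by rewrite mulr_ge0 ?G2_ge0 ?cP_ge0. Qed.

Lemma head_diff : exists2 C, 0 <= C & forall t, 1 < t ->
  bde t (C * t `^ (- (1 / 2))) (fun x => Duh a `]0, 1[%classic t (fu f u) x - Duh a `]0, 1[%classic t fA0 x).
Proof.
have [C C0 H] := tbd_head; exists (G2 R n * cP a * (C * (cfu + cA0))).
  exact: mulr_ge0 GP_ge0 (mulr_ge0 C0 (addr_ge0 cfu_ge0 cA0_ge0)).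
move=> t t1; rewrite -[G2 R n * cP a * _ * _]mulrA.
have D0 s : `]0, 1[%classic s -> 0 < s by rewrite /= in_itv/= => /andP[].
apply: (Duh_diff_bde _ (H t _ t1 cfu_ge0) (H t _ t1 cA0_ge0) (H t _ t1 (addr_ge0 cfu_ge0 cA0_ge0))) => //.
- exact: lt_trans t1.
- by apply: fuj => //; exact: ltW.
- by apply: jm_cv; apply: jm_fA0; exact: measurable_itv.
- by move=> s /D0; exact: fu_decay.
- by move=> s /D0; exact: fA0_bd.
- by move=> s /D0 s0; rewrite mulrDl; apply: bdB; [exact: fu_decay|exact: fA0_bd].
Qed.

(** Both functions are below (Mu + C) t^(-n/2), so f is Lipschitz along them with a constant of
    order t^(-b). *)
Lemma fdiff_bd k : exists2 C, 0 <= C & forall s K, 1 < s -> bd s K (fun x => u s x - Ak k s x) ->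
  bd s (C * s `^ (- b) * K) (fun y => fu f u s y - fAk k s y).
Proof.
have [C C0 AC] := Ak_gauss k; have M0 : 0 <= Mu + C by rewrite addr_ge0 ?Mu_ge0.
exists (Lf q Cf (Mu + C)); first exact: Lf_ge0.
move=> s K s1 h; have s0 : 0 < s by exact: lt_trans s1.
have h0 := hw_ge0 n s.
apply: (f_bd q0 qb Cf0 mf fL M0 _ (measurable_Ak k s1) _ _ h); first exact: bd_measurable (ub s0).
  by have [_] := ub s0; apply: filterS => x /le_trans; apply; rewrite ler_wpM2r// lerDl.
apply: aeW => x; apply: le_trans (gauss_bd_hw s0 C0 (AC s x s1)) _.
by rewrite ler_wpM2r// lerDr Mu_ge0.
Qed.

(** Common to source exponents b + ga below and above 1: the two ranges differ only in the time
    integral supplied as hypothesis. *)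
Lemma tail_diff_gen k ga Cu0 e : 0 <= Cu0 ->
  (exists2 C, 0 <= C & forall t c, 1 < t -> 0 <= c ->
    tbd `]1, t[%classic t (fun s => c * s `^ (- (b + ga))) (C * c * t `^ (- e))) ->
  (forall s, 1 < s -> bd s (Cu0 * s `^ (- ga)) (fun x => u s x - Ak k s x)) ->
  exists2 C, 0 <= C & forall t, 1 < t -> bde t (C * t `^ (- e))
    (fun x => Duh a `]1, t[%classic t (fu f u) x - Duh a `]1, t[%classic t (fAk k) x).
Proof.
move=> Cu00 [C3 C30 H3] H; have [C1 C10 H1] := fdiff_bd k.
have [C2 C20 H2] := tbd_tail b_ge0 b_lt1.
have [C4 C40 AC] := Ak_gauss k.
have d0 : 0 <= C1 * Cu0 by rewrite mulr_ge0.
exists (G2 R n * cP a * (C3 * (C1 * Cu0))); first exact: mulr_ge0 GP_ge0 (mulr_ge0 C30 d0).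
move=> t t1; rewrite -[G2 R n * cP a * _ * _]mulrA.
have D1 s : `]1, t[%classic s -> 1 < s by rewrite /= in_itv/= => /andP[].
have c0 : 0 <= Lf q Cf C4 * C4 by rewrite mulr_ge0// Lf_ge0.
apply: (Duh_diff_bde _ (H2 t _ t1 cfu_ge0) (H2 t _ t1 c0) (H3 t _ t1 d0)).
- exact: lt_trans t1.
- by apply: fuj.
- exact: jmD_fAk.
- by move=> s /D1; exact: lt_trans.
- by move=> s /D1 s1; apply: fu_decay; exact: lt_trans s1.
- by move=> s /D1 s1; exact: fAk_bd.
move=> s /D1 s1; have s0 : 0 < s by exact: lt_trans s1.
have := H1 s _ s1 (H s s1); rewrite opprD powRD ?(gt_eqF s0) ?implybT//.
by rewrite (_ : C1 * _ * _ = C1 * Cu0 * (s `^ (- b) * s `^ (- ga)))//; ring.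
Qed.

Lemma tail_diff k ga Cu0 : 0 <= ga -> b + ga < 1 -> 0 <= Cu0 ->
  (forall s, 1 < s -> bd s (Cu0 * s `^ (- ga)) (fun x => u s x - Ak k s x)) ->
  exists2 C, 0 <= C & forall t, 1 < t -> bde t (C * t `^ (- (sigma + ga)))
    (fun x => Duh a `]1, t[%classic t (fu f u) x - Duh a `]1, t[%classic t (fAk k) x).
Proof.
move=> ga0 bga Cu00; apply: tail_diff_gen => //.
have [C C0 H] := tbd_tail (addr_ge0 b_ge0 ga0) bga; exists C => // t c t1 c0.
by rewrite (_ : - (sigma + ga) = 1 / 2 - (b + ga)); [exact: H|rewrite bs; ring].
Qed.

Lemma tail_diff1 k ga de Cu0 : b + ga = 1 + de -> 0 < de -> 0 <= Cu0 ->
  (forall s, 1 < s -> bd s (Cu0 * s `^ (- ga)) (fun x => u s x - Ak k s x)) ->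
  exists2 C, 0 <= C & forall t, 1 < t -> bde t (C * t `^ (- (1 / 2)))
    (fun x => Duh a `]1, t[%classic t (fu f u) x - Duh a `]1, t[%classic t (fAk k) x).
Proof. by move=> bga de0 Cu00; apply: tail_diff_gen => //; rewrite bga; exact: tbd_tail1. Qed.

Lemma u_Ak_step k ga Cu0 : 0 <= ga -> sigma + ga < 1 / 2 -> 0 <= Cu0 ->
  (forall s, 1 < s -> bd s (Cu0 * s `^ (- ga)) (fun x => u s x - Ak k s x)) ->
  exists2 C, 0 <= C & forall t, 1 < t -> bd t (C * t `^ (- (sigma + ga))) (fun x => u t x - Ak k.+1 t x).
Proof.
move=> ga0 sga Cu00 H.
have bga : b + ga < 1.
  by rewrite bs addrAC (lt_le_trans (y := 1 / 2 + 1 / 2)) ?ltrD2r// -splitr.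
have [C1 C10 H1] := heat_moment; have [C2 C20 H2] := head_diff.
have [C3 C30 H3] := tail_diff ga0 bga Cu00 H.
exists (C1 + C2 + C3); first by rewrite !addr_ge0.
move=> t t1; have t0 : 0 < t by exact: lt_trans t1.
have tt : t `^ (- (1 / 2)) <= t `^ (- (sigma + ga)).
  by apply: ler_powR; [exact: ltW|rewrite lerN2 ltW].
have := bdD (bdD (H1 t t1) (bde_bd (H2 t t1))) (bde_bd (H3 t t1)) => B1.
apply: (bd_ae _ _ (bd_weak _ B1)).
- by apply: measurable_funB; [exact: bd_measurable (ub t0)|exact: measurable_Ak].
- have e (x1 x2 x3 x4 x5 x6 : R) : x1 - x2 + (x3 - x4) + (x5 - x6) = x1 + x3 + x5 - (x2 + x4 + x6) by ring.
  by move: (usplit t1); apply: filterS => x ->; exact: e.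
- by rewrite !mulrDl; apply: lerD => //; apply: lerD; rewrite ler_wpM2l.
Qed.

Lemma u_A0 : exists2 C, 0 <= C & forall t, 1 < t -> bd t (C * t `^ (- sigma)) (fun x => u t x - Ak 0 t x).
Proof.
have [C1 C10 H1] := heat_moment.
have [C2 C20 H2] := tbd_head; have [C3 C30 H3] := tbd_tail b_ge0 b_lt1.
pose C4 := G2 R n * cP a; have C40 : 0 <= C4 := GP_ge0.
exists (C1 + C4 * (C2 * cfu) + C4 * (C3 * cfu)).
  exact: addr_ge0 (addr_ge0 C10 (mulr_ge0 C40 (mulr_ge0 C20 cfu_ge0))) (mulr_ge0 C40 (mulr_ge0 C30 cfu_ge0)).
move=> t t1; have t0 : 0 < t by exact: lt_trans t1.
have tt : t `^ (- (1 / 2)) <= t `^ (- sigma).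
  by apply: ler_powR; [exact: ltW|rewrite lerN2 ltW].
have h2 : bde t (C4 * (C2 * cfu * t `^ (- (1 / 2)))) (Duh a `]0, 1[%classic t (fu f u)).
  have := @Duh_bde _ _ a _ t (fu f u) _ _ 0 (H2 t _ t1 cfu_ge0); rewrite addr0; apply.
  - by apply: fuj => //; exact: ltW.
  - by move=> s; rewrite /= in_itv/= addr0 => /andP[].
  - by move=> s; rewrite /= in_itv/= addr0 => /andP[s0 _]; exact: fu_decay.
have h3 : bde t (C4 * (C3 * cfu * t `^ (1 / 2 - b))) (Duh a `]1, t[%classic t (fu f u)).
  have := @Duh_bde _ _ a _ t (fu f u) _ _ 0 (H3 t _ t1 cfu_ge0); rewrite addr0; apply.
  - exact: fuj.
  - by move=> s; rewrite /= in_itv/= addr0 => /andP[s1 _]; exact: lt_trans s1.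
  - by move=> s; rewrite /= in_itv/= addr0 => /andP[s1 _]; apply: fu_decay; exact: lt_trans s1.
rewrite (_ : 1 / 2 - b = - sigma) in h3; last by rewrite bs; ring.
have := bdD (bdD (H1 t t1) (bde_bd h2)) (bde_bd h3) => B1.
apply: (bd_ae _ _ (bd_weak _ B1)).
- by apply: measurable_funB; [exact: bd_measurable (ub t0)|exact: measurable_Ak].
- have e (x1 x2 x3 x5 : R) : x1 - x2 + x3 + x5 = x1 + x3 + x5 - x2 by ring.
  by move: (usplit t1); apply: filterS => x ->; exact: e.
- rewrite [C4 * (_ * _ `^ _)]mulrA [C4 * (C3 * cfu * _)]mulrA !mulrDl; apply: lerD => //.
  by apply: lerD; rewrite ler_wpM2l// mulr_ge0// mulr_ge0 ?cfu_ge0.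
Qed.

Lemma u_Ak k : k.+1%:R * sigma < 1 / 2 -> exists2 C, 0 <= C & forall t, 1 < t ->
  bd t (C * t `^ (- (k.+1%:R * sigma))) (fun x => u t x - Ak k t x).
Proof.
elim: k => [|k IH] ks; first by rewrite mul1r; exact: u_A0.
have e : k.+2%:R * sigma = sigma + k.+1%:R * sigma by rewrite -[k.+2%:R]natr1; ring.
have ks' : k.+1%:R * sigma < 1 / 2 by apply: le_lt_trans ks; rewrite e lerDr ltW.
have [C C0 H] := IH ks'; rewrite e; apply: (u_Ak_step _ _ C0 H); last by rewrite -e.
by rewrite mulr_ge0// ltW.
Qed.

Lemma final_bd k : k.+2%:R * sigma = 1 / 2 -> exists2 C, 0 <= C & forall t, 1 < t ->
  bd t (C * t `^ (- (1 / 2))) (fun x => u t x - (Ak k.+1 t x +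
    (\int[leb]_(s in `]1, t[) Mpsi k s) * pker a t x)).
Proof.
move=> ks; have e : k.+2%:R * sigma = sigma + k.+1%:R * sigma by rewrite -[k.+2%:R]natr1; ring.
have ks' : k.+1%:R * sigma < 1 / 2 by rewrite -ks e ltrDr.
(* Half a sigma is given up. The step to the next profile then has rate 1/2 - sigma/2 and stays
   subcritical, and the Duhamel integral after it has source exponent 1 + sigma/2, beyond the
   critical value. *)
pose ga := k.+1%:R * sigma - sigma / 2.
have s2 : 0 < sigma / 2 by rewrite divr_gt0.
have ga0 : 0 <= ga.
  rewrite subr_ge0 -[k.+1%:R]natr1 mulrDl mul1r ler_wpDl ?mulr_ge0 ?(ltW sigma0)//.
  by rewrite ler_pdivrMr// ler_peMr ?(ltW sigma0)// ler1n.
have sga : sigma + ga = 1 / 2 - sigma / 2 by rewrite /ga addrA -e ks.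
have sga1 : sigma + ga < 1 / 2 by rewrite sga gtrBl.
have [C0 C00 H0] := u_Ak ks'.
have H0' s : 1 < s -> bd s (C0 * s `^ (- ga)) (fun x => u s x - Ak k s x).
  move=> s1; apply: bd_weak (H0 s s1); rewrite ler_wpM2l//.
  by apply: ler_powR; [exact: ltW|rewrite lerN2 /ga gerBl ltW].
have [C1 C10 H1] := u_Ak_step ga0 sga1 C00 H0'.
have bga : b + (sigma + ga) = 1 + sigma / 2 by rewrite sga bs; field.
have [C2 C20 H2] := tail_diff1 bga s2 C10 H1.
have [C3 C30 H3] := heat_moment; have [C4 C40 H4] := head_diff.
have [C5 C50 H5] := last_bde ks.
exists (C3 + C4 + C2 + C5); first by rewrite !addr_ge0.
move=> t t1; have t0 : 0 < t by exact: lt_trans t1.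
have B1 := bdD (bdD (bdD (H3 t t1) (bde_bd (H4 t t1))) (bde_bd (H2 t t1))) (bde_bd (H5 t t1)).
rewrite -!mulrDl in B1; apply: bd_ae B1.
- apply: measurable_funB; first exact: bd_measurable (ub t0).
  apply: measurable_funD; first exact: measurable_Ak.
  by apply: measurable_funM => //; apply: measurable_pker => //; exact: measurable_id.
(* The Duhamel integral of f(A_{k+1}) cancels between the last two differences; what remains on the
   right is A_{k+1} and the mass term. *)
have e1 (x1 x2 x3 x4 x5 x6 x7 x8 : R) :
  x1 - x2 + (x3 - x4) + (x5 - x6) + (x6 - x7 - x8) = x1 + x3 + x5 - (x2 + x4 + x7 + x8) by ring.
by move: (usplit t1); apply: filterS => x ->; exact: e1.
Qed.

End asymptotic_profiles.

(** * From the concrete operators of the statement to the abstract ones *)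

Section bridges.
Variables (R : realType) (n : nat).
Local Notation V := (n.-tuple R).
Local Notation mu := (lebn R n).
Local Notation leb := (@lebesgue_measure R).
Local Notation Rb := (measurableTypeR R).
Implicit Types (g h : V -> R) (A : set V) (M K t : R).

Lemma lebRnE A : measurable A -> lebRn A = mu A.
Proof.
move=> mA; rewrite /lebRn ge0_intRnE.
- by rewrite integral_indic// setIT.
- by apply/measurable_EFinP; exact: measurable_indic.
- by move=> x; rewrite lee_fin.
Qed.

(** [nullRn] integrates an indicator coordinate by coordinate. This is identified with the measure
    of the set when the set is measurable, hence the hypothesis on A. *)
Lemma nullRn_ae (P : V -> Prop) A : measurable A -> nullRn A -> (forall x, ~ A x -> P x) ->
  {ae mu, forall x, P x}.
Proof.
move=> mA nA AP; exists A; split => //; first by rewrite -lebRnE.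
by move=> x /= nP; apply: contrapT => /AP.
Qed.

Lemma measurable_gt_norm g M : measurable_fun setT g -> measurable [set x | M < `|g x|].
Proof.
move=> mg; rewrite -[X in measurable X]setTI.
have ma : measurable_fun setT (fun x => `|g x|) by exact: measurableT_comp.
have := ma measurableT `]M, +oo[%classic (measurable_itv _).
rewrite (_ : _ @^-1` _ = [set x | M < `|g x|])//.
by apply/seteqP; split => x /=; rewrite in_itv/= andbT.
Qed.

Lemma ae_nullRn g M : measurable_fun setT g -> {ae mu, forall x, `|g x| <= M} -> nullRn [set x | M < `|g x|].
Proof.
move=> mg [A [mA A0 gA]]; rewrite /nullRn lebRnE; last exact: measurable_gt_norm.
apply: subset_measure0 A0 => //; first exact: measurable_gt_norm.
by move=> x /= Mg; apply: gA => /= gM; move: Mg; rewrite ltNge gM.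
Qed.

Lemma measurable_neq g h : measurable_fun setT g -> measurable_fun setT h -> measurable [set x | g x <> h x].
Proof.
move=> mg mh; have md : measurable_fun setT (fun x => g x - h x) by exact: measurable_funB.
have := md measurableT (~` [set 0]) (measurableC (measurable_set1 _)).
rewrite setTI (_ : _ @^-1` _ = [set x | g x <> h x])//.
by apply/seteqP; split => x /= H; apply: contra_not H; [move=> ->; rewrite subrr|move=> /eqP; rewrite subr_eq0 => /eqP].
Qed.

Lemma esssup_fin_ae g : measurable_fun setT g -> (esssupnorm g < +oo)%E ->
  exists2 K, 0 <= K & {ae mu, forall x, `|g x| <= K}.
Proof.
move=> mg /ereal_inf_lt[_ [K [K0 nK] <-]] _; exists K => //.
by apply: nullRn_ae (measurable_gt_norm K mg) nK _ => x /= /negP; rewrite -leNgt.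
Qed.

Lemma esssup_lt_ae g M : measurable_fun setT g -> (esssupnorm g < M%:E)%E ->
  {ae mu, forall x, `|g x| <= M}.
Proof.
move=> mg /ereal_inf_lt[_ [K [K0 nK] <-]]; rewrite lte_fin => KM.
apply: nullRn_ae (measurable_gt_norm K mg) nK _ => x /= /negP; rewrite -leNgt => /le_trans; apply.
exact: ltW.
Qed.

Lemma Lq1E g : measurable_fun setT g -> Lqnorm 1%:E g = (\int[mu]_x (`|g x|)%:E)%E.
Proof.
move=> mg; rewrite /Lqnorm invr1 poweRe1.
  rewrite ge0_intRnE.
  - by apply: eq_integral => x _; rewrite powRr1.
  - by apply/measurable_EFinP; under eq_fun do rewrite powRr1//; exact: measurableT_comp.
  - by move=> x; rewrite lee_fin powR_ge0.
rewrite ge0_intRnE; first by apply: integral_ge0 => x _; rewrite lee_fin powR_ge0.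
  by apply/measurable_EFinP; under eq_fun do rewrite powRr1//; exact: measurableT_comp.
by move=> x; rewrite lee_fin powR_ge0.
Qed.

Lemma Lq1_L1le g M : measurable_fun setT g -> (Lqnorm 1%:E g <= M%:E)%E -> L1le mu g M.
Proof. by move=> mg; rewrite Lq1E. Qed.

Lemma Lq1_L1 g : measurable_fun setT g -> (Lqnorm 1%:E g < +oo)%E -> L1 mu g.
Proof. by move=> mg; rewrite Lq1E// => gf; apply/integrableP; split => //; exact/measurable_EFinP. Qed.

Lemma massE g : L1 mu g -> mass g = \int[mu]_x g x.
Proof. by move=> ig; rewrite /mass intRnE. Qed.

Lemma ae_esssup g M : measurable_fun setT g -> 0 <= M -> {ae mu, forall x, `|g x| <= M} ->
  (esssupnorm g <= M%:E)%E.
Proof. by move=> mg M0 gM; apply: ereal_inf_lbound; exists M => //; split => //; exact: ae_nullRn. Qed.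

(** Interpolation: |g|^r <= (K t^(-n/2))^(r-1) |g| almost everywhere, after which the powers of t
    cancel exactly for each r. *)
Lemma bd_Lq (q : \bar R) t K g : 0 < t -> bd t K g -> (1%:E <= q)%E ->
  ((t `^ (n%:R / 2 * (1 - (if q is r%:E then r^-1 else 0))))%:E * Lqnorm q g <= K%:E)%E.
Proof.
move=> t0 gb; have K0 := bd_ge0 gb; have mg := bd_measurable gb; have [[_ gK] gw] := gb.
have h0 := hw_gt0 n t0.
case: q => [r|_|//]; last first.
  rewrite subr0 mulr1 /=; have Kh : 0 <= K * hw n t by rewrite mulr_ge0// ltW.
  apply: le_trans (lee_wpmul2l _ (ae_esssup mg Kh gw)) _; first by rewrite lee_fin powR_ge0.
  rewrite -EFinM lee_fin /hw mulrCA -powRD ?(gt_eqF t0) ?implybT// subrr powRr0 mulr1.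
  exact: lexx.
rewrite lee_fin => r1; have r0 : 0 < r by exact: lt_le_trans r1.
have mr : measurable_fun setT (fun x => `|g x| `^ r).
  by apply: (measurableT_comp (measurable_powR r)); exact: measurableT_comp.
rewrite /Lqnorm ge0_intRnE; last 2 first.
- exact/measurable_EFinP.
- by move=> x; rewrite lee_fin powR_ge0.
have c0 : 0 <= (K * hw n t) `^ (r - 1) by exact: powR_ge0.
have I : (\int[mu]_x (`|g x| `^ r)%:E <= ((K * hw n t) `^ (r - 1) * K)%:E)%E.
  apply: (@le_trans _ _ (\int[mu]_x (((K * hw n t) `^ (r - 1))%:E * (`|g x|)%:E))%E).
    apply: ae_ge0_le_integral => //.
    - exact/measurable_EFinP.
    - by move=> x _; rewrite -EFinM lee_fin mulr_ge0.
    - by apply/measurable_EFinP; apply: measurable_funM => //; exact: measurableT_comp.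
    move: gw; apply: filterS => x gx _; rewrite -EFinM lee_fin.
    have [->|g0] := eqVneq (g x) 0; first by rewrite normr0 powR0 ?gt_eqF// mulr0.
    have ng : 0 < `|g x| by rewrite normr_gt0.
    have -> : `|g x| `^ r = `|g x| `^ (r - 1) * `|g x|.
      by rewrite -[X in _ = _ * X](powRr1 (ltW ng)) -powRD ?(gt_eqF ng) ?implybT// subrK.
    rewrite ler_wpM2r//.
    by apply: ge0_ler_powR; rewrite ?nnegrE ?subr_ge0// mulr_ge0// ltW.
  rewrite ge0_integralZl//; first by rewrite EFinM lee_wpmul2l.
  by apply/measurable_EFinP; exact: measurableT_comp.
have ri : 0 <= r^-1 by rewrite invr_ge0 ltW.
apply: (@le_trans _ _ ((t `^ (n%:R / 2 * (1 - r^-1)))%:E * (((K * hw n t) `^ (r - 1) * K)%:E `^ r^-1))%E).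
  apply: lee_wpmul2l; first by rewrite lee_fin powR_ge0.
  apply: gt0_ler_poweR => //; rewrite in_itv/= leey andbT ?lee_fin ?mulr_ge0//.
  by apply: integral_ge0 => x _; rewrite lee_fin powR_ge0.
rewrite poweR_EFin -EFinM lee_fin.
(* K = 0 is treated apart, because splitting the powers of K below needs a nonzero base. *)
move: K0; rewrite le_eqVlt => /orP[/eqP <-|K0].
  by rewrite mulr0 powR0 ?mulr0// gt_eqF// invr_gt0.
have e1 : r^-1 * (r - 1) = 1 - r^-1 by rewrite mulrBr mulVf ?gt_eqF// mulr1.
rewrite le_eqVlt; apply/orP; left; apply/eqP.
rewrite powRM ?powR_ge0 ?(ltW K0)// -powRrM [(r - 1) * _]mulrC e1 powRM ?(ltW K0) ?(ltW h0)//.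
have -> : hw n t `^ (1 - r^-1) = t `^ (- (n%:R / 2 * (1 - r^-1))) by rewrite /hw -powRrM mulNr.
set X := t `^ (n%:R / 2 * _); set Y := t `^ (- _).
have XY : X * Y = 1 by rewrite /X /Y -powRD ?(gt_eqF t0) ?implybT// subrr powRr0.
have KK : K `^ (1 - r^-1) * K `^ r^-1 = K.
  by rewrite -powRD ?(gt_eqF K0) ?implybT// subrK powRr1// ltW.
rewrite [LHS](_ : _ = (X * Y) * (K `^ (1 - r^-1) * K `^ r^-1)); last by ring.
by rewrite XY KK mul1r.
Qed.

Lemma L1_norm1 (phi : V -> R) : measurable_fun setT phi ->
  (forall j : 'I_n, (Lqnorm 1%:E (fun x => (tnth x j * phi x)%R) < +oo)%E) ->
  L1 mu (fun y => norm1 y * `|phi y|).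
Proof.
move=> mphi pm.
have i1 (j : 'I_n) : L1 mu (fun y => `|tnth y j * phi y|).
  apply: integrable_norm; apply: Lq1_L1 (pm j).
  by apply: measurable_funM => //; exact: measurable_coord.
have := L1_bigsum (index_enum 'I_n) i1; congr (L1 _ _); apply/funext => y.
by rewrite /norm1 mulr_suml; apply: eq_bigr => j _; rewrite normrM.
Qed.

(** Here the first moment of the datum enters: it gives the linear part its rate t^(-1/2). *)
Lemma heat_moment_bd (phi : V -> R) : L1 mu phi -> L1 mu (fun y => norm1 y * `|phi y|) ->
  exists2 C, 0 <= C & forall t, 0 < t ->
    bd t (C * t `^ (- (1 / 2))) (fun x => cv (gauss t) phi x - (\int[mu]_y phi y) * gauss t x).
Proof.
move=> ip iw; have [W W0 wW] := L1_L1le iw.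
pose I := \int[mu]_y (norm1 y * `|phi y|).
have I0 : 0 <= I by apply: Rintegral_ge0 => y _; rewrite mulr_ge0// norm1_ge0.
have G0 := G2_ge0 R n.
exists (4 * G2 R n * (W + I)); first by rewrite !mulr_ge0// addr_ge0.
move=> t t0; have t20 : 0 < 2 * t by rewrite mulr_gt0.
have b1 : bde t W (cv (gauss (2 * t)) (fun y => norm1 y * `|phi y|)).
  split; first by have := cv_L1le t20 (gauss_gker n (2 * t)) wW; rewrite mul1r.
  move=> x; apply: le_trans (cv_sup1 x t20 (gauss_gker n (2 * t)) wW) _.
  rewrite mul1r mulrC ler_wpM2l//; apply: hw_mono => //; lra.
have b2 : bde t (I * 1) (fun x : V => gauss (2 * t) x * I).
  apply: (bde_dom (G := gauss (2 * t)) _ I0).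
  - by apply: measurable_funM => //; exact: (measurable_gaussr _ (@measurable_id _ _ setT)).
  - by move=> x; rewrite normrM mulrC (ger0_norm I0).
  - apply: gauss_bde => //; lra.
rewrite mulr1 in b2.
have A0 : 0 <= 4 * G2 R n / Num.sqrt t by rewrite divr_ge0 ?sqrtr_ge0// mulr_ge0.
apply: bde_bd; rewrite (_ : 4 * G2 R n * (W + I) * _ = 4 * G2 R n / Num.sqrt t * (W + I)); last first.
  by rewrite -invsqrtE//; ring.
apply: (bde_dom _ A0 _ (bdeD b1 b2)).
  apply: measurable_funB; first by apply: measurable_cv; [exact: measurable_gaussr|exact: L1_measurable ip].
  by apply: measurable_funM => //; exact: (measurable_gaussr _ (@measurable_id _ _ setT)).
move=> x; apply: le_trans (lipker_moment x t20 A0 (gauss_lipker n t0) (gauss_gker2 n t0) ip iw) _.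
by rewrite ler_wpM2l// ler_norm.
Qed.

(** Undoing the dilation shows a multiple of the derivative of G_t in direction j. Summed over j
    with the weights a_j this becomes the mass times [pker]. *)
Lemma LambdaE (j : 'I_n) t phi x : 0 < t -> Lambda j t phi x = mass phi * dgauss j t x.
Proof.
move=> t0; rewrite /Lambda /dil /xjG1 /dgauss /gauss tnth_mktuple mulr1.
have s0 : 0 < Num.sqrt t by rewrite sqrtr_gt0.
rewrite -!invsqrtE//.
have -> : tnorm2 (tscale (Num.sqrt t)^-1 x) = tnorm2 x / t.
  rewrite /tnorm2 mulr_suml; apply: eq_bigr => i _; rewrite tnth_mktuple exprMn exprVn sqr_sqrtr ?(ltW t0)//.
  by rewrite mulrC.
have -> : tnorm2 x / t / (4 * 1) = tnorm2 x / (4 * t) by rewrite mulr1 invfM -mulrA [t^-1 * _]mulrC.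
have p0 : 0 <= 4 * pi :> R by rewrite mulr_ge0 ?pi_ge0.
have e2 : 2 * t = 2 * Num.sqrt t ^+ 2 by rewrite sqr_sqrtr ?ltW.
rewrite (powRM _ p0 (ltW t0)) e2.
move: s0; move: (Num.sqrt t) (mass phi) (tnth x j) (expR _) (t `^ _) ((4 * pi) `^ _) => w m y E T P w0.
by field; rewrite gt_eqF.
Qed.

End bridges.

Section profiles.
Variables (R : realType) (n : nat) (a : n.-tuple R).
Local Notation V := (n.-tuple R).
Local Notation mu := (lebn R n).
Local Notation leb := (@lebesgue_measure R).
Local Notation Rb := (measurableTypeR R).
Variables (f : R -> R) (q b sigma Cf : R).
Hypotheses (q0 : 0 < q) (qb : n%:R / 2 * q = b) (Cf0 : 0 <= Cf) (f0 : f 0 = 0)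
  (mf : measurable_fun setT f)
  (fL : forall xi eta, `|f xi - f eta| <= Cf * (`|xi| `^ q + `|eta| `^ q) * `|xi - eta|)
  (bs : b = sigma + 1 / 2) (sigma0 : 0 < sigma) (sigma1 : sigma < 1 / 2).
Variable u0 : V -> R.
Local Notation m := (mass u0).

Lemma A0kE k t : 1 < t -> A0k a f u0 k t = Ak a f m k t.
Proof.
elim: k t => [|k IH] t t1; first by apply/funext => x.
apply/funext => x /=; rewrite /A0; congr (_ + _ + _).
  apply: (duhamelE (v := A0 u0)); [exact: ltr01|exact: ltW| |].
    by move=> s /andP[s0 _]; exact: bd_L1 (fA0_bd q0 qb Cf0 f0 mf fL m s0).
  by apply: jm_cv; apply: (jm_fA0 f0 mf m); exact: measurable_itv.
have [C C0 AC] := Ak_gauss a q0 qb Cf0 f0 mf fL bs sigma0 sigma1 m k.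
rewrite (duhamelE (v := A0k a f u0 k)) //.
- by apply: eq_tint => s; rewrite /= in_itv/= => /andP[s1 _]; rewrite IH.
- move=> s /andP[s1 _]; rewrite IH//.
  exact: bd_L1 (fAk_bd q0 qb Cf0 f0 mf fL C0 s1 AC).
- apply: eq_jm (jmD_fAk a f0 mf m k t) => s y; rewrite /= in_itv/= => /andP[s1 _].
  by rewrite IH.
Qed.

(** The index k + 1 here is the positive k of the statement, so that the predecessor taken in
    [tildeA] is a true one. *)
Lemma tildeAE k t x : k.+2%:R * sigma = 1 / 2 -> 1 < t ->
  tildeA a f u0 k.+1 t x = Ak a f m k.+1 t x + (\int[leb]_(s in `]1, t[) Mpsi a f m k s) * pker a t x.
Proof.
move=> ks t1; have t0 : 0 < t by exact: lt_trans t1.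
rewrite /tildeA -[k.+1.-1]/k A0kE//; congr (_ + _); rewrite /pker mulr_sumr; apply: eq_bigr => j _.
rewrite mulrCA; congr (_ * _).
have [C C0 AC] := Ak_gauss a q0 qb Cf0 f0 mf fL bs sigma0 sigma1 m k.
have [C' C0' AC'] := Ak_gauss a q0 qb Cf0 f0 mf fL bs sigma0 sigma1 m k.+1.
have D1 s : `]1, t[%classic s -> 1 < s by rewrite /= in_itv/= => /andP[].
have E s : `]1, t[%classic s -> Lambda j t (fun y => f (A0k a f u0 k.+1 s y) - f (A0k a f u0 k s y)) x =
    Mpsi a f m k s * dgauss j t x.
  move=> /D1 s1; rewrite LambdaE// (A0kE k.+1 s1) (A0kE k s1); congr (_ * _).
  rewrite massE//; apply: L1B.
    exact: bd_L1 (fAk_bd q0 qb Cf0 f0 mf fL C0' s1 AC').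
  exact: bd_L1 (fAk_bd q0 qb Cf0 f0 mf fL C0 s1 AC).
have iM := Mpsi_integrable a q0 qb Cf0 f0 mf fL bs sigma0 sigma1 m ks t1.
rewrite -RintegralZr//.
have mi : measurable_fun `]1, t[ (fun s : Rb =>
    (Lambda j t (fun y => f (A0k a f u0 k.+1 s y) - f (A0k a f u0 k s y)) x)%:E).
  apply: (eq_measurable_fun (fun s : Rb => (Mpsi a f m k s * dgauss j t x)%:E)).
    by move=> s; rewrite inE => /E ->.
  apply/measurable_EFinP; apply: measurable_funM => //.
  by have /integrableP[/measurable_EFinP] := iM.
rewrite (integral_itv_bndoo _ _ mi) /Rintegral; congr fine.
by apply: eq_integral => s; rewrite inE => /E ->.
Qed.

End profiles.

Theorem theorem2p2 (R : realType) (n : nat) (a : n.-tuple R) (f : R -> R)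
    (k : nat) (u0 : n.-tuple R -> R) (u : R -> n.-tuple R -> R) :
  (0 < n)%N ->
  (exists j : 'I_n, tnth a j != 0) ->
  (* p = 1 + (k+2)/((k+1) n) *)
  let p : R := 1 + (k.+2)%:R / ((k.+1)%:R * n%:R) in
  (* f in C^1(R), f not identically 0, f(0) = 0, growth condition *)
  (forall x : R, derivable f x 1) -> continuous (derive1 f) ->
  (exists xi : R, f xi != 0) -> f 0 = 0 ->
  (exists C : R, forall xi eta : R,
     `|f xi - f eta| <= C * (`|xi| `^ (p - 1) + `|eta| `^ (p - 1)) * `|xi - eta|) ->
  (0 < k)%N ->
  (* u0 in L^1_1 cap L^oo *)
  measurable_fun setT u0 ->
  (Lqnorm 1%:E u0 < +oo)%E ->
  (forall j : 'I_n, (Lqnorm 1%:E (fun x => (tnth x j * u0 x)%R) < +oo)%E) ->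
  (Lqnorm +oo%E u0 < +oo)%E ->
  (* u is the global solution with initial datum u0 *)
  is_global_solution a f u0 u ->
  forall q : \bar R, (1%:E <= q)%E ->
  exists2 C : R, 0 < C &
    forall t : R, 2 ^+ k.+1 < t ->
      ((t `^ (n%:R / 2 * (1 - (if q is r%:E then r^-1 else 0))))%:E *
        Lqnorm q (fun x => (u t x - tildeA a f u0 k t x)%R)
       <= (C * t `^ (- (1/2)))%:E)%E.
Proof.
(* The positive k of the statement becomes k + 1, so that p - 1 = (k + 3) / ((k + 2) n) from here
   on. *)
move=> n0 _ p fd _ _ f0 [Cf0 fL0]; case: k @p fL0 => // k p fL0 _ mu0 u0L1 u0m u0oo Hu q q1.
have fc : continuous f by move=> x; apply: differentiable_continuous; apply/derivable1_diffP.
have mf : measurable_fun setT (f : measurableTypeR R -> measurableTypeR R) by exact: continuous_measurable_fun.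
have n0' : 0 < n%:R :> R by rewrite ltr0n.
pose r : R := k.+3%:R / (k.+2%:R * n%:R).
have pr : p - 1 = r by rewrite /p addrAC subrr add0r.
have r0 : 0 < r by rewrite divr_gt0// mulr_gt0.
(* The growth constant comes without a sign; its positive part satisfies the same inequality. *)
pose Cf := Num.max Cf0 0; have Cf1 : 0 <= Cf by rewrite le_max lexx orbT.
have fL xi eta : `|f xi - f eta| <= Cf * (`|xi| `^ r + `|eta| `^ r) * `|xi - eta|.
  apply: le_trans (fL0 xi eta) _; rewrite pr ler_wpM2r// ler_wpM2r ?addr_ge0 ?powR_ge0//.
  by rewrite le_max lexx.
(* This is (n/2)(p - 1) - 1/2, written so that (k + 2) sigma = 1/2 can be read off. *)
pose sigma : R := 1 / (2 * k.+2%:R); pose b := sigma + 1 / 2.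
have sigma0 : 0 < sigma by rewrite divr_gt0// mulr_gt0.
have sigma1 : sigma < 1 / 2.
  rewrite /sigma ltr_pdivrMr ?mulr_gt0// mulrA divfK// mul1r ltr1n//.
have ks : k.+2%:R * sigma = 1 / 2.
  rewrite /sigma; have : k.+2%:R != 0 :> R by rewrite pnatr_eq0.
  by move: (k.+2%:R) => w w0; field.
have qb : n%:R / 2 * r = b.
  rewrite /b /sigma /r -[k.+3%:R]natr1; have : k.+2%:R != 0 :> R by rewrite pnatr_eq0.
  have : n%:R != 0 :> R by rewrite gt_eqF.
  by move: (k.+2%:R) (n%:R) => w z z0 w0; field; rewrite w0.
have [mu_ [[B1 u1] [c1 [[B2 u2] [coo [_ mild0]]]]]] := Hu.
have iu0 := Lq1_L1 mu0 u0L1.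
have [K0 K00 u0K] := L1_L1le iu0; have [K1 K10 u0K1] := esssup_fin_ae mu0 u0oo.
(* One constant above all norms of u and of the datum. The added 1 gives the strict inequality from
   which an almost-everywhere bound is extracted, the essential supremum being an infimum. *)
pose B := K0 + K1 + `|B1| + `|B2| + 1.
have B1B : B1 <= B by rewrite /B; have := ler_norm B1; have := normr_ge0 B2; lra.
have B2B : B2 < B by rewrite /B; have := ler_norm B2; have := normr_ge0 B1; lra.
have K0B : K0 <= B by rewrite /B; have := normr_ge0 B2; have := normr_ge0 B1; lra.
have K1B : K1 <= B by rewrite /B; have := normr_ge0 B2; have := normr_ge0 B1; lra.
have u0b : bd 1 B u0.
  split; first exact: L1le_weak u0K.
  by rewrite hw1 mulr1; move: u0K1; apply: filterS => x /le_trans; apply.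
have ub t : 0 < t -> bd 1 B (u t).
  move=> t0; have mt := mu_ t (ltW t0); split.
    by apply: L1le_weak B1B _; apply: Lq1_L1le (u1 t (ltW t0)).
  rewrite hw1 mulr1; apply: esssup_lt_ae => //; apply: le_lt_trans (u2 t t0) _.
  by rewrite lte_fin.
have uc t0 : 0 < t0 -> forall e, 0 < e -> exists2 d, 0 < d & forall t, 0 < t -> `|t - t0| < d ->
    L1le (lebn R n) (fun x => u t x - u t0 x) e.
  move=> t00 e e0; have [d d0 H] := c1 t0 (ltW t00) e e0; exists d => // t t0' td.
  apply: Lq1_L1le; last exact: ltW (H t (ltW t0') td).
  by apply: measurable_funB; exact: mu_ (ltW _).
have ucoo t0 : 0 < t0 -> forall e, 0 < e -> exists2 d, 0 < d & forall t, 0 < t -> `|t - t0| < d ->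
    {ae lebn R n, forall x, `|u t x - u t0 x| <= e}.
  move=> t00 e e0; have [d d0 H] := coo t0 t00 e e0; exists d => // t t0' td.
  apply: esssup_lt_ae; last exact: H t t0' td.
  by apply: measurable_funB; exact: mu_ (ltW _).
have fuj lo hi t : 0 <= lo -> lo < hi -> hi <= t -> jmD a `]lo, hi[%classic t (fu f u).
  exact: (fu_jm a r0 qb Cf1 f0 mf fL ub uc).
have mild t : 0 < t -> {ae lebn R n, forall x, u t x = cv (gauss t) u0 x + Duh a `]0, t[%classic t (fu f u) x}.
  move=> t0; have mt := mu_ t (ltW t0).
  (* Once the right side is a convolution plus a jointly measurable time integral, the exceptional
     set of the Duhamel formula is measurable, and nullity in the iterated sense becomes an
     almost-everywhere identity. *)
  have E : (fun x => heat t u0 x + duhamel a f u 0 t t x) = (fun x => cv (gauss t) u0 x + Duh a `]0, t[%classic t (fu f u) x).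
    apply/funext => x; rewrite (heat_cv x t0 iu0); congr (_ + _); apply: duhamelE => //; last exact: fuj.
    by move=> s /andP[s0 _]; exact: bd_L1 (fu_bd r0 qb Cf1 f0 mf fL ub s0).
  apply: nullRn_ae _ (mild0 t t0) _; last first.
    by move=> x /= /contrapT ->; exact: (congr1 (fun g => g x) E).
  rewrite (_ : [set x | _] = [set x | u t x <> cv (gauss t) u0 x + Duh a `]0, t[%classic t (fu f u) x]).
    apply: measurable_neq => //; apply: measurable_funD.
      by apply: measurable_cv => //; exact: measurable_gaussr.
    by apply: measurable_tint; exact: fuj.
  by apply/seteqP; split => x /=; rewrite -(congr1 (fun g => g x) E).
have rst := restart r0 qb Cf1 f0 mf fL u0b ub uc mild.
have small := u_small r0 qb Cf1 f0 mf fL u0b ub uc mild fc n0.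
have [M M0 dec] := u_decay r0 qb Cf1 f0 mf fL (erefl b) sigma0 ub ucoo rst fuj small.
have ubt t : 0 < t -> bd t M (u t).
  move=> t0; have [h1 h2] := dec t t0; split => //; move: h2; apply: filterS => x /le_trans; apply.
  by rewrite ler_wpM2l// hw_mono// lerDr.
have usplit t : 1 < t -> {ae lebn R n, forall x, u t x = cv (gauss t) u0 x +
    Duh a `]0, 1[%classic t (fu f u) x + Duh a `]1, t[%classic t (fu f u) x}.
  move=> t1; have t0 : 0 < t by exact: lt_trans t1.
  move: (mild t t0); apply: filterS => x ->; rewrite -addrA; congr (_ + _).
  have iS := fu_slice_integrable a r0 qb Cf1 f0 mf fL u0b ub uc x (lexx 0) t0.
  exact: (tint_split ltr01 t1 iS).
have iw := L1_norm1 mu0 u0m.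
have [C1 C10 H1] := heat_moment_bd iu0 iw.
have hm : exists2 C, 0 <= C & forall t, 1 < t ->
    bd t (C * t `^ (- (1 / 2))) (fun x => cv (gauss t) u0 x - mass u0 * gauss t x).
  by exists C1 => // t t1; rewrite massE//; apply: H1; exact: lt_trans t1.
have [C C0 fin] := final_bd r0 qb Cf1 f0 mf fL (erefl b) sigma0 sigma1 ubt fuj usplit hm ks.
exists (C + 1); first by rewrite ltr_wpDl.
move=> t t2; have t1 : 1 < t by apply: le_lt_trans t2; rewrite exprn_ege1// ler1n.
have t0 : 0 < t by exact: lt_trans t1.
have tb : bd t (C * t `^ (- (1 / 2))) (fun x => u t x - tildeA a f u0 k.+1 t x).
  have := fin t t1; congr (bd _ _ _); apply/funext => x.
  by rewrite (tildeAE a r0 qb Cf1 f0 mf fL (erefl b) sigma0 sigma1 u0 x ks t1).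
apply: le_trans (bd_Lq t0 tb q1) _; rewrite lee_fin ler_wpM2r ?powR_ge0//.
by rewrite lerDl.
Qed.
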